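(* Suppose $d=1$, $u_0\equiv1$, $H_0\ge\frac12$ and $0<H<\frac12$, where $H=H_1$. Let $u_n$ be the $n$-th chaos candidate of the solution to the parabolic Anderson model $\partial_t u=\frac12\partial_x^2 u+u\dot W$ on $\mathbb{R}_+\times\mathbb{R}$. Then $\mathbb{E}[u_n(t,x)^2]<+\infty$ for every $(t,x)\in\mathbb{R}_+\times\mathbb{R}$ and all $n\ge1$ if and only if $$2H_0+H>\tfrac54.$$
   Context: Parameters. $H_0\in[1/2,1)$ is the temporal and $H\in(0,1)$ the spatial Hurst parameter (space dimension $1$). Noise. Let $\gamma_0(r)=H_0(2H_0-1)|r|^{2H_0-2}$ if $H_0>1/2$ and $\gamma_0=\delta_0$ (Dirac delta) if $H_0=1/2$. $\widehat{\varphi}(r,\xi)=\int_{\mathbb{R}}e^{-\iota \xi x}\varphi(r,x)dx$ denotes the Fourier transform in the spatial variable ($\iota=\sqrt{-1}$). $\mathfrak{H}$ is the Hilbert space completion of $C_0^\infty(\mathbb{R}_+\times\mathbb{R})$ for $\langle\varphi,\psi\rangle_{\mathfrak H}=\int_{\mathbb{R}_+^2\times\mathbb{R}}\widehat\varphi(r,\xi)\overline{\widehat\psi(s,\xi)}|\xi|^{1-2H}\gamma_0(r-s)\,dr\,ds\,d\xi$, and $W$ is an isonormal Gaussian process over $\mathfrak H$ (centered, $\mathbb{E}[W(\varphi)W(\psi)]=\langle\varphi,\psi\rangle_{\mathfrak H}$). $I_n$ is the $n$-th multiple Itô–Wiener integral with respect to $W$, so that $\mathbb{E}[I_n(f)^2]=n!\|f\|^2_{\mathfrak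 H^{\otimes n}}$ for symmetric $f$. Chaos candidates. The product $u\dot W$ is in the Itô–Skorohod sense. With $G_t(x)=(2\pi t)^{-1/2}e^{-x^2/(2t)}$ and $u_0\equiv1$, put $u_n(t,x)=I_n(\tilde f_n(t,x))$, where $$\tilde f_n(t,x;s_1,x_1,\dots,s_n,x_n)=\frac1{n!}\sum_\sigma\prod_{i=1}^nG_{s_{\sigma(i+1)}-s_{\sigma(i)}}(x_{\sigma(i+1)}-x_{\sigma(i)})\mathbf 1_{\{0<s_{\sigma(1)}<\cdots<s_{\sigma(n)}<t\}},$$ $\sigma$ runs over permutations of $\{1,\dots,n\}$, $\sigma(n+1)=n+1$, $s_{n+1}=t$, $x_{n+1}=x$. Thus $\mathbb{E}[u_n(t,x)^2]=n!\|\tilde f_n(t,x)\|^2_{\mathfrak H^{\otimes n}}\in[0,\infty]$, with $$\|f\|^2_{\mathfrak H^{\otimes n}}=\int_{\mathbb{R}_+^{2n}\times\mathbb{R}^{n}}\widehat f(r_1,\xi_1,\dots,r_n,\xi_n)\overline{\widehat f(s_1,\xi_1,\dots,s_n,\xi_n)}\prod_{i=1}^n|\xi_{i}|^{1-2H}\prod_{i=1}^n\gamma_0(r_i-s_i)\,dr\,ds\,d\xi,$$ interpreted as $+\infty$ when this integral diverges. *)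

(* Defs.v *)
From HB Require Import structures.
From mathcomp Require Import all_boot all_order all_algebra perm.
From mathcomp Require Import all_classical all_reals all_analysis.
From mathcomp Require Import complex.

Set Implicit Arguments.
Unset Strict Implicit.
Unset Printing Implicit Defensive.

Import Order.TTheory GRing.Theory Num.Theory.
Import numFieldNormedType.Exports.

Local Open Scope classical_set_scope.
Local Open Scope ring_scope.

(* The library declares this as an instance on [\x], but a later subprobability
   instance shadows it during inference. *)
Lemma sigma_finite_product_measure d1 d2 (T1 : measurableType d1)
    (T2 : measurableType d2) (R : realType)
    (m1 : {sigma_finite_measure set T1 -> \bar R})
    (m2 : {sigma_finite_measure set T2 -> \bar R}) :
  sigma_finite setT (m1 \x m2)%E.
Proof.
have /sigma_finiteP[F [TF ndF Foo]] := sigma_finiteT m1.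
have /sigma_finiteP[G [TG ndG Goo]] := sigma_finiteT m2.
exists (fun n => F n `*` G n).
  rewrite -setXTT TF TG predeqE => -[x y]; split.
    move=> [/= [n _ Fnx] [k _ Gky]]; exists (maxn n k) => //; split.
    - by move: x Fnx; exact/subsetPset/ndF/leq_maxl.
    - by move: y Gky; exact/subsetPset/ndG/leq_maxr.
  by move=> [n _ []/= ? ?]; split; exists n.
move=> k; have [? ?] := Foo k; have [? ?] := Goo k.
split; first exact: measurableX.
by rewrite product_measure1E// lte_mul_pinfty// ge0_fin_numE.
Qed.

Section tuple_cons_measure.
Context d (T : measurableType d) (R : realType) (n : nat).
Variables (m : {sigma_finite_measure set T -> \bar R})
          (mn : {sigma_finite_measure set (n.-tuple T) -> \bar R}).
Local Open Scope ereal_scope.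

Definition tuple_cons (p : T * n.-tuple T) : n.+1.-tuple T :=
  [the n.+1.-tuple T of p.1 :: p.2].

Lemma measurable_tuple_cons : measurable_fun setT tuple_cons.
Proof. exact: measurable_cons. Qed.

HB.instance Definition _ := isMeasurableFun.Build _ _ _ _ tuple_cons
  measurable_tuple_cons.

Definition tuple_cons_measure := pushforward (m \x mn) tuple_cons.

Let tcm0 : tuple_cons_measure set0 = 0.
Proof. exact: measure0. Qed.

Let tcm_ge0 A : 0 <= tuple_cons_measure A.
Proof. exact: measure_ge0. Qed.

Let tcm_sigma_additive : semi_sigma_additive tuple_cons_measure.
Proof. exact: measure_semi_sigma_additive. Qed.

HB.instance Definition _ := isMeasure.Build _ _ _ tuple_cons_measure
  tcm0 tcm_ge0 tcm_sigma_additive.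

Let tcm_sigma_finite : sigma_finite setT tuple_cons_measure.
Proof.
have [F TF Foo] := sigma_finite_product_measure m mn.
pose uncons (s : n.+1.-tuple T) := (thead s, [tuple of behead s]).
have uconsK : cancel tuple_cons uncons.
  by move=> [a s]; rewrite /uncons/=; congr pair; apply: val_inj.
have mu : measurable_fun setT uncons.
  apply: measurable_fun_pair; last exact: measurable_behead.
  exact: measurable_tnth.
exists (fun k => uncons @^-1` F k).
  by rewrite -preimage_bigcup -TF preimage_setT.
move=> k; have [mF Fk] := Foo k; split.
  by rewrite -[X in measurable X]setTI; exact: mu.
rewrite /tuple_cons_measure /pushforward.
by rewrite (_ : _ @^-1` _ = F k)//; apply/seteqP; split => p /=; rewrite uconsK.
Qed.

HB.instance Definition _ := Measure_isSigmaFinite.Build _ _ _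
  tuple_cons_measure tcm_sigma_finite.

End tuple_cons_measure.

(* The n-fold product of [m], on the product sigma-algebra of [n.-tuple T]. *)
Fixpoint tuple_measure d (T : measurableType d) (R : realType)
    (m : {sigma_finite_measure set T -> \bar R}) (n : nat) :
    {sigma_finite_measure set (n.-tuple T) -> \bar R} :=
  if n is k.+1 then tuple_cons_measure m (tuple_measure m k)
  else \d_ [tuple].

Lemma tuple_measure_box d (T : measurableType d) (R : realType)
    (m : {sigma_finite_measure set T -> \bar R}) n (A : 'I_n -> set T) :
  (forall i, measurable (A i)) ->
  (tuple_measure m n [set s | forall i, A i (tnth s i)]
   = \prod_(i < n) m (A i))%E.
Proof.
elim: n A => [|n IHn] A mA /=.
  rewrite big_ord0 diracE mem_set//= => -[].
  by [].
rewrite big_ord_recl /= -(IHn (fun i => A (lift ord0 i)))//.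
have mB : measurable [set s : n.-tuple T | forall i, A (lift ord0 i) (tnth s i)].
  rewrite (_ : [set _ | _] =
      \bigcap_(i in [set: 'I_n]) ((@tnth n T ^~ i) @^-1` A (lift ord0 i))).
    apply: fin_bigcap_measurable => // i _.
    by rewrite -[X in measurable X]setTI; exact: measurable_tnth.
  by apply/seteqP; split => s /= As i; [move=> _|]; exact: As.
rewrite -product_measure1E// /tuple_cons_measure /pushforward.
congr (_ _); apply/seteqP; split => -[a s] /=.
  by move=> As; split => [|i]; [have := As ord0|have := As (lift ord0 i)];
    rewrite ?tnthS.
move=> [Aa As] i; have [j ->|->] := unliftP ord0 i; last by [].
by rewrite tnthS; exact: As.
Qed.

Section complex_integral.
Context d (T : measurableType d) (R : realType).
Variables (mu : {measure set T -> \bar R}) (D : set T) (f : T -> R[i]).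

Definition cintegrable :=
  mu.-integrable D (fun x => (complex.Re (f x))%:E) &&
  mu.-integrable D (fun x => (complex.Im (f x))%:E).

Definition cintegral : R[i] :=
  Complex (\int[mu]_(x in D) complex.Re (f x)) (\int[mu]_(x in D) complex.Im (f x)).

(* For integrals that are real whenever they converge absolutely, such as the
   squared norms below; a divergent integral counts as +oo. *)
Definition cintegral_or_pinfty : \bar R :=
  if cintegrable then (complex.Re cintegral)%:E else +oo%E.

End complex_integral.

Section anderson_chaos.
Variable R : realType.

Definition expi (a : R) : R[i] := Complex (cos a) (sin a).

Definition leb n := tuple_measure (@lebesgue_measure R) n.

(* A function on (R_+ x R)^n: [f s x] is its value at
   (s_1, x_1, ..., s_n, x_n). *)
Definition spacetime_fun n := n.-tuple R -> n.-tuple R -> R.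

Definition fourier n (f : spacetime_fun n) (s xi : n.-tuple R) : R[i] :=
  cintegral (leb n) setT (fun x : n.-tuple R =>
    expi (- \sum_(j < n) tnth xi j * tnth x j) * Complex (f s x) 0).

Definition nonneg_tuples {n} : set (n.-tuple R) :=
  [set s | forall i, 0 <= tnth s i].

Definition gamma0 (H0 r : R) : R :=
  H0 * (2 * H0 - 1) * `|r| `^ (2 * H0 - 2).

Definition spectral_weight (H : R) n (xi : n.-tuple R) : R :=
  \prod_(i < n) `|tnth xi i| `^ (1 - 2 * H).

(* The squared norm of H^{(x) n}.  For H0 = 1/2 the temporal covariance is the
   Dirac delta, which collapses the two time variables into one. *)
Definition sqnorm (H0 H : R) n (f : spacetime_fun n) : \bar R :=
  if H0 == 2^-1 then
    cintegral_or_pinfty (leb n \x leb n)%E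
      (nonneg_tuples `*` setT)
      (fun p => let: (s, xi) := p in
         fourier f s xi * conjc (fourier f s xi)
         * Complex (spectral_weight H xi) 0)
  else
    cintegral_or_pinfty ((leb n \x leb n) \x leb n)%E
      ((nonneg_tuples `*` nonneg_tuples) `*` setT)
      (fun p => let: (r, s, xi) := p in
         fourier f r xi * conjc (fourier f s xi)
         * Complex (spectral_weight H xi
                    * \prod_(i < n) gamma0 H0 (tnth r i - tnth s i)) 0).

Definition heat_kernel (t x : R) : R :=
  (Num.sqrt (2 * pi * t))^-1 * expR (- (x ^+ 2 / (2 * t))).

(* s_(sigma(1)), ..., s_(sigma(n)), t *)
Definition permuted_path n (s : n.-tuple R) (sigma : 'S_n) (t : R) : seq R :=
  rcons [seq tnth s (sigma i) | i <- enum 'I_n] t.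

(* The condition [path <%R 0 _] is 0 < s_(sigma(1)) < ... < s_(sigma(n)) < t. *)
Definition chaos_kernel n (t x : R) : spacetime_fun n := fun s y =>
  (n`!%:R)^-1 * \sum_(sigma : 'S_n)
    (let tau := permuted_path s sigma t in
     let zeta := permuted_path y sigma x in
     (path <%R 0 tau)%:R *
     \prod_(i < n) heat_kernel (tau`_i.+1 - tau`_i) (zeta`_i.+1 - zeta`_i)).

(* E[u_n(t,x)^2] for u_n(t,x) = I_n(chaos_kernel t x), given by the isometry
   E[I_n(f)^2] = n! |f|^2 for symmetric f; by convention it is +oo when the norm is
   infinite, I_n(f) being then undefined. *)
Definition chaos_moment2 (H0 H : R) n (t x : R) : \bar R :=
  (n`!%:R)%:E * sqnorm H0 H (chaos_kernel (n := n) t x).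

End anderson_chaos.

(* Main.v *)
Require Import Defs.
From HB Require Import structures.
From mathcomp Require Import all_boot all_order all_algebra perm.
From mathcomp Require Import all_classical all_reals all_analysis.
From mathcomp Require Import measurable_realfun complex ring lra.

(** Write alpha = 2 - 2 H0 and beta = 1 - 2 H; the condition of the theorem is
    2 alpha + beta < 5/2.

    Reduction to a positive integral. For times in increasing order the chain of
    heat kernels has an explicit Fourier transform in space: a phase that
    depends only on the frequencies xi and the endpoint x, times the damping
    product of the exp(- (s_(j+1) - s_j) eta_j^2 / 2), where
    eta_j = xi_1 + ... + xi_j ([integral_cos_heat_chain]). The phase is the same
    for all orderings and all times, so it cancels in the squared norm
    ([fourier_chaos_kernel_conj]). Finiteness of the moment is then convergence
    of an integral of a nonnegative function: the product of two symbols, of the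
    spectral weight prod |xi_j|^beta and of the temporal kernels
    |r_j - s_j|^(- alpha).

    Sufficiency. Put u_j = 1 + eta_j^2. For fixed frequencies and two orderings
    sigma and tau of the times, the energy is at most the mass of one symbol
    times the supremum of the potential of the other; with the better of the two
    choices of roles this is at most the sum of the two products belonging to a
    single ordering ([pair_energy_le_diag]), and relabelling reduces to the
    identity ordering. The mass is at most C^n prod u_j^(- q) for every q < 1
    ([simplex_damping_integral_le]): Gaussian damping is traded for an integrable
    singularity in the gap. As for the weight, xi_j is the difference of
    eta_j and eta_(j-1), so |xi_j|^beta is at most a constant times
    max(u_j, u_(j-1))^(beta / 2), and u_j is charged twice, to the power beta,
    only when it is a local maximum of the sequence. At such a peak the damping
    of the gap that follows is used in the potential as well: it gains
    u_j^(- e), at the price of a singularity |s_j - s_(j+1)|^(- e) between two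
    poles of order alpha, which is integrable for alpha + e / 2 < 1
    ([three_point_le], [double_singular_bounded]). Two peaks are never adjacent,
    so the gains are independent ([riesz_damping_integral_le]). What remains is
    prod u_j^(- (q - m)) with m = max(beta / 2, beta - e), integrable in the
    variables eta_j when q - m > 1/2. One needs m < 1/2, hence
    beta - 1/2 < e < 2 - 2 alpha, and such an e exists exactly under the
    condition. For H0 = 1/2 the two time vectors coincide and there is no pole;
    charging every u_j to the power beta is then affordable, since beta < 1/2.

    Necessity. The second chaos at time 1 already diverges. Let xi_1 be in
    ]x, x + 1[ and xi_2 in ]- x - 1, - x[: the first frequency is damped only
    over times of order x^(-2) and the second partial sum is bounded. With times
    on a mesh of size 1 / (4 x^2), the density is at least of order
    x^(2 beta + 4 alpha) on x^2 disjoint boxes of volume (4 x^2)^(-4), and when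
    2 alpha + beta >= 5/2 their contribution is at least a multiple of 1 / x.
    Summing over the integers x gives the harmonic series
    ([harmonic_boxes_not_integrable]); the case H0 = 1/2 is similar. *)

Set Implicit Arguments.
Unset Strict Implicit.
Unset Printing Implicit Defensive.

Import Order.TTheory GRing.Theory Num.Theory.
Import numFieldNormedType.Exports.
Local Open Scope classical_set_scope.
Local Open Scope ring_scope.

(** * Integrals of nonnegative functions *)

Section nonneg_integral.
Context d (T : measurableType d) (R : realType).
Variable mu : {measure set T -> \bar R}.
Local Open Scope ereal_scope.

(** Monotonicity of the integral needs no measurability for nonnegative
    functions, the integral being a supremum over the simple functions below;
    this spares most measurability side conditions of the estimates. *)
Lemma le_nonneg_integral (f g : T -> \bar R) :
  (forall x, 0 <= f x) -> (forall x, f x <= g x) ->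
  \int[mu]_x f x <= \int[mu]_x g x.
Proof.
move=> f0 fg.
have g0 x : 0 <= g x by exact: le_trans (f0 x) (fg x).
rewrite !ge0_integralTE//; apply: ub_ereal_sup => _ [h hf <-].
by apply: ereal_sup_ubound; exists h => // x; exact: le_trans (hf x) (fg x).
Qed.

Lemma le_nonneg_integral_in (D : set T) (f g : T -> \bar R) :
  (forall x, D x -> 0 <= f x) -> (forall x, D x -> f x <= g x) ->
  \int[mu]_(x in D) f x <= \int[mu]_(x in D) g x.
Proof.
move=> f0 fg; rewrite integral_mkcond [leRHS]integral_mkcond.
apply: le_nonneg_integral => x; rewrite !patchE; case: ifPn => // /set_mem Dx.
  exact: f0.
exact: fg.
Qed.

Lemma ge0_integralZl_real (c : R) (f : T -> R) :
  (0 <= c)%R -> measurable_fun setT f -> (forall x, 0 <= f x)%R ->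
  \int[mu]_x (c * f x)%:E = c%:E * \int[mu]_x (f x)%:E.
Proof.
move=> c0 mf f0; under eq_integral do rewrite EFinM.
by rewrite ge0_integralZl// => [|x _]; rewrite ?lee_fin//; exact/measurable_EFinP.
Qed.

End nonneg_integral.

Lemma iterated_integral_le d1 d2 (X : measurableType d1) (Y : measurableType d2)
    (R : realType) (m1 : {measure set X -> \bar R}) (m2 : {measure set Y -> \bar R})
    (u : X -> R) (v : X -> Y -> R) (A B : R) :
  0 <= B -> (forall x, 0 <= u x) -> measurable_fun setT u ->
  (forall x y, 0 <= v x y) -> (forall x, measurable_fun setT (v x)) ->
  (\int[m1]_x (u x)%:E <= A%:E)%E -> (forall x, \int[m2]_y (v x y)%:E <= B%:E)%E ->
  (\int[m1]_x \int[m2]_y (u x * v x y)%:E <= (A * B)%:E)%E.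
Proof.
move=> B0 u0 mu v0 mv uA vB; apply: (@le_trans _ _ (\int[m1]_x (B * u x)%:E)%E).
  apply: le_nonneg_integral => x.
    by apply: integral_ge0 => y _; rewrite lee_fin mulr_ge0.
  rewrite [leLHS](ge0_integralZl_real m2 (u0 x) (mv x) (v0 x)).
  by rewrite mulrC EFinM lee_wpmul2l ?lee_fin.
rewrite [leLHS](ge0_integralZl_real m1 B0 mu u0) mulrC EFinM.
by rewrite lee_wpmul2l ?lee_fin.
Qed.

Section measurability.
Context d (T : measurableType d) (R : realType).

Lemma measurable_fun_natr (b : T -> bool) :
  measurable_fun setT b -> measurable_fun setT (fun x => (b x)%:R : R).
Proof. by move=> mb; apply: (@measurableT_comp _ _ _ _ _ _ (fun b : bool => b%:R : R)). Qed.

Lemma measurable_itv_natr (t : R) (f : T -> R) :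
  measurable_fun setT f -> measurable_fun setT (fun x => (0 < f x < t)%R%:R : R).
Proof.
by move=> mf; apply: measurable_fun_natr; apply: measurable_and; exact: measurable_fun_ltr.
Qed.

Lemma measurable_dist_powR (p : R) (f g : T -> R) :
  measurable_fun setT f -> measurable_fun setT g ->
  measurable_fun setT (fun x => `|f x - g x| `^ p).
Proof.
move=> mf mg; apply: (measurableT_comp (measurable_powR _)).
by apply: measurableT_comp => //; exact: measurable_funB.
Qed.

End measurability.

(** * Translations and power functions on the line *)

Section real_line.
Context {R : realType}.
Notation mu := (@lebesgue_measure R).
Local Open Scope ereal_scope.

Lemma lebesgue_measure_subl (c : R) (A : set R) : measurable A ->
  pushforward mu (fun x : measurableTypeR R => (c - x)%R : measurableTypeR R) A = mu A.
Proof.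
move=> mA.
have mf : measurable_fun setT (fun x : measurableTypeR R => (c - x)%R : measurableTypeR R).
  exact: measurable_funB.
apply/esym/lebesgue_measure_unique => //= _ [[a b] _ <-].
rewrite /pushforward.
have -> : (fun x : R => (c - x)%R) @^-1` `]a, b] = `[(c - b)%R, (c - a)%R[%classic.
  by apply/seteqP; split => x /=; rewrite !in_itv/= => /andP[? ?]; apply/andP; split; lra.
rewrite !lebesgue_measure_itv/= !lte_fin ltrD2l ltrN2.
by case: ifP => // _; rewrite -!EFinB; congr EFin; lra.
Qed.

Lemma ge0_integral_subl (c : R) (f : R -> \bar R) :
  measurable_fun setT f -> (forall x, 0 <= f x) ->
  \int[mu]_x f (c - x)%R = \int[mu]_x f x.
Proof.
move=> mf f0.
have mc : measurable_fun setT (fun x : measurableTypeR R => (c - x)%R : measurableTypeR R).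
  exact: measurable_funB.
rewrite -[LHS](@ge0_integral_pushforward _ _ _ _ _ _ mc mu setT f)//.
by apply: eq_measure_integral => //= A mA _; exact: lebesgue_measure_subl.
Qed.

Lemma ge0_integral_shift (c : R) (f : R -> \bar R) :
  measurable_fun setT f -> (forall x, 0 <= f x) ->
  \int[mu]_x f (c + x)%R = \int[mu]_x f x.
Proof.
move=> mf f0; rewrite -(ge0_integral_subl c mf f0).
rewrite -[RHS](ge0_integral_subl 0%R)//; last first.
  by apply: (measurableT_comp mf); exact: measurable_funB.
by apply: eq_integral => x _; rewrite sub0r opprK.
Qed.

Lemma integral_powR (p a b : R) : (0 < a)%R -> (a < b)%R -> (p != 1)%R ->
  \int[mu]_(x in `[a, b]) (x `^ (- p))%:E =
  ((b `^ (1 - p) - a `^ (1 - p)) / (1 - p))%:E.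
Proof.
move=> a0 ab p1.
have b0 : (0 < b)%R by apply: lt_trans ab.
have p0 : (1 - p != 0)%R by rewrite subr_eq0 eq_sym.
have [k kE] : exists k, k = (1 - p)^-1%R by exists (1 - p)^-1%R.
pose F (x : R) : R := (x `^ (1 - p) * k)%R.
have dF (x : R) : (0 < x)%R -> is_derive x 1%R F (x `^ (- p))%R.
  move=> x0; have ? := is_derive1_powR (1 - p) x0.
  rewrite /F; apply: is_derive_eq.
  rewrite /GRing.scale/= mulr0 add0r mulrA kE mulVf// mul1r.
  by congr (_ `^ _)%R; lra.
have cont (x : R) (q : R) : (0 < x)%R -> {for x, continuous (fun y : R => y `^ q)%R}.
  move=> x0; apply: differentiable_continuous; apply/derivable1_diffP.
  by have [] := is_derive1_powR q x0.
rewrite (@continuous_FTC2 _ _ F)//.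
- by rewrite -EFinB; congr EFin; rewrite /F -mulrBl kE.
- apply: continuous_in_subspaceT => x; rewrite inE/= in_itv/= => /andP[ax _].
  by apply: cont; exact: lt_le_trans ax.
- have cF (x : R) : (0 < x)%R -> F y @[y --> x] --> F x.
    move=> x0; apply: differentiable_continuous; apply/derivable1_diffP.
    by have [] := dF _ x0.
  split.
  + move=> x; rewrite in_itv/= => /andP[ax _].
    by have [] := dF _ (lt_trans a0 ax).
  + by apply: cvg_at_right_filter; exact: cF.
  + by apply: cvg_at_left_filter; exact: cF.
- move=> x; rewrite in_itv/= => /andP[ax _]; rewrite derive1E.
  by have [_ ->] := dF _ (lt_trans a0 ax).
Qed.

(** Monotone convergence: an improper integral inherits the bounds of the
    proper ones that exhaust it. *)
Lemma integral_powR_sup (p C : R) (F : (set R)^nat) :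
  nondecreasing_seq F -> (forall i, measurable (F i)) ->
  (forall i, \int[mu]_(x in F i) (x `^ (- p))%:E <= C%:E) ->
  \int[mu]_(x in \bigcup_i F i) (x `^ (- p))%:E <= C%:E.
Proof.
move=> ndF mF hC.
have mf i : measurable_fun (F i) (fun x : R => (x `^ (- p))%:E).
  by apply/measurable_EFinP; apply: measurable_funTS; exact: measurable_powR.
have h := ge0_nondecreasing_set_cvg_integral (mu := mu) ndF mF mf
  (fun i x _ => powR_ge0 _ _).
have/cvg_lim <- := h => //; apply: lime_le; first by apply/cvg_ex; eexists; exact: h.
by apply: nearW.
Qed.

Lemma integral_powR_near0 (p : R) : (0 <= p < 1)%R ->
  \int[mu]_(x in `]0%R, 1%R]) (x `^ (- p))%:E <= ((1 - p)^-1)%:E.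
Proof.
move=> /andP[p0 p1].
have -> : `]0%R, 1%R]%classic = \bigcup_n `[(n.+2%:R^-1 : R)%R, 1%R]%classic.
  apply/seteqP; split => x /=; last first.
    move=> [n _] /=; rewrite !in_itv/= => /andP[nx ->]; rewrite andbT.
    by apply: lt_le_trans nx; rewrite invr_gt0.
  rewrite in_itv/= => /andP[x0 x1]; exists (Num.truncn x^-1) => //=.
  rewrite in_itv/= x1 andbT -[leRHS]invrK lef_pV2 ?posrE ?invr_gt0//.
  rewrite (le_trans (ltW (Num.Theory.truncnS_gt _)))// ler_nat; exact: leqnSn.
apply: integral_powR_sup.
- apply/nondecreasing_seqP => n; apply/subsetPset => x /=; rewrite !in_itv/=.
  move=> /andP[nx ->]; rewrite andbT; apply: le_trans nx.
  by rewrite lef_pV2 ?posrE// ler_nat.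
- by move=> i; exact: measurable_itv.
- move=> n; rewrite integral_powR//.
  + rewrite lee_fin powR1 ler_pdivrMr ?subr_gt0// mulVf ?gt_eqF ?subr_gt0 //.
  + by rewrite invf_lt1// ltr1n.
  + by rewrite lt_eqF.
Qed.

Lemma integral_powR_tail (p : R) : (1 < p)%R ->
  \int[mu]_(x in `[1%R, +oo[) (x `^ (- p))%:E <= ((p - 1)^-1)%:E.
Proof.
move=> p1.
have -> : `[1%R, +oo[%classic = \bigcup_n `[1%R, (n.+2%:R : R)%R]%classic.
  apply/seteqP; split => x /=; last first.
    by move=> [n _] /=; rewrite !in_itv/= => /andP[-> _].
  rewrite in_itv/= andbT => x1; exists (Num.truncn x) => //=.
  rewrite in_itv/= x1/=.
  rewrite (le_trans (ltW (Num.Theory.truncnS_gt _)))// ler_nat; exact: leqnSn.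
apply: integral_powR_sup.
- apply/nondecreasing_seqP => n; apply/subsetPset => x /=; rewrite !in_itv/=.
  move=> /andP[-> nx] /=; apply: (le_trans nx).
  by rewrite ler_nat.
- by move=> i; exact: measurable_itv.
- move=> n; rewrite integral_powR ?ltr1n ?gt_eqF//.
  have p10 : (p - 1 != 0)%R by rewrite subr_eq0 gt_eqF.
  rewrite lee_fin powR1 -[(1 - p)%R]opprB invrN mulrN -mulNr opprB.
  rewrite ler_pdivrMr ?subr_gt0// mulVf//.
Qed.

End real_line.

(** * Even extensions and singular kernels on the line *)

Section singular.
Context {R : realType}.
Notation mu := (@lebesgue_measure R).
Local Open Scope ereal_scope.

Lemma ler_powRN_base (x y p : R) : (0 < x)%R -> (x <= y)%R -> (0 <= p)%R ->
  (y `^ (- p) <= x `^ (- p))%R.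
Proof.
move=> x0 xy p0; have y0 := lt_le_trans x0 xy.
rewrite !powRN lef_pV2 ?posrE ?powR_gt0//.
by apply: ge0_ler_powR => //; rewrite nnegrE ltW.
Qed.

Lemma powRN_le1 (x p : R) : (1 <= x)%R -> (0 <= p)%R -> (x `^ (- p) <= 1)%R.
Proof. by move=> x1 p0; have := ler_powRN_base ltr01 x1 p0; rewrite powR1. Qed.

Lemma integral_itv_natr (t : R) : (0 < t)%R ->
  \int[mu]_x ((0 < x < t)%R%:R)%:E = t%:E.
Proof.
move=> t0.
transitivity (\int[mu]_x (\1_([set` `]0%R, t[%R] : set R) x)%:E).
  by apply: eq_integral => x _; rewrite indicE mem_setE in_itv.
by rewrite integral_indic//= setIT lebesgue_measure_itv/= lte_fin t0 -EFinB subr0.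
Qed.

(** For D inside the half line of nonnegative numbers this is f(|x|) on the
    points with |x| in D, up to a harmless doubling at 0; it reduces integrals
    of even functions over the line to the half line. *)
Definition even_extension (D : set R) (f : R -> R) (x : R) : \bar R :=
  ((fun x => (f x)%:E) \_ D) x + ((fun x => (f x)%:E) \_ D) (- x)%R.

Section even_extension.
Variables (D : set R) (f : R -> R).
Hypotheses (mD : measurable D) (mf : measurable_fun setT f).
Hypothesis (f0 : forall x, (0 <= f x)%R).

Let h := (fun x => (f x)%:E) \_ D.

Let h0 x : 0 <= h x.
Proof. by rewrite /h patchE; case: ifPn => // _; rewrite lee_fin. Qed.

Let mh : measurable_fun setT h.
Proof.
apply: (iffLR (measurable_restrictT _ mD)); apply: measurable_funTS.
exact/measurable_EFinP.
Qed.

Let mhN : measurable_fun setT (fun x : R => h (- x)%R).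
Proof. by apply: (measurableT_comp mh); exact: measurable_funN. Qed.

Lemma even_extension_ge0 x : 0 <= even_extension D f x.
Proof. exact: adde_ge0. Qed.

Lemma measurable_even_extension : measurable_fun setT (even_extension D f).
Proof. exact: emeasurable_funD. Qed.

Lemma even_extension_norm_ge x : D `|x|%R -> (f `|x|%R)%:E <= even_extension D f x.
Proof.
have [x0 Dx|x0 Dx] := leP 0%R x.
  rewrite ger0_norm// in Dx *; rewrite /even_extension [X in _ <= X + _]patchE mem_set//=.
  by rewrite leeDl//; exact: h0.
rewrite ltr0_norm// in Dx *; rewrite /even_extension [X in _ <= _ + X]patchE mem_set//=.
by rewrite leeDr//; exact: h0.
Qed.

Lemma integral_even_extension_le (c : R) : \int[mu]_(x in D) (f x)%:E <= c%:E ->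
  \int[mu]_x even_extension D f x <= (c + c)%:E.
Proof.
move=> fc; have hc : \int[mu]_x h x <= c%:E by rewrite /h -integral_mkcond.
rewrite /even_extension ge0_integralD// EFinD leeD//.
rewrite [leLHS](_ : _ = \int[mu]_x h (0 - x)%R).
  by rewrite ge0_integral_subl.
by apply: eq_integral => x _; rewrite sub0r.
Qed.

End even_extension.

(** Away from its pole the kernel is at most 1, and near the pole it is a
    translate of the fixed integrable function |y|^-k on [-1, 1]: the bound does
    not depend on the position of the pole. *)
Lemma singular_kernel_bounded (t k : R) : (0 < t)%R -> (0 <= k < 1)%R ->
  exists2 C : R, (0 < C)%R & forall e : R,
    \int[mu]_x ((0 < x < t)%R%:R * `|e - x| `^ (- k))%:E <= C%:E.
Proof.
move=> t0 /andP[k0 k1].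
exists (t + ((1 - k)^-1 + (1 - k)^-1))%R.
  by rewrite addr_gt0// addr_gt0// invr_gt0 subr_gt0.
move=> e; pose f (x : R) := (x `^ (- k))%R.
pose D : set R := `[0%R, 1%R]%classic.
have mD : measurable D by exact: measurable_itv.
have mf : measurable_fun setT f by exact: measurable_powR.
have f0 x : (0 <= f x)%R by exact: powR_ge0.
have fI : \int[mu]_(x in D) (f x)%:E <= (1 - k)^-1%:E.
  rewrite /D -integral_itv_obnd_cbnd; first by apply: integral_powR_near0; rewrite k0 k1.
  by apply/measurable_EFinP/measurable_funTS.
have mH := measurable_even_extension mD mf.
have H0 := even_extension_ge0 D f0.
have mI : measurable_fun setT (fun x : R => ((0 < x < t)%R%:R)%:E : \bar R).
  by apply/measurable_EFinP; exact: measurable_itv_natr.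
have mHe : measurable_fun setT (fun x : R => even_extension D f (e - x)%R).
  by apply: (measurableT_comp mH); exact: measurable_funB.
apply: (@le_trans _ _ (\int[mu]_x (((0 < x < t)%R%:R)%:E + even_extension D f (e - x)%R))).
  apply: le_nonneg_integral => x; first by rewrite lee_fin mulr_ge0// powR_ge0.
  have [xe|xe] := leP `|e - x|%R 1%R; last first.
    by rewrite -[leLHS]adde0 leeD// lee_fin ler_piMr// powRN_le1//; exact: ltW.
  rewrite -[leLHS]add0e leeD ?lee_fin//.
  apply: (@le_trans _ _ ((`|e - x| `^ (- k))%:E)).
    by rewrite lee_fin ler_piMl ?powR_ge0//; case: (_ && _).
  by apply: even_extension_norm_ge => //; rewrite /D/= in_itv/= normr_ge0.
rewrite ge0_integralD// EFinD; apply: leeD; first by rewrite integral_itv_natr.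
by rewrite (ge0_integral_subl e mH H0); exact: integral_even_extension_le.
Qed.

(** The bracket is at least 1 and at least x^2: the first bound serves near the
    origin, the second at infinity, where 2 l > 1 is the threshold. *)
Lemma japanese_bracket_integrable (l : R) : (2^-1 < l)%R ->
  exists2 C : R, (0 < C)%R & \int[mu]_x ((1 + x ^+ 2) `^ (- l))%:E <= C%:E.
Proof.
move=> l2; exists (2 + ((2 * l - 1)^-1 + (2 * l - 1)^-1))%R.
  by rewrite addr_gt0// addr_gt0// invr_gt0; lra.
pose f (x : R) := (x `^ (- (2 * l)))%R.
pose D : set R := `[1%R, +oo[%classic.
have mD : measurable D by exact: measurable_itv.
have mf : measurable_fun setT f by exact: measurable_powR.
have f0 x : (0 <= f x)%R by exact: powR_ge0.
have fI : \int[mu]_(x in D) (f x)%:E <= (2 * l - 1)^-1%:E.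
  by apply: integral_powR_tail; lra.
have mH := measurable_even_extension mD mf.
have H0 := even_extension_ge0 D f0.
pose E : set R := `](-1)%R, 1%R[%classic.
have mE : measurable E by exact: measurable_itv.
have mI : measurable_fun setT (fun x : R => ((\1_E x)%:E : \bar R)).
  by apply/measurable_EFinP; exact: measurable_indic.
apply: (@le_trans _ _ (\int[mu]_x ((\1_E x : R)%:E + even_extension D f x))).
  apply: le_nonneg_integral => x; first by rewrite lee_fin powR_ge0.
  have bx : (1 <= 1 + x ^+ 2)%R by rewrite lerDl sqr_ge0.
  have [x1|x1] := ltP `|x|%R 1%R.
    rewrite -[leLHS]adde0 leeD// indicE mem_set ?lee_fin ?powRN_le1//; first lra.
    by rewrite /E/= in_itv/= -ltr_norml.
  rewrite -[leLHS]add0e leeD ?lee_fin//.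
  apply: le_trans (@even_extension_norm_ge D f f0 x _); last first.
    by rewrite /D/= in_itv/= x1.
  rewrite lee_fin /f (_ : (- (2 * l)) = 2 * - l)%R; last by lra.
  rewrite powRrM (powR_mulrn 2)// real_normK ?num_real//.
  apply: ler_powRN_base; [|by rewrite lerDr|lra].
  by rewrite -real_normK ?num_real// exprn_gt0//; lra.
rewrite ge0_integralD//; rewrite EFinD; apply: leeD; last exact: integral_even_extension_le.
rewrite integral_indic//= setIT lebesgue_measure_itv/= lte_fin ifT; last by lra.
by rewrite -EFinB lee_fin; lra.
Qed.

End singular.

(** * The Fourier transform of the heat kernel *)

Section gaussian.
Context {R : realType}.
Notation mu := (@lebesgue_measure R).

Lemma heat_kernel_normal_pdf (v y b : R) : 0 < v ->
  heat_kernel v (y - b) = normal_pdf y (Num.sqrt v) b.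
Proof.
move=> v0; rewrite normal_pdfE ?sqrtr_eq0 -?ltNge// /heat_kernel /normal_peak /normal_fun.
rewrite sqr_sqrtr ?ltW//; congr (_ * expR _).
  by congr (Num.sqrt _)^-1; rewrite -mulr_natl; ring.
by rewrite -[in LHS](opprB b y) sqrrN mulNr mulr_natl.
Qed.

Lemma heat_kernel_ge0 (v x : R) : 0 <= heat_kernel v x.
Proof. by rewrite mulr_ge0 ?expR_ge0// invr_ge0 sqrtr_ge0. Qed.

Lemma measurable_heat_kernel (v : R) : measurable_fun setT (@heat_kernel R v).
Proof.
apply: measurable_funM => //; apply: (measurableT_comp (@measurable_expR R)).
apply: measurable_funN; apply: measurable_funM => //.
Qed.

Lemma integral_heat_kernel (v y : R) : 0 < v ->
  (\int[mu]_b (heat_kernel v (y - b))%:E = 1)%E.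
Proof.
move=> v0; under eq_integral do rewrite heat_kernel_normal_pdf//.
exact: integral_normal_pdf.
Qed.

Lemma integrable_heat_kernel (v y : R) : 0 < v ->
  mu.-integrable setT (fun b => (heat_kernel v (y - b))%:E).
Proof.
move=> v0; under eq_fun do rewrite heat_kernel_normal_pdf//.
exact: integrable_normal_pdf.
Qed.

Lemma measurable_heat_kernel_sub (v y : R) :
  measurable_fun setT (fun b : R => heat_kernel v (y - b)).
Proof.
by apply: (measurableT_comp (measurable_heat_kernel v)); exact: measurable_funB.
Qed.

(** A factor |z| is absorbed by doubling the variance: this gives the integrable
    majorants needed to differentiate under the integral sign. *)
Lemma heat_kernel_moment_le (v : R) : 0 < v ->
  exists2 C : R, 0 < C & forall z, `|z| * heat_kernel v z <= C * heat_kernel (2 * v) z.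
Proof.
move=> v0.
pose k := (Num.sqrt (2 * pi * v))^-1 * Num.sqrt (2 * pi * (2 * v)).
have pi0 := pi_gt0 R.
have s0 : 0 < Num.sqrt (2 * pi * v) by rewrite sqrtr_gt0 !mulr_gt0.
have s20 : 0 < Num.sqrt (2 * pi * (2 * v)) by rewrite sqrtr_gt0 !mulr_gt0.
exists (k * (1 + 4 * v)) => [|z].
  by rewrite /k !mulr_gt0 ?invr_gt0 ?addr_gt0 ?mulr_gt0.
have zle : `|z| <= (1 + 4 * v) * expR (z ^+ 2 / (4 * v)).
  apply: (@le_trans _ _ ((1 + 4 * v) * (1 + z ^+ 2 / (4 * v)))); last first.
    by rewrite ler_wpM2l ?expR_ge1Dx ?addr_ge0 ?mulr_ge0 ?ltW.
  have -> : (1 + 4 * v) * (1 + z ^+ 2 / (4 * v)) =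
      1 + 4 * v + z ^+ 2 / (4 * v) + z ^+ 2 by field; rewrite gt_eqF.
  have q0 : 0 <= z ^+ 2 / (4 * v) by rewrite divr_ge0 ?sqr_ge0// mulr_ge0// ltW.
  have : `|z| <= 1 + z ^+ 2.
    by rewrite -real_normK ?num_real//; have := normr_ge0 z; nra.
  lra.
rewrite /heat_kernel /k.
have -> : expR (- (z ^+ 2 / (2 * v))) =
    expR (- (z ^+ 2 / (2 * (2 * v)))) * (expR (z ^+ 2 / (4 * v)))^-1.
  by rewrite -expRN -expRD; congr expR; field; rewrite gt_eqF.
set E := expR (- (z ^+ 2 / (2 * (2 * v)))).
have E0 : 0 < E by exact: expR_gt0.
have ez := expR_gt0 (z ^+ 2 / (4 * v)).
set s1 := Num.sqrt (2 * pi * v) in s0 *; set s2 := Num.sqrt _ in s20 *.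
set e := expR (z ^+ 2 / (4 * v)) in zle ez *.
have -> : s1^-1 * s2 * (1 + 4 * v) * (s2^-1 * E) = s1^-1 * E * (1 + 4 * v).
  by field; rewrite !gt_eqF.
have -> : `|z| * (s1^-1 * (E / e)) = s1^-1 * E * (`|z| / e) by field; rewrite !gt_eqF.
by rewrite ler_pM2l ?mulr_gt0 ?invr_gt0// ler_pdivrMr.
Qed.

Lemma heat_kernelN (v x : R) : heat_kernel v (- x) = heat_kernel v x.
Proof. by rewrite /heat_kernel sqrrN. Qed.

Lemma cvg_heat_kernel_nat (v y : R) : 0 < v ->
  heat_kernel v (y + n%:R) @[n --> \oo] --> (0 : R).
Proof.
move=> v0; pose c := Num.sqrt (2 * v).
have c0 : 0 < c by rewrite sqrtr_gt0 mulr_gt0.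
have -> : (fun n => heat_kernel v (y + n%:R)) =
    (fun n => (Num.sqrt (2 * pi * v))^-1 * gauss_fun ((y + n%:R) / c)).
  apply/funext => n; rewrite /heat_kernel /gauss_fun; congr (_ * expR (- _)).
  by rewrite expr_div_n /c sqr_sqrtr// ltW// mulr_gt0.
rewrite -[X in _ --> X](mulr0 (Num.sqrt (2 * pi * v))^-1); apply: cvgMl_tmp.
apply: (@cvg_comp _ _ _ (fun n : nat => (y + n%:R) / c) gauss_fun); last exact: cvg_gauss_fun.
apply/cvgryPge => A; near=> n; rewrite ler_pdivlMr// addrC -lerBlDr.
near: n; exact: nbhs_infty_ger.
Unshelve. all: by end_near. Qed.

(** The integral is the limit of the integrals over [-n, n], which are the
    increments F(n) - F(-n). *)
Lemma integral_derivative_eq0 (F f : R -> R) :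
  (forall x : R, is_derive x 1 F (f x)) -> continuous f ->
  mu.-integrable setT (EFin \o f) ->
  F n%:R @[n --> \oo] --> (0 : R) -> F (- n%:R) @[n --> \oo] --> (0 : R) ->
  \int[mu]_x f x = 0.
Proof.
move=> dF cf If Fy FNy.
pose g (n : nat) (x : R) : \bar R := ((EFin \o f) \_ `[- n%:R, n%:R]) x.
have mf : measurable_fun setT (EFin \o f) by case/integrableP: If.
have mg n : measurable_fun setT (g n).
  by apply: (iffLR (measurable_restrictT _ _)) => //; exact: measurable_funTS.
have gf : {ae mu, forall x, setT x -> g ^~ x @ \oo --> (EFin \o f) x}.
  apply: aeW => x _; apply: cvg_near_cst.
  near=> n; rewrite /g patchE mem_set//= in_itv/= -ler_norml.
  near: n; exact: nbhs_infty_ger.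
have gle : {ae mu, forall x n, setT x -> (`|g n x| <= `|(EFin \o f) x|)%E}.
  by apply: aeW => x n _; rewrite /g patchE; case: ifPn => //; rewrite abse0.
have [_ _] := @dominated_convergence _ (measurableTypeR R) R mu setT measurableT
  g _ _ mg mf gf (integrable_abse If) gle.
have cF (x : R) : F y @[y --> x] --> F x.
  by apply: differentiable_continuous; apply/derivable1_diffP; have [] := dF x.
have -> : [sequence \int[mu]_x g n x]_n%E =
    (fun n : nat => (F n%:R - F (- n%:R))%:E).
  apply/funext => n /=; rewrite /g -integral_mkcond.
  have [n0|n0] := posnP n.
    by rewrite n0 oppr0 subrr set_itv1 integral_set1.
  have nn : - n%:R < n%:R :> R by rewrite -subr_gt0 opprK addr_gt0 ?ltr0n.
  rewrite (@continuous_FTC2 _ f F _ _ nn)//.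
  - exact: continuous_subspaceT.
  - by split => [x _||]; [case: (dF x)|apply: cvg_at_right_filter|apply: cvg_at_left_filter].
  - by move=> x _; rewrite derive1E; case: (dF x).
move=> h.
have h0 : (fun n : nat => (F n%:R - F (- n%:R))%:E) @ \oo --> (0 : R)%:E.
  by apply: cvg_EFin; [exact: nearW|]; rewrite -[0]subr0; exact: cvgB.
rewrite /Rintegral; have -> : (\int[mu]_x (f x)%:E = 0)%E.
  by apply: cvg_unique h h0.
by [].
Unshelve. all: by end_near. Qed.

Lemma cos_phase_derive_time (p w v y b : R) : 0 < v ->
  is_derive b 1 (fun b => sin (p + w * (b - y)) * heat_kernel v (y - b))
    (w * cos (p + w * (b - y)) * heat_kernel v (y - b) +
     sin (p + w * (b - y)) * ((y - b) / v) * heat_kernel v (y - b)).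
Proof.
move=> v0; rewrite /heat_kernel.
have [k kE] : exists k, k = (2 * v)^-1 by exists (2 * v)^-1.
have [c cE] : exists c, c = (Num.sqrt (2 * pi * v))^-1 by eexists.
rewrite -cE -kE; apply: trigger_derive.
rewrite /GRing.scale/=; have -> : v^-1 = 2 * k by rewrite kE; field; rewrite gt_eqF.
set e := expR _; set a := cos _; set s := sin _; ring.
Qed.

Lemma cos_phase_derive_freq (p w v y b : R) :
  is_derive w 1 (fun w => cos (p + w * (b - y)) * heat_kernel v (y - b))
    ((y - b) * sin (p + w * (b - y)) * heat_kernel v (y - b)).
Proof.
set c := heat_kernel _ _; apply: trigger_derive.
rewrite /GRing.scale/=; set a := cos _; set s := sin _; ring.
Qed.

Lemma integrable_bounded_heat_kernel (v y C : R) (f : R -> R) : 0 < v -> 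
  measurable_fun setT f -> (forall b, `|f b| <= C) ->
  mu.-integrable setT (fun b => (f b * heat_kernel v (y - b))%:E).
Proof.
move=> v0 mf fC.
have C0 : 0 <= C by exact: le_trans (fC 0).
apply: (le_integrable _ _ _ (integrableZl measurableT C (integrable_heat_kernel y v0))) => //.
- apply/measurable_EFinP; apply: measurable_funM => //.
  exact: measurable_heat_kernel_sub.
- move=> b _; rewrite lee_fin.
  rewrite [leLHS]normrM [leRHS]normrM (ger0_norm C0) !(ger0_norm (heat_kernel_ge0 _ _)).
  by rewrite ler_wpM2r ?heat_kernel_ge0.
Qed.

Lemma integrable_moment_heat_kernel (v y : R) (f : R -> R) : 0 < v ->
  measurable_fun setT f -> (forall b, `|f b| <= 1) ->
  mu.-integrable setT (fun b => ((y - b) * f b * heat_kernel v (y - b))%:E).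
Proof.
move=> v0 mf f1; have [C C0 hC] := heat_kernel_moment_le v0.
have v20 : 0 < 2 * v by rewrite mulr_gt0.
apply: (le_integrable _ _ _ (integrableZl measurableT C (integrable_heat_kernel y v20))) => //.
- apply/measurable_EFinP; apply: measurable_funM => //; last first.
    exact: measurable_heat_kernel_sub.
  by apply: measurable_funM => //; exact: measurable_funB.
- move=> b _; rewrite lee_fin [leLHS]normrM [leRHS]normrM [X in X * _]normrM (gtr0_norm C0) !(ger0_norm (heat_kernel_ge0 _ _)).
  apply: le_trans (hC _); rewrite ler_wpM2r ?heat_kernel_ge0//.
  by rewrite ler_piMr.
Qed.

Lemma measurable_cos_phase (p w y : R) :
  measurable_fun setT (fun b : R => cos (p + w * (b - y))).
Proof.
apply: continuous_measurable_fun => b.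
apply: continuous_comp; last exact: continuous_cos.
by apply: cvgD; [exact: cvg_cst|apply: cvgMr; apply: cvgB; [exact: cvg_id|exact: cvg_cst]].
Qed.

Lemma measurable_sin_phase (p w y : R) :
  measurable_fun setT (fun b : R => sin (p + w * (b - y))).
Proof.
apply: continuous_measurable_fun => b.
apply: continuous_comp; last exact: continuous_sin.
by apply: cvgD; [exact: cvg_cst|apply: cvgMr; apply: cvgB; [exact: cvg_id|exact: cvg_cst]].
Qed.

Lemma normr_cos_le1 (x : R) : `|cos x| <= 1.
Proof. by rewrite ler_norml cos_geN1 cos_le1. Qed.

Lemma normr_sin_le1 (x : R) : `|sin x| <= 1.
Proof. by rewrite ler_norml sin_geN1 sin_le1. Qed.

(** Stein's identity: the integrand f2 on the left is, up to the factor v, the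
    part of the derivative of sin(p + w (b - y)) G_v(y - b) that comes from the
    Gaussian; the whole derivative integrates to 0. *)
Lemma gaussian_integration_by_parts (p w v y : R) : 0 < v ->
  \int[mu]_b ((y - b) * sin (p + w * (b - y)) * heat_kernel v (y - b)) =
  - (v * w) * \int[mu]_b (cos (p + w * (b - y)) * heat_kernel v (y - b)).
Proof.
move=> v0.
pose F b := sin (p + w * (b - y)) * heat_kernel v (y - b).
pose f1 b := cos (p + w * (b - y)) * heat_kernel v (y - b).
pose f2 b := (y - b) * sin (p + w * (b - y)) * heat_kernel v (y - b).
have If1 : mu.-integrable setT (EFin \o f1).
  by apply: (@integrable_bounded_heat_kernel v y 1) => //;
    [exact: measurable_cos_phase|move=> b; exact: normr_cos_le1].
have If2 : mu.-integrable setT (EFin \o f2).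
  by apply: integrable_moment_heat_kernel => //;
    [exact: measurable_sin_phase|move=> b; exact: normr_sin_le1].
have Iw : mu.-integrable setT (EFin \o (fun b => w * f1 b)).
  exact: (integrableZl measurableT w If1).
have Iv : mu.-integrable setT (EFin \o (fun b => v^-1 * f2 b)).
  exact: (integrableZl measurableT v^-1 If2).
have dF (b : R) : is_derive b 1 F (w * f1 b + v^-1 * f2 b).
  have := @cos_phase_derive_time p w v y b v0; congr is_derive.
  by rewrite /f1 /f2; field; rewrite gt_eqF.
have cF : F n%:R @[n --> \oo] --> (0 : R) /\ F (- n%:R) @[n --> \oo] --> (0 : R).
  split; apply: norm_cvg0.
    apply: (@squeeze_cvgr _ _ _ _ (cst 0) (fun n => heat_kernel v (- y + n%:R))).
    - apply: nearW => n; rewrite /cst normr_ge0/= /F normrM (ger0_norm (heat_kernel_ge0 _ _)).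
      rewrite -heat_kernelN opprD opprK.
      by rewrite ler_piMl ?heat_kernel_ge0// normr_sin_le1.
    - exact: cvg_cst.
    - exact: cvg_heat_kernel_nat.
  apply: (@squeeze_cvgr _ _ _ _ (cst 0) (fun n => heat_kernel v (y + n%:R))).
  - apply: nearW => n; rewrite /cst normr_ge0/= /F normrM (ger0_norm (heat_kernel_ge0 _ _)).
    by rewrite opprK ler_piMl ?heat_kernel_ge0// normr_sin_le1.
  - exact: cvg_cst.
  - exact: cvg_heat_kernel_nat.
have cont : continuous (fun b => w * f1 b + v^-1 * f2 b).
  have cb : continuous (fun b : R => y - b).
    by move=> b; apply: cvgB; [exact: cvg_cst|exact: cvg_id].
  have cp : continuous (fun b : R => p + w * (b - y)).
    by move=> b; apply: cvgD; [exact: cvg_cst|apply: cvgMr; apply: cvgB;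
      [exact: cvg_id|exact: cvg_cst]].
  have ch : continuous (fun b : R => heat_kernel v (y - b)).
    under [X in continuous X]eq_fun do rewrite heat_kernel_normal_pdf//.
    by apply: continuous_normal_pdf; rewrite sqrtr_eq0 -ltNge.
  have cc : continuous (fun b : R => cos (p + w * (b - y))).
    by move=> b; apply: continuous_comp; [exact: cp|exact: continuous_cos].
  have cs : continuous (fun b : R => sin (p + w * (b - y))).
    by move=> b; apply: continuous_comp; [exact: cp|exact: continuous_sin].
  move=> b; apply: cvgD; apply: cvgMr.
    by apply: cvgM; [exact: cc|exact: ch].
  by apply: cvgM; [apply: cvgM; [exact: cb|exact: cs]|exact: ch].
have IF : mu.-integrable setT (EFin \o (fun b => w * f1 b + v^-1 * f2 b)).
  exact: (integrableD measurableT Iw Iv).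
have := integral_derivative_eq0 dF cont IF cF.1 cF.2.
rewrite RintegralD// RintegralZl// RintegralZl// => /eqP.
rewrite addrC addr_eq0 => /eqP h.
have vn0 : v != 0 by rewrite gt_eqF.
transitivity (v * (v^-1 * \int[mu]_x f2 x)); first by rewrite mulrA mulfV// mul1r.
by rewrite h; ring.
Qed.

(** The integral, as a function h of the frequency, solves h' = - v w h: this is
    differentiation under the integral sign followed by Stein's identity.
    Carrying an arbitrary phase p makes the real and the imaginary part of the
    characteristic function two instances of one real identity. *)
Lemma integral_cos_heat_kernel (p w v y : R) : 0 < v ->
  \int[mu]_b (cos (p + w * b) * heat_kernel v (y - b)) =
  cos (p + w * y) * expR (- (v * w ^+ 2 / 2)).
Proof.
move=> v0; pose q := p + w * y.
pose h w := \int[mu]_b (cos (q + w * (b - y)) * heat_kernel v (y - b)).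
have dh (x : R) : is_derive x 1 h (- (v * x) * h x).
  pose f (x b : R) := cos (q + x * (b - y)) * heat_kernel v (y - b).
  pose G (b : R) := `|y - b| * heat_kernel v (y - b).
  have G0 b : 0 <= G b by rewrite mulr_ge0 ?heat_kernel_ge0.
  have IG : mu.-integrable setT (EFin \o G).
    have n1 (b : R) : `|(cst 1 : R -> R) b| <= 1 by rewrite normr1.
    have := integrable_abse (integrable_moment_heat_kernel y v0 (@measurable_cst _ _ _ _ setT (1 : R)) n1).
    congr (_.-integrable _ _); apply/funext => b /=.
    by rewrite mulr1 normrM (ger0_norm (heat_kernel_ge0 _ _)).
  have xI : `]x - 1, x + 1[%classic x by rewrite /= in_itv/=; lra.
  have If z : `]x - 1, x + 1[%classic z -> mu.-integrable setT (EFin \o f z).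
    move=> _; apply: (@integrable_bounded_heat_kernel v y 1) => //.
      exact: measurable_cos_phase.
    by move=> b; exact: normr_cos_le1.
  have df z b : `]x - 1, x + 1[%classic z -> [set: R] b -> derivable (f ^~ b) z 1.
    by move=> _ _; have [] := cos_phase_derive_freq q z v y b.
  have p1 z b : partial1of2 f z b = (y - b) * sin (q + z * (b - y)) * heat_kernel v (y - b).
    by rewrite partial1of2E; have [_ ->] := cos_phase_derive_freq q z v y b.
  have Gu z b : `]x - 1, x + 1[%classic z -> [set: R] b -> `|partial1of2 f z b| <= G b.
    move=> _ _; rewrite p1 [leLHS]normrM normrM (ger0_norm (heat_kernel_ge0 _ _)).
    by rewrite ler_wpM2r ?heat_kernel_ge0// ler_piMr// normr_sin_le1.
  have d1 := derivable_under_integral measurableT xI If df G0 IG Gu.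
  have d2 := differentiation_under_integral measurableT xI If df G0 IG Gu.
  apply: DeriveDef => //; rewrite -derive1E d2.
  under eq_Rintegral do rewrite p1.
  by rewrite gaussian_integration_by_parts.
pose k w := h w * expR (v * w ^+ 2 / 2).
have dk (x : R) : is_derive x 1 k 0.
  have ? := dh x; have [c cE] : exists c : R, c = 2^-1 by eexists.
  rewrite /k -cE; apply: trigger_derive; rewrite /GRing.scale/=.
  set e := expR _; rewrite cE; by field.
have := is_derive_0_is_cst w 0 dk; rewrite /k expr0n/= mulr0 mul0r expR0 mulr1.
have -> : h 0 = cos q.
  rewrite /h; under eq_Rintegral do rewrite mul0r addr0.
  by rewrite RintegralZl//; [rewrite /Rintegral integral_heat_kernel//= mulr1|
    exact: integrable_heat_kernel].
move=> hk; rewrite -/q -hk -[RHS]mulrA -expRD subrr expR0 mulr1 /h.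
apply: eq_Rintegral => b _; congr (cos _ * _); rewrite /q; ring.
Qed.

End gaussian.

(** * Iterated integrals over tuples and permutations of coordinates *)

Section tuple_integral.
Context {R : realType}.
Notation mu := (@lebesgue_measure R).
Notation T := (measurableTypeR R).
Local Open Scope ereal_scope.

Lemma measurable_fun_tuple0 d (U : measurableType d) (F : 0.-tuple T -> U) :
  measurable_fun setT F.
Proof.
move=> _ Y mY; rewrite setTI; set A := _ @^-1` _.
have [h|h] := pselect (A [tuple]).
  by rewrite (_ : A = setT)//; apply/seteqP; split => // x _; rewrite tuple0.
rewrite (_ : A = set0)//; apply/seteqP; split => // x Ax; apply: h.
by rewrite -(tuple0 x).
Qed.

Lemma integral_leb0 (F : 0.-tuple R -> \bar R) :
  \int[leb R 0]_s F s = F [tuple].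
Proof.
rewrite /leb /= integral_dirac//; first by rewrite diracT mul1e.
exact: measurable_fun_tuple0.
Qed.

(** The (n+1)-fold product is the image of mu x leb n under consing, so this is
    a change of variables followed by Tonelli; the first coordinate is the inner
    variable, which is how the earliest time is integrated out below. *)
Lemma ge0_integral_lebS n (F : n.+1.-tuple R -> \bar R) :
  measurable_fun setT F -> (forall s, 0 <= F s) ->
  \int[leb R n.+1]_s F s = \int[leb R n]_s \int[mu]_x F [tuple of x :: s].
Proof.
move=> mF F0.
have mc := @measurable_tuple_cons _ T n.
transitivity (\int[mu \x leb R n]_p (F \o tuple_cons (n:=n)) p).
  by rewrite {1}/leb /= [LHS](ge0_integral_pushforward mc).
apply: (@fubini_tonelli2 _ _ _ _ _ mu (leb R n) (F \o tuple_cons (n:=n))) => //.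
  exact: measurableT_comp.
by move=> x; exact: F0.
Qed.

Lemma integrable_lebS n (F : n.+1.-tuple R -> \bar R) :
  measurable_fun setT F ->
  \int[leb R n]_s \int[mu]_x `|F [tuple of x :: s]| < +oo ->
  (mu \x leb R n).-integrable setT (F \o tuple_cons (n:=n)).
Proof.
move=> mF h; apply/integrable21ltyP => //.
by apply: measurableT_comp => //; exact: measurable_tuple_cons.
Qed.

Lemma integral_lebS n (F : n.+1.-tuple R -> \bar R) :
  (leb R n.+1).-integrable setT F ->
  \int[leb R n.+1]_s F s = \int[leb R n]_s \int[mu]_x F [tuple of x :: s].
Proof.
move=> /integrableP[mF]; rewrite (@ge0_integral_lebS n (abse \o F))//=; last first.
  exact: (measurableT_comp (@abse_measurable R setT) mF).
move=> h.
have mc := @measurable_tuple_cons _ T n.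
transitivity (\int[mu \x leb R n]_p (F \o tuple_cons (n:=n)) p).
  by rewrite {1}/leb /= [LHS](integral_pushforward mc)//; exact: integrable_lebS.
apply/esym; apply: (@integral21_prod_meas1 _ _ _ _ _ mu (leb R n) (F \o tuple_cons (n:=n))).
exact: integrable_lebS.
Qed.

Definition tuple_perm (X : Type) n (sigma : 'S_n) (s : n.-tuple X) : n.-tuple X :=
  [tuple tnth s (sigma i) | i < n].

Lemma measurable_tuple_perm n (sigma : 'S_n) :
  measurable_fun setT (@tuple_perm T n sigma).
Proof.
apply/measurable_fun_tnthP => i.
rewrite (_ : _ \o _ = (@tnth n T) ^~ (sigma i)); first exact: measurable_tnth.
by apply/funext => s /=; rewrite tnth_mktuple.
Qed.

(** A pi-system generating the product sigma-algebra, on which the product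
    measure has a closed formula. *)
Definition boxes n : set (set (n.-tuple T)) :=
  [set B | exists2 A : 'I_n -> set T, (forall i, measurable (A i)) &
    B = [set s : n.-tuple R | forall i, A i (tnth s i)]].

Lemma measurable_box n (A : 'I_n -> set T) : (forall i, measurable (A i)) ->
  measurable ([set s | forall i, A i (tnth s i)] : set (n.-tuple T)).
Proof.
move=> mA; rewrite (_ : [set _ | _] =
      \bigcap_(i in [set: 'I_n]) ((@tnth n T ^~ i) @^-1` A i)).
  apply: fin_bigcap_measurable => // i _.
  by rewrite -[X in measurable X]setTI; exact: (@measurable_tnth _ T n i measurableT).
by apply/seteqP; split => s /= As i; [move=> _|]; exact: As.
Qed.

Lemma boxes_generate n : (@measurable _ (n.-tuple T)) = <<s @boxes n >>.
Proof.
apply/seteqP; split; last first.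
  apply: smallest_sub; first exact: sigma_algebra_measurable.
  by move=> _ [A mA ->]; exact: measurable_box.
apply: smallest_sub; first exact: smallest_sigma_algebra.
case: n => [|n]; first by rewrite big_ord0.
rewrite -bigcup_mkord_ord => A [i /= ilt [B mB <-]]; apply: sub_sigma_algebra.
exists (fun j => if j == inord i then B else setT) => [j|].
  by case: ifP.
rewrite setTI; apply/seteqP; split => s /=.
  by move=> Bs j; case: eqP => // ->.
by move=> /(_ (inord i)); rewrite eqxx.
Qed.

(** Permuting the coordinates turns a box into the box with permuted sides, of
    the same volume; measures agreeing on boxes agree everywhere, since space is
    exhausted by bounded boxes. *)
Lemma leb_tuple_perm n (sigma : 'S_n) (A : set (n.-tuple T)) : measurable A ->
  pushforward (leb R n) (@tuple_perm T n sigma) A = leb R n A.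
Proof.
move=> mA; have mp := measurable_tuple_perm sigma.
apply: (measure_unique (@boxes n)
  (fun k => [set s | forall i, `]- k%:R, k%:R[%classic%R (tnth s i)])) A mA => [||||C|].
- exact: boxes_generate.
- move=> _ _ [A mA ->] [B mB ->]; exists (fun i => A i `&` B i) => [i|].
    exact: measurableI.
  apply/seteqP; split => s /= => [[sA sB] i|sAB]; first by split.
  by split => i; have [] := sAB i.
- move=> k; exists (fun=> `]- k%:R, k%:R[%classic%R) => // i; exact: measurable_itv.
- apply/seteqP; split => // s _.
  pose M := (\sum_(i < n) `|tnth s i|)%R.
  exists (Num.truncn M).+1 => //= i; rewrite in_itv/= -ltr_norml.
  apply: le_lt_trans (Num.Theory.truncnS_gt _).
  by rewrite /M (bigD1 i)//= lerDl sumr_ge0.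
- move=> [B mB ->]; rewrite /= /pushforward.
  rewrite [X in leb R n X](_ : _ =
      [set s | forall i, B ((sigma^-1)%g i) (tnth s i)]); last first.
    apply/seteqP; split => s /= h i.
      by have := h ((sigma^-1)%g i); rewrite tnth_mktuple permKV.
    by have := h (sigma i); rewrite tnth_mktuple permK.
  rewrite (tuple_measure_box _ mB) (tuple_measure_box _ (fun i => mB ((sigma^-1)%g i))).
  rewrite (reindex_inj (@perm_inj _ sigma))/=.
  by apply: eq_bigr => i _; rewrite permK.
- move=> k; rewrite /= /pushforward.
  rewrite [X in leb R n X](_ : _ =
      [set s | forall i, `]- k%:R, k%:R[%classic%R (tnth s i)]); last first.
    apply/seteqP; split => s /= h i.
      by have := h ((sigma^-1)%g i); rewrite tnth_mktuple permKV.
    by rewrite tnth_mktuple.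
  rewrite (@tuple_measure_box _ _ _ mu n (fun=> `]- k%:R, k%:R[%classic%R)); last first.
    by move=> i; exact: measurable_itv.
  set p := \prod_(_ < _) _; suff : p \is a fin_num by rewrite fin_numElt => /andP[].
  rewrite /p; apply: (big_ind (fun x : \bar R => x \is a fin_num)) => // [x y|i _].
    exact: fin_numM.
  by rewrite /= lebesgue_measure_itv/=; case: ifP.
Qed.

Lemma ge0_integral_tuple_perm n (sigma : 'S_n) (F : n.-tuple R -> \bar R) :
  measurable_fun setT F -> (forall s, 0 <= F s) ->
  \int[leb R n]_s F (tuple_perm sigma s) = \int[leb R n]_s F s.
Proof.
move=> mF F0; have mp := measurable_tuple_perm sigma.
rewrite -[LHS](@ge0_integral_pushforward _ _ _ _ _ _ mp (leb R n) setT F)//.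
by apply: eq_measure_integral => /= A mA _; exact: leb_tuple_perm.
Qed.

Lemma integrable_tuple_perm n (sigma : 'S_n) (F : n.-tuple R -> \bar R) :
  (leb R n).-integrable setT F ->
  (leb R n).-integrable setT (F \o tuple_perm sigma).
Proof.
move=> /integrableP[mF Foo]; apply/integrableP; split.
  by apply: measurableT_comp => //; exact: measurable_tuple_perm.
rewrite (ge0_integral_tuple_perm sigma (F := fun s => `|F s|))//.
exact: measurableT_comp.
Qed.

Lemma integral_tuple_perm n (sigma : 'S_n) (F : n.-tuple R -> \bar R) :
  (leb R n).-integrable setT F ->
  \int[leb R n]_s F (tuple_perm sigma s) = \int[leb R n]_s F s.
Proof.
move=> IF; have [mF _] := integrableP _ _ _ IF.
have mp := measurable_tuple_perm sigma.
rewrite -[LHS](@integral_pushforward _ _ _ _ _ _ mp (leb R n) setT F)//; last first.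
  exact: integrable_tuple_perm.
by apply: eq_measure_integral => /= A mA _; exact: leb_tuple_perm.
Qed.

End tuple_integral.

(** * The Fourier transform of a chain of heat kernels *)

Section chain.
Context {R : realType}.
Notation mu := (@lebesgue_measure R).
Notation T := (measurableTypeR R).

(** Appending the end time t makes the last gap t - s_n a case like the others. *)
Definition gap (t : R) (s : seq R) (i : nat) : R :=
  (rcons s t)`_i.+1 - (rcons s t)`_i.

(** The offset w stands for the sum of the frequencies of coordinates already
    removed from the front of the tuple; it lets every induction on the tuple
    proceed by [freqS]. *)
Definition freq (w : R) (xi : seq R) (i : nat) : R := w + \sum_(j < i.+1) xi`_j.

Definition heat_chain n (t x : R) (s y : seq R) : R :=
  \prod_(i < n) heat_kernel (gap t s i) (gap x y i).

Definition damping n (t w : R) (s xi : seq R) : R :=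
  \prod_(i < n) expR (- (gap t s i * freq w xi i ^+ 2 / 2)).

Lemma freq0 w a xi : freq w (a :: xi) 0 = w + a.
Proof. by rewrite /freq big_ord_recl big_ord0 addr0. Qed.

Lemma freqS w a xi i : freq w (a :: xi) i.+1 = freq (w + a) xi i.
Proof. by rewrite /freq big_ord_recl addrA. Qed.

Lemma heat_chainS n t x a s b y :
  heat_chain n.+1 t x (a :: s) (b :: y) =
  heat_kernel ((rcons s t)`_0 - a) ((rcons y x)`_0 - b) * heat_chain n t x s y.
Proof. by rewrite /heat_chain big_ord_recl. Qed.

Lemma dampingS n t w a s b xi :
  damping n.+1 t w (a :: s) (b :: xi) =
  expR (- (((rcons s t)`_0 - a) * (w + b) ^+ 2 / 2)) * damping n t (w + b) s xi.
Proof.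
rewrite /damping big_ord_recl freq0; congr (_ * _); apply: eq_bigr => i _.
by rewrite freqS.
Qed.

Lemma heat_chain_ge0 n t x s y : 0 <= heat_chain n t x s y.
Proof. by apply: prodr_ge0 => i _; exact: heat_kernel_ge0. Qed.

Lemma damping_gt0 n t w s xi : 0 < damping n t w s xi.
Proof. by apply: prodr_gt0 => i _; exact: expR_gt0. Qed.

Section measurability.
Context d (U : measurableType d).

Lemma measurable_nth_tuple n (f : U -> n.-tuple T) (x : R) (i : nat) :
  measurable_fun setT f -> measurable_fun setT (fun u => nth x (f u) i : R).
Proof.
move=> mf; have [ni|ni] := ltnP i n; last first.
  rewrite (_ : (fun _ => _) = cst x)//; apply/funext => u.
  by rewrite nth_default// size_tuple.
rewrite (_ : (fun _ => _) = (@tnth n T ^~ (Ordinal ni)) \o f).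
  by apply: measurableT_comp => //; exact: measurable_tnth.
by apply/funext => u /=; rewrite (tnth_nth x).
Qed.

Lemma measurable_nth_rcons n (f : U -> n.-tuple T) (t : R) (i : nat) :
  measurable_fun setT f -> measurable_fun setT (fun u => (rcons (f u) t)`_i : R).
Proof.
move=> mf; have [ni|ni] := ltnP i n.
  rewrite (_ : (fun _ => _) = fun u => nth 0 (f u) i); first exact: measurable_nth_tuple.
  by apply/funext => u; rewrite nth_rcons size_tuple ni.
rewrite (_ : (fun _ => _) = cst (if i == n then t else 0))//.
by apply/funext => u; rewrite nth_rcons size_tuple ltnNge ni.
Qed.

Lemma measurable_gap n (f : U -> n.-tuple T) (t : R) (i : nat) :
  measurable_fun setT f -> measurable_fun setT (fun u => gap t (f u) i).
Proof. by move=> mf; apply: measurable_funB; exact: measurable_nth_rcons. Qed.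

Lemma measurable_freq n (f : U -> n.-tuple T) (w : R) (i : nat) :
  measurable_fun setT f -> measurable_fun setT (fun u => freq w (f u) i).
Proof.
move=> mf; apply: measurable_funD => //; apply: measurable_sum => j.
exact: measurable_nth_tuple.
Qed.

Lemma measurable_damping n (f g : U -> n.-tuple T) (t w : R) :
  measurable_fun setT f -> measurable_fun setT g ->
  measurable_fun setT (fun u => damping n t w (f u) (g u)).
Proof.
move=> mf mg; apply: measurable_prod => i _.
apply: (measurableT_comp (@measurable_expR R)).
apply: measurable_funN; apply: measurable_funM => //.
apply: measurable_funM; first exact: measurable_gap.
by apply: measurable_funX; exact: measurable_freq.
Qed.

Lemma measurable_heat_chain n (s : seq R) (f : U -> n.-tuple T) (t x : R) :
  measurable_fun setT f -> measurable_fun setT (fun u => heat_chain n t x s (f u)).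
Proof.
move=> mf; apply: measurable_prod => i _.
by apply: (measurableT_comp (measurable_heat_kernel _)); exact: measurable_gap.
Qed.

End measurability.

Definition increasing_gaps n (t : R) (s : seq R) := forall i, (i < n)%N -> 0 < gap t s i.

Lemma increasing_gapsS n t a s : increasing_gaps n.+1 t (a :: s) ->
  0 < (rcons s t)`_0 - a /\ increasing_gaps n t s.
Proof. by move=> h; split; [exact: (h 0)|move=> i ni; exact: (h i.+1)]. Qed.

Lemma integral_heat_chain n (t x : R) (s : n.-tuple R) : increasing_gaps n t s ->
  (\int[leb R n]_y (heat_chain n t x s y)%:E = 1)%E.
Proof.
elim: n s => [|n IH] s h.
  by rewrite integral_leb0 /heat_chain big_ord0.
case/tupleP: s h => a s /increasing_gapsS[g0 h].
rewrite ge0_integral_lebS; last 2 first.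
  by apply/measurable_EFinP; exact: measurable_heat_chain.
  by move=> y; rewrite lee_fin heat_chain_ge0.
rewrite -(IH s h); apply: eq_integral => y _.
under eq_integral do rewrite heat_chainS EFinM.
rewrite ge0_integralZr//.
- by rewrite integral_heat_kernel// mul1e.
- by apply/measurable_EFinP; exact: measurable_heat_kernel_sub.
- by move=> b _; rewrite lee_fin heat_kernel_ge0.
- by rewrite lee_fin heat_chain_ge0.
Qed.

Lemma integrable_cos_heat_chain n (t x : R) (s : n.-tuple R) (g : n.-tuple T -> R) :
  increasing_gaps n t s -> measurable_fun setT g ->
  (leb R n).-integrable setT (fun y => (cos (g y) * heat_chain n t x s y)%:E).
Proof.
move=> h mg.
have mh : measurable_fun setT (fun y : n.-tuple T => heat_chain n t x s y).
  exact: measurable_heat_chain.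
apply/integrableP; split.
  apply/measurable_EFinP; apply: measurable_funM => //.
  by apply: measurableT_comp mg; apply: continuous_measurable_fun; exact: continuous_cos.
rewrite (@le_lt_trans _ _ 1%E) ?ltry//.
rewrite -(integral_heat_chain x h); apply: le_nonneg_integral => y; first exact: abse_ge0.
rewrite /= lee_fin normrM (ger0_norm (heat_chain_ge0 _ _ _ _ _)).
by rewrite ler_piMl ?heat_chain_ge0// normr_cos_le1.
Qed.

Lemma measurable_phase n (w x : R) (xi : seq R) :
  measurable_fun setT (fun y : n.-tuple T =>
    w * (rcons y x)`_0 + \sum_(j < n) xi`_j * tnth y j).
Proof.
apply: measurable_funD.
  by apply: measurable_funM => //; apply: measurable_nth_rcons; exact: measurable_id.
apply: measurable_sum => j; apply: measurable_funM => //; exact: measurable_tnth.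
Qed.

(** The earliest variable b occurs in one kernel only. Integrating it out moves
    its phase (w + c) b onto the next variable and leaves the damping factor of
    the frequency w + c: the partial sums of the frequencies build up in the
    offset, and the last one ends up as the phase at the endpoint x. *)
Lemma integral_cos_heat_chain n (t x p w : R) (s xi : n.-tuple R) :
  increasing_gaps n t s ->
  (\int[leb R n]_y (cos (p + (w * (rcons y x)`_0 + \sum_(j < n) xi`_j * tnth y j))
     * heat_chain n t x s y)%:E =
  (cos (p + (w + \sum_(j < n) xi`_j) * x) * damping n t w s xi)%:E)%E.
Proof.
elim: n p w s xi => [|n IH] p w s xi h.
  by rewrite integral_leb0 /heat_chain /damping !big_ord0 /= !addr0.
rewrite integral_lebS; last first.
  apply: integrable_cos_heat_chain => //.
  by apply: measurable_funD => //; exact: measurable_phase.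
case/tupleP: s h => a s /increasing_gapsS[g0 h]; case/tupleP: xi => c xi.
transitivity (\int[leb R n]_y
   ((expR (- (((rcons s t)`_0 - a) * (w + c) ^+ 2 / 2)))%:E *
   (cos (p + ((w + c) * (rcons y x)`_0 + \sum_(j < n) xi`_j * tnth y j))
     * heat_chain n t x s y)%:E))%E.
  apply: eq_integral => y _.
  set q := \sum_(j < n) xi`_j * tnth y j.
  have -> : (\int[mu]_b (cos (p + (w * (rcons [tuple of b :: y] x)`_0 +
        \sum_(j < n.+1) [tuple of c :: xi]`_j * tnth [tuple of b :: y] j)) *
        heat_chain n.+1 t x [tuple of a :: s] [tuple of b :: y])%:E =
      \int[mu]_b ((heat_chain n t x s y)%:E * (cos ((p + q) + (w + c) * b) *
        heat_kernel ((rcons s t)`_0 - a) ((rcons y x)`_0 - b))%:E))%E.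
    apply: eq_integral => b _; rewrite -EFinM; congr EFin.
    rewrite [RHS]mulrCA heat_chainS /=; congr (cos _ * _); last by rewrite mulrC.
    rewrite big_ord_recl.
    have -> : \sum_(i < n) xi`_i * tnth [tuple of b :: y] (lift ord0 i) = q.
      by apply: eq_bigr => i _; rewrite tnthS.
    by rewrite tnth0 /=; ring.
  set z := (rcons y x)`_0.
  have Ic : mu.-integrable setT (fun b => (cos (p + q + (w + c) * b) *
        heat_kernel ((rcons s t)`_0 - a) (z - b))%:E).
    apply: (@integrable_bounded_heat_kernel _ _ _ 1) => //.
      have := @measurable_cos_phase R (p + q) (w + c) 0.
      by under [X in measurable_fun _ X -> _]eq_fun do rewrite subr0.
    by move=> b; exact: normr_cos_le1.
  rewrite integralZl//.
  have E := integral_cos_heat_kernel (p + q) (w + c) z g0.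
  rewrite -[X in (_ * X)%E](fineK (integrable_fin_num measurableT Ic)).
  rewrite [fine _]E -!EFinM; congr EFin.
  rewrite [LHS]mulrC -[LHS]mulrA [RHS]mulrCA.
  by congr (cos _ * _); rewrite /q; ring.
rewrite integralZl//; last first.
  apply: integrable_cos_heat_chain => //.
  by apply: measurable_funD => //; exact: measurable_phase.
rewrite IH// -EFinM; congr EFin.
rewrite mulrCA -dampingS; congr (cos (p + _ * x) * _).
by rewrite big_ord_recl/= addrA.
Qed.

End chain.

(** * The Fourier transform of the chaos kernel *)

Section chaos_fourier.
Context {R : realType}.
Notation mu := (@lebesgue_measure R).
Notation T := (measurableTypeR R).

Definition ordered (t : R) (s : seq R) : bool := path <%R 0 (rcons s t).

Definition simplex_damping n (t w : R) (s xi : seq R) : R :=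
  (ordered t s)%:R * damping n t w s xi.

(** The Fourier transform of the chaos kernel stripped of its phase, as
    [fourier_chaos_kernel] shows. *)
Definition chaos_symbol n (t : R) (s xi : n.-tuple R) : R :=
  (n`!%:R)^-1 * \sum_(sigma : 'S_n)
    simplex_damping n t 0 (tuple_perm sigma s) (tuple_perm sigma xi).

Lemma ordered_increasing_gaps n t (s : n.-tuple R) :
  ordered t s -> increasing_gaps n t s.
Proof.
move=> /(pathP 0) h i ni; rewrite /gap subr_gt0.
by have := h i.+1; rewrite size_rcons size_tuple ltnS => /(_ ni).
Qed.

Lemma chaos_kernelE n (t x : R) (s y : n.-tuple R) :
  chaos_kernel t x s y = (n`!%:R)^-1 * \sum_(sigma : 'S_n)
   ((ordered t (tuple_perm sigma s))%:R *
     heat_chain n t x (tuple_perm sigma s) (tuple_perm sigma y)).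
Proof. by []. Qed.

(** Relabelling the space variables by sigma reduces a term of the chaos kernel
    to the chain of the identity ordering; the phase is a sum over all
    coordinates, so relabelling the frequencies along with the variables
    preserves it. *)
Lemma integrable_cos_ordered_chain n (t x p : R) (s xi : n.-tuple R) (sigma : 'S_n) :
  (leb R n).-integrable setT (fun y => (cos (p + \sum_(j < n) tnth xi j * tnth y j) *
    ((ordered t (tuple_perm sigma s))%:R *
     heat_chain n t x (tuple_perm sigma s) (tuple_perm sigma y)))%:E) /\
  (\int[leb R n]_y (cos (p + \sum_(j < n) tnth xi j * tnth y j) *
    ((ordered t (tuple_perm sigma s))%:R *
     heat_chain n t x (tuple_perm sigma s) (tuple_perm sigma y)))%:E =
  (cos (p + (\sum_(j < n) tnth xi j) * x) *
    simplex_damping n t 0 (tuple_perm sigma s) (tuple_perm sigma xi))%:E)%E.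
Proof.
rewrite /simplex_damping; case: (boolP (ordered _ _)) => [ord_s|_]; last first.
  rewrite !mul0r mulr0; under eq_fun do rewrite mul0r mulr0.
  by split; [exact: integrable0|rewrite integral0].
have h := ordered_increasing_gaps ord_s.
set s' := tuple_perm sigma s; set xi' := tuple_perm sigma xi.
pose F (y : n.-tuple R) := (cos (p + (0 * (rcons y x)`_0 + \sum_(j < n) xi'`_j * tnth y j))
    * heat_chain n t x s' y)%:E.
have IF : (leb R n).-integrable setT F.
  apply: integrable_cos_heat_chain => //.
  by apply: measurable_funD => //; exact: measurable_phase.
have EF : (fun y => (cos (p + \sum_(j < n) tnth xi j * tnth y j) *
    (true%:R * heat_chain n t x s' (tuple_perm sigma y)))%:E) = F \o tuple_perm sigma.
  apply/funext => y; rewrite /F /= mul1r mul0r add0r; congr (cos (p + _) * _)%:E.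
  rewrite (reindex_inj (@perm_inj _ sigma))/=; apply: eq_bigr => j _.
  by rewrite -(tnth_nth 0 xi') !tnth_mktuple.
rewrite EF; split; first exact: integrable_tuple_perm.
rewrite (integral_tuple_perm sigma IF) /F integral_cos_heat_chain// mul1r add0r.
congr (cos (p + _ * _) * _)%:E.
rewrite [RHS](reindex_inj (@perm_inj _ sigma))/=; apply: eq_bigr => j _.
by rewrite -(tnth_nth 0 xi') tnth_mktuple.
Qed.

Lemma integral_cos_chaos_kernel n (t x p : R) (s xi : n.-tuple R) :
  \int[leb R n]_y (cos (p + \sum_(j < n) tnth xi j * tnth y j) * chaos_kernel t x s y) =
  cos (p + (\sum_(j < n) tnth xi j) * x) * chaos_symbol t s xi.
Proof.
suff E : (\int[leb R n]_y (cos (p + \sum_(j < n) tnth xi j * tnth y j) *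
    chaos_kernel t x s y)%:E =
    (cos (p + (\sum_(j < n) tnth xi j) * x) * chaos_symbol t s xi)%:E)%E.
  by rewrite /Rintegral E.
pose f sigma y := (cos (p + \sum_(j < n) tnth xi j * tnth y j) *
    ((ordered t (tuple_perm sigma s))%:R *
     heat_chain n t x (tuple_perm sigma s) (tuple_perm sigma y)))%:E.
have If sigma : (leb R n).-integrable setT (f sigma).
  by have [] := integrable_cos_ordered_chain t x p s xi sigma.
transitivity (\int[leb R n]_y (((n`!%:R)^-1)%:E * \sum_(sigma : 'S_n) f sigma y))%E.
  apply: eq_integral => y _; rewrite /f sumEFin -EFinM chaos_kernelE mulrCA mulr_sumr.
  by [].
rewrite integralZl//; last exact: integrable_sum.
rewrite integral_sum//.
under eq_bigr => sigma _ do
  rewrite (integrable_cos_ordered_chain t x p s xi sigma).2.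
by rewrite sumEFin -EFinM /= -mulr_sumr mulrCA.
Qed.

Lemma mul_Complex (a b c d : R) :
  Complex a b * Complex c d = Complex (a * c - b * d) (a * d + b * c).
Proof. by []. Qed.

Lemma fourier_chaos_kernel n (t x : R) (s xi : n.-tuple R) :
  fourier (chaos_kernel t x) s xi =
  expi (- ((\sum_(j < n) tnth xi j) * x)) * Complex (chaos_symbol t s xi) 0.
Proof.
rewrite /fourier /cintegral /expi.
set S := \sum_(j < n) tnth xi j.
rewrite mul_Complex !mulr0 subr0 add0r.
congr Complex.
  rewrite cosN -[S * x]add0r -integral_cos_chaos_kernel; apply: eq_Rintegral => y _.
  by rewrite mul_Complex /= mulr0 subr0 cosN add0r.
have sinNE (a : R) : sin (- a) = cos (pi / 2 + a) by rewrite sinN cosD cos_pihalf sin_pihalf; ring.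
rewrite sinNE -integral_cos_chaos_kernel; apply: eq_Rintegral => y _.
by rewrite mul_Complex /= mulr0 add0r sinNE.
Qed.

Lemma chaos_symbol_ge0 n (t : R) (s xi : n.-tuple R) : 0 <= chaos_symbol t s xi.
Proof.
rewrite mulr_ge0 ?invr_ge0// sumr_ge0// => sigma _.
by rewrite mulr_ge0// ltW// damping_gt0.
Qed.

(** The phase depends on the frequencies and on x but not on the times, so it
    cancels against its conjugate. The integrand of the squared norm is thus
    real and nonnegative, and finiteness of the moment is convergence of an
    integral of a positive function. *)
Lemma fourier_chaos_kernel_conj n (t x w : R) (r s xi : n.-tuple R) :
  fourier (chaos_kernel t x) r xi * conjc (fourier (chaos_kernel t x) s xi) * Complex w 0 =
  Complex (chaos_symbol t r xi * chaos_symbol t s xi * w) 0.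
Proof.
rewrite !fourier_chaos_kernel /expi; set a := - _.
set gr := chaos_symbol t r xi; set gs := chaos_symbol t s xi.
have := cos2Dsin2 a; set c := cos a; set d := sin a => cd.
rewrite mul_Complex !(mulr0, subr0, add0r) /= !mul_Complex; congr Complex; last by ring.
by rewrite -[RHS]mul1r -cd; ring.
Qed.

End chaos_fourier.

(** * Integrating out the earliest times *)

Section peeling.
Context {R : realType}.
Notation mu := (@lebesgue_measure R).
Notation T := (measurableTypeR R).

Lemma measurable_ordered n d (U : measurableType d) (t : R) (f : U -> n.-tuple T) :
  measurable_fun setT f -> measurable_fun setT (fun u => (ordered t (f u))%:R : R).
Proof.
move=> mf.
rewrite (_ : (fun _ => _) = fun u => \prod_(i < n.+1)
    ((0 :: rcons (f u) t)`_i < (rcons (f u) t)`_i)%R%:R); last first.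
  apply/funext => u; rewrite /ordered; case: (pathP 0) => h.
    by rewrite big1// => i _; rewrite h// size_rcons size_tuple.
  apply/esym/eqP; apply: contra_notT h => /prodf_neq0 h i.
  rewrite size_rcons size_tuple => ni.
  by have := h (Ordinal ni) isT; rewrite pnatr_eq0 eqb0 negbK.
apply: measurable_prod => i _; apply: measurable_fun_natr.
apply: measurable_fun_ltr; last exact: measurable_nth_rcons.
case: i => [[|i] ?] /=; first exact: measurable_cst.
exact: measurable_nth_rcons.
Qed.

Lemma ordered_cons (t a : R) s : ordered t (a :: s) ->
  [/\ 0 < a < t, a < (rcons s t)`_0 <= t & ordered t s].
Proof.
elim: s a => [|b s IH] a; rewrite /ordered/=.
  by rewrite !andbT => /andP[a0 alt]; rewrite a0 alt lexx (lt_trans a0 alt).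
move=> /and3P[a0 ab h]; have b0 : 0 < b by exact: lt_trans ab.
have /IH[/andP[_ bt] _ _] : ordered t (b :: s) by rewrite /ordered/= b0 h.
by rewrite a0 ab h b0 (lt_trans ab bt) ltW.
Qed.

(** The earliest time is the inner variable, so a bound on its integral that is
    uniform in the other times factors out. *)
Lemma le_integral_peel n (F : n.+1.-tuple R -> R) (h : n.-tuple R -> R)
    (k : n.-tuple R -> R -> R) (D : R) :
  measurable_fun setT F -> (forall s, 0 <= F s) ->
  measurable_fun setT h -> (forall s, 0 <= h s) ->
  (forall s, measurable_fun setT (k s)) -> (forall s a, 0 <= k s a) -> 0 <= D ->
  (forall s, \int[mu]_a (k s a)%:E <= D%:E)%E ->
  (forall (a : R) (s : n.-tuple R), F [tuple of a :: s] <= h s * k s a) ->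
  (\int[leb R n.+1]_s (F s)%:E <= D%:E * \int[leb R n]_s (h s)%:E)%E.
Proof.
move=> mF F0 mh h0 mk k0 D0 kD Fhk.
rewrite ge0_integral_lebS; last 2 first.
  exact/measurable_EFinP.
  by move=> s; rewrite lee_fin.
have -> : (D%:E * \int[leb R n]_s (h s)%:E = \int[leb R n]_s (D%:E * (h s)%:E))%E.
  by rewrite ge0_integralZl ?lee_fin// => [|s _]; rewrite ?lee_fin//; exact/measurable_EFinP.
apply: le_nonneg_integral => s.
  by apply: integral_ge0 => a _; rewrite lee_fin.
rewrite muleC; apply: (@le_trans _ _ (\int[mu]_a ((h s)%:E * (k s a)%:E)))%E.
  by apply: le_nonneg_integral => a; rewrite -?EFinM lee_fin.
have -> : (\int[mu]_a ((h s)%:E * (k s a)%:E) = (h s)%:E * \int[mu]_a (k s a)%:E)%E.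
  rewrite ge0_integralZl ?lee_fin//; first by apply/measurable_EFinP; exact: mk.
  by move=> a _; rewrite lee_fin.
by rewrite lee_wpmul2l ?lee_fin.
Qed.

(** The same with the two earliest times, integrated jointly: this is needed
    when the factor k couples them. *)
Lemma le_integral_peel2 n (F : n.+2.-tuple R -> R) (h : n.-tuple R -> R)
    (k : T * T -> R) (D : R) :
  measurable_fun setT F -> (forall s, 0 <= F s) ->
  measurable_fun setT h -> (forall s, 0 <= h s) ->
  measurable_fun setT k -> (forall p, 0 <= k p) -> 0 <= D ->
  (\int[mu]_b \int[mu]_a (k (a, b))%:E <= D%:E)%E ->
  (forall (a b : R) (s : n.-tuple R), F [tuple of a :: [tuple of b :: s]] <= h s * k (a, b)) ->
  (\int[leb R n.+2]_s (F s)%:E <= D%:E * \int[leb R n]_s (h s)%:E)%E.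
Proof.
move=> mF F0 mh h0 mk k0 D0 kD Fhk.
have mFE : measurable_fun setT (fun s => (F s)%:E) by exact/measurable_EFinP.
have mcomp : measurable_fun setT (fun p : T * n.+1.-tuple T => (F (tuple_cons p))%:E).
  by apply: (measurableT_comp mFE); exact: measurable_tuple_cons.
rewrite ge0_integral_lebS//.
rewrite ge0_integral_lebS; last 2 first.
- have := @measurable_fun_fubini_tonelli_G _ _ _ _ _ mu
    (fun p : T * n.+1.-tuple T => (F (tuple_cons p))%:E).
  by apply => // p; rewrite lee_fin.
- by move=> s; apply: integral_ge0 => a _; rewrite lee_fin.
have -> : (D%:E * \int[leb R n]_s (h s)%:E = \int[leb R n]_s (D%:E * (h s)%:E))%E.
  by rewrite ge0_integralZl ?lee_fin// => [|s _]; rewrite ?lee_fin//; exact/measurable_EFinP.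
have mka b : measurable_fun setT (fun a : T => (k (a, b))%:E).
  by apply/measurable_EFinP; apply: measurableT_comp mk _; exact: measurable_pair2.
have mkE : measurable_fun setT (fun p : T * T => (k p)%:E) by exact/measurable_EFinP.
apply: le_nonneg_integral => s.
  by apply: integral_ge0 => b _; apply: integral_ge0 => a _; rewrite lee_fin.
rewrite muleC.
apply: (@le_trans _ _ (\int[mu]_b ((h s)%:E * \int[mu]_a (k (a, b))%:E)))%E.
  apply: le_nonneg_integral => b.
    by apply: integral_ge0 => a _; rewrite lee_fin.
  rewrite -ge0_integralZl ?lee_fin//.
    by apply: le_nonneg_integral => a; rewrite -?EFinM lee_fin.
  by move=> a _; rewrite lee_fin.
have -> : (\int[mu]_b ((h s)%:E * \int[mu]_a (k (a, b))%:E) =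
    (h s)%:E * \int[mu]_b \int[mu]_a (k (a, b))%:E)%E.
  rewrite ge0_integralZl ?lee_fin//.
  - have := @measurable_fun_fubini_tonelli_G _ _ _ _ _ mu (fun p : T * T => (k p)%:E).
    by apply => // p; rewrite lee_fin.
  - by move=> b _; apply: integral_ge0 => a _; rewrite lee_fin.
by rewrite lee_wpmul2l ?lee_fin.
Qed.

End peeling.

(** * Two pointwise inequalities *)

Section pointwise.
Context {R : realType}.
Notation mu := (@lebesgue_measure R).
Notation T := (measurableTypeR R).

(** Gaussian decay in the frequency is traded for polynomial decay, at the price
    of a singularity of order e in the gap a: e^(-z) <= 1 / (1 + z) <=
    (1 + z)^(-e), and 1 + a y^2 / 2 dominates a multiple of a (1 + y^2) because
    a is bounded. *)
Lemma expR_le_powR (t e : R) : 0 < t -> 0 <= e <= 1 ->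
  exists2 C : R, 0 < C & forall a y, 0 < a < t ->
    expR (- (a * y ^+ 2 / 2)) <= C * a `^ (- e) * (1 + y ^+ 2) `^ (- e).
Proof.
move=> t0 /andP[e0 e1]; pose c : R := Num.min t^-1 2^-1.
have c0 : 0 < c by rewrite lt_min !invr_gt0 t0/= ltr0n.
exists (c `^ (- e)) => [|a y /andP[a0 alt]]; first exact: powR_gt0.
have y1 : 0 < 1 + y ^+ 2 by have := sqr_ge0 y; lra.
have -> : c `^ (- e) * a `^ (- e) * (1 + y ^+ 2) `^ (- e) = (c * a * (1 + y ^+ 2)) `^ (- e).
  by rewrite !powRM ?mulr_ge0//; exact: ltW.
have z0 : 0 < c * a * (1 + y ^+ 2) by rewrite !mulr_gt0.
have q0 : 0 <= a * y ^+ 2 / 2 by rewrite divr_ge0// mulr_ge0 ?sqr_ge0 ?ltW.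
have le1 : c * a * (1 + y ^+ 2) <= 1 + a * y ^+ 2 / 2.
  have ca : c * a <= 1.
    rewrite (@le_trans _ _ (t^-1 * t))//; last by rewrite mulVf ?gt_eqF.
    have ct : c <= t^-1 by rewrite /c ge_min lexx.
    by apply: ler_pM => //; exact: ltW.
  have cc : c <= 2^-1 by rewrite /c ge_min lexx orbT.
  have := sqr_ge0 y; set z := y ^+ 2 => z0'.
  have : c * (a * z) <= 2^-1 * (a * z) by apply: ler_wpM2r => //; apply: mulr_ge0 => //; exact: ltW.
  nra.
apply: (@le_trans _ _ ((1 + a * y ^+ 2 / 2) `^ (- e))); last exact: ler_powRN_base.
rewrite expRN powRN lef_pV2 ?posrE ?expR_gt0 ?powR_gt0 ?(lt_le_trans z0)//.
by rewrite (le_trans _ (expR_ge1Dx _))// ler1_powR// lerDl.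
Qed.

(** The power of the largest of the three numbers is handed over to the other
    two, the split being chosen so that each of them ends up with half of the
    total exponent 2 al + e. When the middle one is largest its exponent e is
    halved; when an outer one is, al - e / 2 goes to the middle and e / 2 to the
    other end. *)
Lemma three_point_le (x y w al e k : R) : 0 <= x -> 0 <= y -> 0 <= w ->
  0 < e -> e / 2 <= al -> k = al + e / 2 ->
  x `^ (- al) * y `^ (- e) * w `^ (- al) <=
  x `^ (- k) * y `^ (- k) + x `^ (- k) * w `^ (- k) + w `^ (- k) * y `^ (- k).
Proof.
move=> x0 y0 w0 e0 eal kE.
have al0 : 0 < al by lra.
have rhs0 : 0 <= x `^ (- k) * y `^ (- k) + x `^ (- k) * w `^ (- k) + w `^ (- k) * y `^ (- k).
  by rewrite !addr_ge0 ?mulr_ge0 ?powR_ge0.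
have [->|xn0] := eqVneq x 0.
  by rewrite powR0 ?mul0r ?oppr_eq0 ?gt_eqF// !addr_ge0 ?mulr_ge0 ?powR_ge0.
have [->|yn0] := eqVneq y 0.
  by rewrite (@powR0 _ (- e)) ?mulr0 ?mul0r ?oppr_eq0 ?gt_eqF// !addr_ge0 ?mulr_ge0 ?powR_ge0.
have [->|wn0] := eqVneq w 0.
  by rewrite (@powR0 _ (- al)) ?mulr0 ?oppr_eq0 ?gt_eqF// !addr_ge0 ?mulr_ge0 ?powR_ge0.
have {x0 xn0}x0 : 0 < x by rewrite lt_def xn0.
have {y0 yn0}y0 : 0 < y by rewrite lt_def yn0.
have {w0 wn0}w0 : 0 < w by rewrite lt_def wn0.
have pD (z p q : R) : 0 < z -> z `^ (- (p + q)) = z `^ (- p) * z `^ (- q).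
  by move=> z0; rewrite opprD powRD//; apply/implyP => _; rewrite gt_eqF.
have p0 (z p : R) : 0 <= z `^ p by exact: powR_ge0.
have e20 : 0 <= e / 2 by lra.
have ae0 : 0 <= al - e / 2 by lra.
have t1 := mulr_ge0 (p0 x (- k)) (p0 y (- k)).
have t2 := mulr_ge0 (p0 x (- k)) (p0 w (- k)).
have t3 := mulr_ge0 (p0 w (- k)) (p0 y (- k)).
have ymax : x <= y -> w <= y ->
    x `^ (- al) * y `^ (- e) * w `^ (- al) <= x `^ (- k) * w `^ (- k).
  move=> xy wy; rewrite kE !pD// [X in _ * y `^ (- X) * _](_ : e = e / 2 + e / 2); last by lra.
  rewrite pD//.
  rewrite -[leRHS](_ : x `^ (- al) * (x `^ (- (e / 2)) * w `^ (- (e / 2))) * w `^ (- al) = _); last by ring.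
  by rewrite ler_wpM2r// ler_wpM2l// ler_pM// ler_powRN_base.
have xmax a b c : 0 < a -> 0 < b -> 0 < c -> b <= a -> c <= a ->
    a `^ (- al) * b `^ (- e) * c `^ (- al) <= b `^ (- k) * c `^ (- k).
  move=> a0 b0 c0 ba ca; rewrite kE (pD c)//.
  rewrite [X in a `^ (- X)](_ : al = (al - e / 2) + e / 2); last by lra.
  rewrite (pD a)// [X in b `^ (- X) * (_ * _)](_ : _ = (al - e / 2) + e); last by lra.
  rewrite (pD b)//.
  rewrite [leLHS](_ : _ = (a `^ (- (al - e / 2)) * a `^ (- (e / 2))) * (b `^ (- e) * c `^ (- al))); last by ring.
  rewrite [leRHS](_ : _ = (b `^ (- (al - e / 2)) * c `^ (- (e / 2))) * (b `^ (- e) * c `^ (- al))); last by ring.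
  by rewrite ler_wpM2r ?mulr_ge0// ler_pM// ler_powRN_base.
have [xy|yx] := leP x y.
  have [wy|yw] := leP w y.
    by apply: (le_trans (ymax xy wy)); lra.
  apply: le_trans (_ : x `^ (- k) * y `^ (- k) <= _); last lra.
  rewrite mulrC [leRHS]mulrC mulrA mulrAC.
  by rewrite xmax// ltW// (le_lt_trans xy).
have [wx|xw] := leP w x.
  apply: le_trans (_ : w `^ (- k) * y `^ (- k) <= _); last lra.
  by rewrite [leRHS]mulrC xmax// ltW.
apply: le_trans (_ : x `^ (- k) * y `^ (- k) <= _); last lra.
rewrite mulrC [leRHS]mulrC mulrA mulrAC.
by rewrite xmax// ltW// (lt_trans yx).
Qed.

End pointwise.

(** * Two poles and a diagonal singularity *)

Section singular_pairs.
Context {R : realType}.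
Notation mu := (@lebesgue_measure R).
Notation T := (measurableTypeR R).

Definition singular_kernel (t k e a : R) : R := (0 < a < t)%R%:R * `|e - a| `^ (- k).

Lemma singular_kernel_ge0 t k e a : 0 <= singular_kernel t k e a.
Proof. by rewrite mulr_ge0 ?powR_ge0. Qed.

Lemma measurable_singular_kernel d (U : measurableType d) (t k : R) (f g : U -> T) :
  measurable_fun setT f -> measurable_fun setT g ->
  measurable_fun setT (fun u => singular_kernel t k (f u) (g u)).
Proof.
by move=> mf mg; apply: measurable_funM; [exact: measurable_itv_natr|exact: measurable_dist_powR].
Qed.

(** Two poles of order al at r1 and r2 and a singularity of order e on the
    diagonal: by the three-point inequality the integrand is at most a sum of
    products of two poles of order al + e / 2 < 1 in which one of the variables
    occurs in a single factor, so that they can be integrated one after the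
    other, uniformly in r1 and r2. *)
Lemma double_singular_bounded (t al e : R) : 0 < t -> 0 < e -> e / 2 <= al ->
  al + e / 2 < 1 ->
  exists2 D : R, 0 < D & forall r1 r2 : R,
    (\int[mu]_b \int[mu]_a
      ((0 < a < t)%R%:R * (0 < b < t)%R%:R *
       (`|r1 - a| `^ (- al) * `|b - a| `^ (- e) * `|r2 - b| `^ (- al)))%:E <= D%:E)%E.
Proof.
move=> t0 e0 eal k1; pose k := al + e / 2.
have k01 : 0 <= k < 1 by rewrite /k k1 andbT; lra.
have [C C0 hC] := singular_kernel_bounded t0 k01.
exists (C * C + C * C + C * C) => [|r1 r2]; first by rewrite !addr_gt0 ?mulr_gt0.
pose T1 (p : T * T) := (singular_kernel t k r1 p.1 * singular_kernel t k p.1 p.2)%:E.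
pose T2 (p : T * T) := (singular_kernel t k r1 p.1 * singular_kernel t k r2 p.2)%:E.
pose T3 (p : T * T) := (singular_kernel t k r2 p.2 * singular_kernel t k p.2 p.1)%:E.
have m1 : measurable_fun setT T1.
  by apply/measurable_EFinP; apply: measurable_funM; exact: measurable_singular_kernel.
have m2 : measurable_fun setT T2.
  by apply/measurable_EFinP; apply: measurable_funM; exact: measurable_singular_kernel.
have m3 : measurable_fun setT T3.
  by apply/measurable_EFinP; apply: measurable_funM; exact: measurable_singular_kernel.
have p1 p : (0 <= T1 p)%E by rewrite lee_fin mulr_ge0 ?singular_kernel_ge0.
have p2 p : (0 <= T2 p)%E by rewrite lee_fin mulr_ge0 ?singular_kernel_ge0.
have p3 p : (0 <= T3 p)%E by rewrite lee_fin mulr_ge0 ?singular_kernel_ge0.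
have msr z : measurable_fun setT (singular_kernel t k z : T -> R).
  exact: measurable_singular_kernel.
have chained (w : R -> R) r :
    (\int[mu]_a \int[mu]_b (singular_kernel t k r a * singular_kernel t k (w a) b)%:E
     <= (C * C)%:E)%E.
  apply: (@iterated_integral_le _ _ T T R mu mu (singular_kernel t k r)
    (fun a => singular_kernel t k (w a)) C C (ltW C0)) => //.
  - exact: singular_kernel_ge0.
  - by move=> a b; exact: singular_kernel_ge0.
  - exact: hC.
  - by move=> a; exact: hC.
pose K (p : T * T) : \bar R := ((0 < p.1 < t)%R%:R * (0 < p.2 < t)%R%:R *
   (`|r1 - p.1| `^ (- al) * `|p.2 - p.1| `^ (- e) * `|r2 - p.2| `^ (- al)))%:E.
have mK : measurable_fun setT K.
  apply/measurable_EFinP; apply: measurable_funM.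
    by apply: measurable_funM; exact: measurable_itv_natr.
  by apply: measurable_funM; first apply: measurable_funM; exact: measurable_dist_powR.
have K0 p : (0 <= K p)%E by rewrite lee_fin !mulr_ge0 ?powR_ge0.
rewrite -(fubini_tonelli2 K mK K0).
apply: (@le_trans _ _ (\int[mu \x mu]_p (T1 p + T2 p + T3 p))%E).
  apply: le_nonneg_integral => -[a b] /=; first by rewrite lee_fin !mulr_ge0 ?powR_ge0.
  rewrite -!EFinD lee_fin /singular_kernel/=.
  case: (0 < a < t); last by rewrite !(mul0r, mulr0, addr0).
  case: (0 < b < t); last by rewrite !(mul0r, mulr0, addr0).
  rewrite !mul1r (distrC a b).
  exact: three_point_le.
have m12 : measurable_fun setT (fun p => T1 p + T2 p)%E by exact: emeasurable_funD.
have p12 p : (0 <= T1 p + T2 p)%E by rewrite adde_ge0.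
rewrite ge0_integralD// ge0_integralD// !EFinD; apply: leeD; first apply: leeD.
- by rewrite (fubini_tonelli1 T1 m1 p1); exact: (chained id).
- by rewrite (fubini_tonelli1 T2 m2 p2); exact: (chained (fun=> r2)).
- by rewrite (fubini_tonelli2 T3 m3 p3); exact: (chained id).
Qed.

End singular_pairs.

(** * Peeling a chain of times *)

Section peeling_estimates.
Context {R : realType}.
Notation mu := (@lebesgue_measure R).
Notation T := (measurableTypeR R).

Definition bracket_prod n (q w : R) (xi : seq R) : R :=
  \prod_(i < n) (1 + freq w xi i ^+ 2) `^ q.

(** A majorant of the product of the |xi_j|^(2 p), up to constants: xi_j is a
    difference of consecutive partial sums, hence the maximum of the two
    brackets; u0 is the bracket of the partial sum that precedes xi. *)
Fixpoint max_bracket_prod (p u0 w : R) (xi : seq R) : R :=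
  if xi is c :: xi' then
    Num.max u0 (1 + (w + c) ^+ 2) `^ p *
    max_bracket_prod p (1 + (w + c) ^+ 2) (w + c) xi'
  else 1.

Definition riesz_prod n (al : R) (r s : seq R) : R :=
  \prod_(i < n) `|r`_i - s`_i| `^ (- al).

Lemma bracket_ge1 (y : R) : 1 <= 1 + y ^+ 2.
Proof. by rewrite lerDl sqr_ge0. Qed.

Lemma bracket_gt0 (y : R) : 0 < 1 + y ^+ 2.
Proof. exact: lt_le_trans (bracket_ge1 y). Qed.

Lemma bracket_prodS n (q w c : R) xi : bracket_prod n.+1 q w (c :: xi) =
  (1 + (w + c) ^+ 2) `^ q * bracket_prod n q (w + c) xi.
Proof.
rewrite /bracket_prod big_ord_recl freq0; congr (_ * _).
by apply: eq_bigr => i _; rewrite freqS.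
Qed.

Lemma bracket_prod_gt0 n (q w : R) xi : 0 < bracket_prod n q w xi.
Proof. by apply: prodr_gt0 => i _; rewrite powR_gt0// bracket_gt0. Qed.

Lemma max_bracket_prod_gt0 (p u0 w : R) xi : 0 < u0 -> 0 < max_bracket_prod p u0 w xi.
Proof.
elim: xi u0 w => //= c xi IH u0 w u00; rewrite mulr_gt0//.
  by rewrite powR_gt0// lt_max u00.
by rewrite IH// bracket_gt0.
Qed.

Lemma riesz_prodS n (al a : R) r b s : riesz_prod n.+1 al (a :: r) (b :: s) =
  `|a - b| `^ (- al) * riesz_prod n al r s.
Proof. by rewrite /riesz_prod big_ord_recl. Qed.

Lemma riesz_prod_ge0 n (al : R) r s : 0 <= riesz_prod n al r s.
Proof. by apply: prodr_ge0 => i _; exact: powR_ge0. Qed.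

Lemma simplex_damping_ge0 n (t w : R) s xi : 0 <= simplex_damping n t w s xi.
Proof. by rewrite mulr_ge0// ltW// damping_gt0. Qed.

Lemma measurable_simplex_damping n d (U : measurableType d) (t w : R)
    (f g : U -> n.-tuple T) :
  measurable_fun setT f -> measurable_fun setT g ->
  measurable_fun setT (fun u => simplex_damping n t w (f u) (g u)).
Proof.
move=> mf mg; apply: measurable_funM; first exact: measurable_ordered.
exact: measurable_damping.
Qed.

Lemma measurable_riesz_prod n d (U : measurableType d) (al : R)
    (f g : U -> n.-tuple T) :
  measurable_fun setT f -> measurable_fun setT g ->
  measurable_fun setT (fun u => riesz_prod n al (f u) (g u)).
Proof.
move=> mf mg; apply: measurable_prod => i _.
by apply: measurable_dist_powR; exact: measurable_nth_tuple.
Qed.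

Lemma measurable_bracket_prod n d (U : measurableType d) (q w : R) (f : U -> n.-tuple T) :
  measurable_fun setT f -> measurable_fun setT (fun u => bracket_prod n q w (f u)).
Proof.
move=> mf; apply: measurable_prod => i _.
apply: (measurableT_comp (measurable_powR _)); apply: measurable_funD => //.
by apply: measurable_funX; exact: measurable_freq.
Qed.

Lemma simplex_damping_cons_le n (t w a c : R) s xi (D : R) :
  (0 < a < t -> a < (rcons s t)`_0 <= t -> ordered t s ->
   expR (- (((rcons s t)`_0 - a) * (w + c) ^+ 2 / 2)) <= D) -> 0 <= D ->
  simplex_damping n.+1 t w (a :: s) (c :: xi) <=
  simplex_damping n t (w + c) s xi * ((0 < a < t)%R%:R * D).
Proof.
move=> h D0; rewrite /simplex_damping dampingS.
case: (boolP (ordered t (a :: s))) => [/ordered_cons[a0t alt ords]|_]; last first.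
  by rewrite mul0r !mulr_ge0// ltW// damping_gt0.
rewrite ords a0t !mul1r mulrC; apply: ler_wpM2l; last exact: h.
by rewrite ltW// damping_gt0.
Qed.

(** Each gap is small with an integrable singularity of order q < 1, which buys
    decay of order q in every partial sum of the frequencies. *)
Lemma simplex_damping_integral_le (t q : R) : 0 < t -> 0 <= q < 1 ->
  exists2 C : R, 0 < C & forall n w (xi : n.-tuple R),
    (\int[leb R n]_s (simplex_damping n t w s xi)%:E <=
     (C ^+ n * bracket_prod n (- q) w xi)%:E)%E.
Proof.
move=> t0 /andP[q0 q1].
have [Ce Ce0 hCe] := expR_le_powR t0 (introT andP (conj q0 (ltW q1))).
have [D D0 hD] := singular_kernel_bounded t0 (introT andP (conj q0 q1)).
exists (D * Ce) => [|n]; first by rewrite mulr_gt0.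
elim: n => [|n IH] w xi.
  rewrite integral_leb0 /simplex_damping /damping /bracket_prod !big_ord0 !mulr1 expr0.
  by rewrite lee_fin; case: (ordered _ _).
case/tupleP: xi => c xi; rewrite bracket_prodS; set u := 1 + (w + c) ^+ 2.
have u0 : 0 < u by exact: bracket_gt0.
pose k (s : n.-tuple R) a := Ce * u `^ (- q) * singular_kernel t q (rcons s t)`_0 a.
have k0 s a : 0 <= k s a by rewrite mulr_ge0 ?singular_kernel_ge0// mulr_ge0 ?powR_ge0// ltW.
have ms s : measurable_fun setT (singular_kernel t q (rcons s t)`_0 : T -> R).
  exact: measurable_singular_kernel.
have c0 : 0 <= Ce * u `^ (- q) by rewrite mulr_ge0 ?powR_ge0// ltW.
apply: le_trans (le_integral_peel (F := fun s => simplex_damping n.+1 t w s [tuple of c :: xi])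
  (h := fun s => simplex_damping n t (w + c) s xi) (k := k)
  (D := D * (Ce * u `^ (- q))) _ _ _ _ _ _ _ _ _) _.
- by apply: measurable_simplex_damping => //; exact: measurable_cst.
- by move=> s; exact: simplex_damping_ge0.
- by apply: measurable_simplex_damping => //; exact: measurable_cst.
- by move=> s; exact: simplex_damping_ge0.
- by move=> s; apply: measurable_funM => //; exact: ms.
- exact: k0.
- by rewrite mulr_ge0// ltW.
- move=> s; rewrite [leLHS](ge0_integralZl_real mu c0 (ms s) (singular_kernel_ge0 _ _ _)).
  by rewrite [D * _]mulrC [leRHS]EFinM; apply: lee_wpmul2l; [rewrite lee_fin|exact: hD].
- move=> a s; apply: (le_trans (@simplex_damping_cons_le n t w a c s xi
     (Ce * u `^ (- q) * `|(rcons s t)`_0 - a| `^ (- q)) _ _)).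
  + move=> /andP[a0 alt] /andP[az zt] _.
    have gap0 : 0 < (rcons s t)`_0 - a < t by rewrite subr_gt0 az/=; lra.
    apply: le_trans (hCe _ (w + c) gap0) _.
    by rewrite gtr0_norm ?subr_gt0// mulrAC.
  + by rewrite mulr_ge0 ?powR_ge0.
  + by rewrite /k /singular_kernel [X in _ * X <= _]mulrCA.
- rewrite (@le_trans _ _ ((D * (Ce * u `^ (- q)))%:E *
     ((D * Ce) ^+ n * bracket_prod n (- q) (w + c) xi)%:E)%E)//.
    by apply: lee_wpmul2l; [rewrite lee_fin mulr_ge0// ltW|exact: IH].
  by rewrite -EFinM lee_fin exprS le_eqVlt; apply/orP; left; apply/eqP; ring.
Qed.

(** Away from the local maxima of the frequencies the damping factor of the
    earliest time is simply bounded by 1: only the pole of order al < 1 coming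
    from the temporal covariance is integrated. *)
Lemma riesz_damping_peel (t al D : R) : 0 <= D ->
  (forall e, \int[mu]_a ((0 < a < t)%R%:R * `|e - a| `^ (- al))%:E <= D%:E)%E ->
  forall n w (c a : R) (xi r : n.-tuple R),
  (\int[leb R n.+1]_s (riesz_prod n.+1 al [tuple of a :: r] s *
      simplex_damping n.+1 t w s [tuple of c :: xi])%:E <=
   D%:E * \int[leb R n]_s (riesz_prod n al r s * simplex_damping n t (w + c) s xi)%:E)%E.
Proof.
move=> D0 hD n w c a xi r.
apply: (le_integral_peel (F := fun s => riesz_prod n.+1 al [tuple of a :: r] s *
      simplex_damping n.+1 t w s [tuple of c :: xi])
  (h := fun s => riesz_prod n al r s * simplex_damping n t (w + c) s xi)
  (k := fun=> singular_kernel t al a)).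
- apply: measurable_funM; first by apply: measurable_riesz_prod => //; exact: measurable_cst.
  by apply: measurable_simplex_damping => //; exact: measurable_cst.
- by move=> s; rewrite mulr_ge0 ?riesz_prod_ge0 ?simplex_damping_ge0.
- apply: measurable_funM; first by apply: measurable_riesz_prod => //; exact: measurable_cst.
  by apply: measurable_simplex_damping => //; exact: measurable_cst.
- by move=> s; rewrite mulr_ge0 ?riesz_prod_ge0 ?simplex_damping_ge0.
- by move=> s; exact: measurable_singular_kernel.
- by move=> s b; exact: singular_kernel_ge0.
- exact: D0.
- by move=> s; exact: hD.
- move=> b s; rewrite riesz_prodS /singular_kernel.
  have h : simplex_damping n.+1 t w (b :: s) (c :: xi) <=
      simplex_damping n t (w + c) s xi * ((0 < b < t)%R%:R * 1).
    apply: simplex_damping_cons_le => // /andP[b0 blt] /andP[bz zt] _.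
    rewrite -expR0 ler_expR oppr_le0 divr_ge0// mulr_ge0 ?sqr_ge0//; lra.
  rewrite mulr1 in h.
  have rp0 : 0 <= `|a - b| `^ (- al) * riesz_prod n al r s.
    by rewrite mulr_ge0 ?powR_ge0 ?riesz_prod_ge0.
  by apply: (le_trans (ler_wpM2l rp0 h)); rewrite le_eqVlt; apply/orP; left; apply/eqP; ring.
Qed.

(** The damping of the first gap is kept and traded for decay of order e in the
    first frequency. It couples the two earliest times by a singularity of order
    e on top of the two poles of the temporal covariance, so both are integrated
    at once. *)
Lemma riesz_damping_peel2 (t al e C D : R) : 0 <= D -> 0 <= C ->
  (forall a y, 0 < a < t ->
    expR (- (a * y ^+ 2 / 2)) <= C * a `^ (- e) * (1 + y ^+ 2) `^ (- e)) ->
  (forall r1 r2 : R, \int[mu]_b \int[mu]_a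
      ((0 < a < t)%R%:R * (0 < b < t)%R%:R *
       (`|r1 - a| `^ (- al) * `|b - a| `^ (- e) * `|r2 - b| `^ (- al)))%:E <= D%:E)%E ->
  forall n w (c1 c2 a1 a2 : R) (xi r : n.-tuple R),
  (\int[leb R n.+2]_s (riesz_prod n.+2 al [tuple of a1 :: [tuple of a2 :: r]] s *
      simplex_damping n.+2 t w s [tuple of c1 :: [tuple of c2 :: xi]])%:E <=
   (D * (C * (1 + (w + c1) ^+ 2) `^ (- e)))%:E *
     \int[leb R n]_s (riesz_prod n al r s * simplex_damping n t (w + c1 + c2) s xi)%:E)%E.
Proof.
move=> D0 C0 hC hD n w c1 c2 a1 a2 xi r.
set u := 1 + (w + c1) ^+ 2.
have c0 : 0 <= C * u `^ (- e) by rewrite mulr_ge0 ?powR_ge0.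
have mh : measurable_fun setT (fun s : n.-tuple T =>
    riesz_prod n al r s * simplex_damping n t (w + c1 + c2) s xi).
  apply: measurable_funM; first by apply: measurable_riesz_prod => //; exact: measurable_cst.
  by apply: measurable_simplex_damping => //; exact: measurable_cst.
have h0 (s : n.-tuple T) : 0 <= riesz_prod n al r s * simplex_damping n t (w + c1 + c2) s xi.
  by rewrite mulr_ge0 ?riesz_prod_ge0 ?simplex_damping_ge0.
rewrite EFinM -muleA -(ge0_integralZl_real (leb R n) c0 mh h0).
pose k (p : T * T) : R := (0 < p.1 < t)%R%:R * (0 < p.2 < t)%R%:R *
   (`|a1 - p.1| `^ (- al) * `|p.2 - p.1| `^ (- e) * `|a2 - p.2| `^ (- al)).
apply: (le_integral_peel2 (F := fun s => riesz_prod n.+2 al [tuple of a1 :: [tuple of a2 :: r]] s *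
      simplex_damping n.+2 t w s [tuple of c1 :: [tuple of c2 :: xi]])
  (h := fun s => C * u `^ (- e) *
     (riesz_prod n al r s * simplex_damping n t (w + c1 + c2) s xi))
  (k := k)).
- apply: measurable_funM; first by apply: measurable_riesz_prod => //; exact: measurable_cst.
  by apply: measurable_simplex_damping => //; exact: measurable_cst.
- by move=> s; rewrite mulr_ge0 ?riesz_prod_ge0 ?simplex_damping_ge0.
- by apply: measurable_funM.
- by move=> s; rewrite mulr_ge0.
- apply: measurable_funM; first by apply: measurable_funM; exact: measurable_itv_natr.
  by apply: measurable_funM; first apply: measurable_funM; exact: measurable_dist_powR.
- by move=> p; rewrite !mulr_ge0 ?powR_ge0.
- exact: D0.
- exact: hD.
- move=> a b s; rewrite !riesz_prodS /k /=.
  have h1 : simplex_damping n.+2 t w (a :: b :: s) (c1 :: c2 :: xi) <=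
      simplex_damping n.+1 t (w + c1) (b :: s) (c2 :: xi) *
      ((0 < a < t)%R%:R * (C * `|b - a| `^ (- e) * u `^ (- e))).
    apply: simplex_damping_cons_le; last by rewrite !mulr_ge0 ?powR_ge0.
    move=> /andP[q0 qlt] /andP[qz zt] _ /=; rewrite /= in qz zt.
    have gap0 : 0 < b - a < t by rewrite subr_gt0 qz/=; lra.
    apply: le_trans (hC _ (w + c1) gap0) _.
    by rewrite gtr0_norm ?subr_gt0.
  have h2 : simplex_damping n.+1 t (w + c1) (b :: s) (c2 :: xi) <=
      simplex_damping n t (w + c1 + c2) s xi * ((0 < b < t)%R%:R * 1).
    apply: simplex_damping_cons_le => // /andP[b0 blt] /andP[bz zt] _.
    rewrite -expR0 ler_expR oppr_le0 divr_ge0// mulr_ge0 ?sqr_ge0//; lra.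
  have i0 : 0 <= (0 < a < t)%R%:R * (C * `|b - a| `^ (- e) * u `^ (- e)).
    by rewrite !mulr_ge0 ?powR_ge0.
  have h3 := le_trans h1 (ler_wpM2r i0 h2).
  have rp0 : 0 <= `|a1 - a| `^ (- al) * (`|a2 - b| `^ (- al) * riesz_prod n al r s).
    by rewrite !mulr_ge0 ?powR_ge0 ?riesz_prod_ge0.
  by apply: (le_trans (ler_wpM2l rp0 h3)); rewrite le_eqVlt; apply/orP; left; apply/eqP; ring.
Qed.

End peeling_estimates.

(** * The potential of one ordering *)

Section potential.
Context {R : realType}.
Notation mu := (@lebesgue_measure R).
Notation T := (measurableTypeR R).

Lemma powR_ge1 (u p : R) : 1 <= u -> 0 <= p -> 1 <= u `^ p.
Proof.
by move=> u1 p0; rewrite -(powRr0 u); apply: ler_powR.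
Qed.

Lemma max_bracket_prod_head (p u0 u0' w : R) xi :
  (forall c xi', xi = c :: xi' -> u0 <= 1 + (w + c) ^+ 2 /\ u0' <= 1 + (w + c) ^+ 2) ->
  max_bracket_prod p u0 w xi = max_bracket_prod p u0' w xi.
Proof.
case: xi => //= c xi /(_ c xi erefl)[h h'].
by rewrite !max_r.
Qed.

(** The arithmetic shared by the cases of the induction below: D, Cn, vp, B, M
    come from the induction hypothesis, Mx is the new factor of the maxima in
    the denominator, um the new factor of the brackets in the numerator and u0p
    the credit left by the preceding bracket. *)
Lemma frac_step_le (D C Cn vp B M u0p um Mx : R) : 0 <= D -> D <= C -> 0 <= Cn ->
  0 < B -> 0 < M -> 0 < Mx -> 0 <= vp -> vp * Mx <= u0p * um ->
  D * (Cn * vp * B / M) <= C * Cn * u0p * (um * B) / (Mx * M).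
Proof.
move=> D0 DC Cn0 B0 M0 Mx0 vp0 h.
rewrite ler_pdivlMr ?mulr_gt0//.
rewrite [leLHS](_ : _ = D * (Cn * B * (vp * Mx))); last by field; rewrite gt_eqF.
rewrite [leRHS](_ : _ = C * (Cn * B * (u0p * um))); last by ring.
have B0' := ltW B0; have Mx0' := ltW Mx0.
have CB : 0 <= Cn * B by exact: mulr_ge0.
by apply: ler_pM => //; [rewrite !mulr_ge0|exact: ler_wpM2l].
Qed.

(** The heart of the upper bound. In the denominator the product of maxima
    charges u^p for the bracket u of a frequency once for each neighbouring
    maximum that it realizes, while the numerator has u^m to spend on it, with
    m >= p, and u0^p is a credit for the bracket that precedes the chain.
    If u <= u0, the first maximum is u0^p, which the credit pays, and u^m pays
    the credit of u for the remaining chain. If u0 < u and u is at most the next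
    bracket, u is charged once only. If u is larger than both neighbours it is
    charged twice, u^(2 p): there the damping of the gap that follows is kept,
    and its decay u^(-e) leaves 2 p - e <= m. The time consumed together with
    that of the peak belongs to a bracket u2 < u, which then serves as the
    preceding bracket of the rest; two peaks are never adjacent, so the gains
    are independent and the induction goes two steps down. *)
Lemma riesz_damping_integral_le (t al e p m : R) : 0 < t ->
  0 < e <= 1 -> e / 2 <= al -> al + e / 2 < 1 -> 0 <= p <= m -> 2 * p - e <= m ->
  exists2 C : R, 0 < C & forall n w (xi r : n.-tuple R) u0, 1 <= u0 ->
    (\int[leb R n]_s (riesz_prod n al r s * simplex_damping n t w s xi)%:E <=
     (C ^+ n * u0 `^ p * bracket_prod n m w xi / max_bracket_prod p u0 w xi)%:E)%E.
Proof.
move=> t0 /andP[e0 e1] eal k1 /andP[p0 pm] pem.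
have al01 : 0 <= al < 1 by apply/andP; split; lra.
have [D1 D10 hD1] := singular_kernel_bounded t0 al01.
have [D2 D20 hD2] := double_singular_bounded t0 e0 eal k1.
have e01 : 0 <= e <= 1 by rewrite e1 ltW.
have [Ce Ce0 hCe] := expR_le_powR t0 e01.
have DC : 0 < D2 * Ce by rewrite mulr_gt0.
pose C := 1 + D1 + D2 * Ce.
have C1 : 1 <= C by rewrite /C; lra.
have C0 : 0 < C by rewrite /C; lra.
have D1C : D1 <= C by rewrite /C; lra.
have D2C : D2 * Ce <= C ^+ 2.
  apply: (@le_trans _ _ C); first by rewrite /C; lra.
  by rewrite ler_eXnr.
exists C => //; elim/ltn_ind => -[_|n IH] w xi r u0 u01.
  rewrite integral_leb0 /simplex_damping /damping /bracket_prod /riesz_prod !big_ord0.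
  rewrite (tuple0 xi) /= !mulr1 mul1r divr1 expr0 mul1r lee_fin.
  by apply: le_trans (powR_ge1 u01 p0); case: (ordered _ _).
case/tupleP: xi => c xi; case/tupleP: r => a r.
have u00 : 0 < u0 by exact: lt_le_trans u01.
set u := 1 + (w + c) ^+ 2.
have u1 : 1 <= u by exact: bracket_ge1.
have u0' : 0 < u by exact: lt_le_trans u1.
have upm : u `^ p <= u `^ m by apply: ler_powR.
have p0g (z q : R) : 0 <= z `^ q by exact: powR_ge0.
have one_step v : 1 <= v -> (\int[leb R n.+1]_s (riesz_prod n.+1 al [tuple of a :: r] s *
      simplex_damping n.+1 t w s [tuple of c :: xi])%:E <=
     (D1 * (C ^+ n * v `^ p * bracket_prod n m (w + c) xi /
       max_bracket_prod p v (w + c) xi))%:E)%E.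
  move=> v1; apply: le_trans (riesz_damping_peel (ltW D10) hD1 _ _ _ _ _) _.
  by rewrite EFinM; apply: lee_wpmul2l; [rewrite lee_fin ltW|exact: IH].
have Bpos := bracket_prod_gt0 n m (w + c) xi.
have Mpos v : 1 <= v -> 0 < max_bracket_prod p v (w + c) xi.
  by move=> v1; apply: max_bracket_prod_gt0; exact: lt_le_trans v1.
have [uu0|u0u] := leP u u0.
  apply: (le_trans (one_step u u1)); rewrite lee_fin bracket_prodS -/u exprS /= -/u max_l//.
  apply: frac_step_le; rewrite ?powR_gt0 ?exprn_ge0 ?Mpos ?(ltW D10) ?(ltW C0)//.
  by rewrite mulrC ler_wpM2l.
(* When u is dominated by the next bracket, the next maximum does not see u, so
   that the preceding bracket of the remaining chain may be replaced by 1 and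
   no credit is needed. *)
have not_peak : (forall c2 xi2, tval xi = c2 :: xi2 -> u <= 1 + (w + c + c2) ^+ 2) ->
    (\int[leb R n.+1]_s (riesz_prod n.+1 al [tuple of a :: r] s *
      simplex_damping n.+1 t w s [tuple of c :: xi])%:E <=
     (C ^+ n.+1 * u0 `^ p * bracket_prod n.+1 m w [tuple of c :: xi] /
      max_bracket_prod p u0 w [tuple of c :: xi])%:E)%E.
  move=> hhead; apply: (le_trans (one_step 1 (lexx _))).
  rewrite lee_fin bracket_prodS -/u exprS /= -/u (max_r (ltW u0u)).
  rewrite (@max_bracket_prod_head p u 1) => [|c2 xi2 /hhead h]; last first.
    by split=> //; exact: bracket_ge1.
  apply: frac_step_le; rewrite ?powR_gt0 ?exprn_ge0 ?Mpos ?(ltW D10) ?(ltW C0)//.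
  rewrite powR1 mul1r; apply: (le_trans upm).
  by rewrite ler_peMl// powR_ge1.
case: n IH xi r one_step Bpos Mpos not_peak => [|n] IH xi r _ Bpos Mpos not_peak.
  by apply: not_peak => c2 xi2; rewrite (tuple0 xi).
case/tupleP: xi Bpos Mpos not_peak => c2 xi; case/tupleP: r => a2 r.
move=> Bpos Mpos not_peak.
have [uu2|u2u] := leP u (1 + (w + c + c2) ^+ 2).
  by apply: not_peak => _ _ [<- _].
move=> {not_peak Bpos Mpos}; set u2 := 1 + (w + c + c2) ^+ 2 in u2u.
have u21 : 1 <= u2 by exact: bracket_ge1.
apply: le_trans (riesz_damping_peel2 (ltW D20) (ltW Ce0) hCe hD2 _ _ _ _ _ _ _) _.
rewrite -/u; apply: le_trans (lee_wpmul2l _ (IH n _ _ _ _ u2 u21)) _ => //.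
  by rewrite lee_fin !mulr_ge0// ltW.
rewrite -EFinM lee_fin !bracket_prodS -/u -/u2 /= -/u -/u2 (max_r (ltW u0u)) (max_l (ltW u2u)).
have Bpos := bracket_prod_gt0 n m (w + c + c2) xi.
have Mpos : 0 < max_bracket_prod p u2 (w + c + c2) xi.
  by apply: max_bracket_prod_gt0; exact: lt_le_trans u21.
(* the peak: both maxima adjacent to u equal u *)
have gain : u `^ (- e) * (u `^ p * u `^ p) <= u `^ m.
  rewrite -!powRD; last 2 first.
    by apply/implyP => _; rewrite gt_eqF.
    by apply/implyP => _; rewrite gt_eqF.
  by apply: ler_powR => //; lra.
have := @frac_step_le (D2 * Ce) (C ^+ 2) (C ^+ n) (u `^ (- e) * u2 `^ p)
  (bracket_prod n m (w + c + c2) xi) (max_bracket_prod p u2 (w + c + c2) xi)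
  (u0 `^ p) (u `^ m * u2 `^ m) (u `^ p * u `^ p) (ltW DC) D2C
  (exprn_ge0 _ (ltW C0)) Bpos Mpos.
have upp : 0 < u `^ p * u `^ p by rewrite mulr_gt0 ?powR_gt0.
have vp0 : 0 <= u `^ (- e) * u2 `^ p by rewrite mulr_ge0.
move=> /(_ upp vp0) h.
have {}h := h _.
have hc : u `^ (- e) * u2 `^ p * (u `^ p * u `^ p) <= u0 `^ p * (u `^ m * u2 `^ m).
  rewrite [leLHS](_ : _ = u2 `^ p * (u `^ (- e) * (u `^ p * u `^ p))); last by ring.
  rewrite [leRHS](_ : _ = u2 `^ m * (u0 `^ p * u `^ m)); last by ring.
  apply: ler_pM => //; first by rewrite !mulr_ge0.
    exact: ler_powR.
  by apply: (le_trans gain); rewrite ler_peMl// powR_ge1.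
have {h hc} := h hc.
rewrite -(addn2 n) exprD.
set B := bracket_prod _ _ _ _; set M := max_bracket_prod _ _ _ _.
rewrite [X in X <= _ -> _](_ : _ = D2 * (Ce * u `^ (- e)) * (C ^+ n * u2 `^ p * B / M)); last by ring.
move=> h; apply: (le_trans h); rewrite le_eqVlt; apply/orP; left; apply/eqP.
by rewrite (mulrC (C ^+ n)) !mulrA.
Qed.

End potential.

(** * Integration over the frequencies *)

Section frequencies.
Context {R : realType}.
Notation mu := (@lebesgue_measure R).
Notation T := (measurableTypeR R).

Lemma prod_powR_le_max_bracket n (p w : R) (xi : n.-tuple R) : 0 <= p ->
  \prod_(i < n) `|tnth xi i| `^ (2 * p) <=
  (4 `^ p) ^+ n * max_bracket_prod p (1 + w ^+ 2) w xi.
Proof.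
move=> p0; elim: n w xi => [|n IH] w xi.
  by rewrite big_ord0 (tuple0 xi)/= expr0 mulr1.
case/tupleP: xi => c xi; rewrite big_ord_recl exprS /= tnth0.
rewrite [leRHS](_ : _ = (4 `^ p * Num.max (1 + w ^+ 2) (1 + (w + c) ^+ 2) `^ p) *
  ((4 `^ p) ^+ n * max_bracket_prod p (1 + (w + c) ^+ 2) (w + c) xi)); last by ring.
apply: ler_pM; rewrite ?powR_ge0//.
- by apply: prodr_ge0 => i _; exact: powR_ge0.
- have m0 : 0 <= Num.max (1 + w ^+ 2) (1 + (w + c) ^+ 2).
    by rewrite le_max (ltW (bracket_gt0 w)).
  rewrite powRrM (powR_mulrn 2)// real_normK ?num_real// -powRM//.
  apply: ge0_ler_powR => //; rewrite ?nnegrE ?sqr_ge0 ?mulr_ge0//.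
  have h1 : 1 + w ^+ 2 <= Num.max (1 + w ^+ 2) (1 + (w + c) ^+ 2) by rewrite le_max lexx.
  have h2 : 1 + (w + c) ^+ 2 <= Num.max (1 + w ^+ 2) (1 + (w + c) ^+ 2).
    by rewrite le_max lexx orbT.
  have : c ^+ 2 <= 2 * w ^+ 2 + 2 * (w + c) ^+ 2.
    have := sqr_ge0 (2 * w + c); nra.
  lra.
- by under eq_bigr do rewrite tnthS; exact: IH.
Qed.

(** The crude bound in which every bracket is charged twice, max(u, v) <= u v for
    u, v >= 1; it suffices when there is no temporal singularity. *)
Lemma max_bracket_prod_le n (p u0 w : R) (xi : n.-tuple R) : 0 <= p -> 1 <= u0 ->
  max_bracket_prod p u0 w xi <= u0 `^ p * bracket_prod n (2 * p) w xi.
Proof.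
move=> p0; elim: n u0 w xi => [|n IH] u0 w xi u01.
  by rewrite (tuple0 xi)/= /bracket_prod big_ord0 mulr1 powR_ge1.
case/tupleP: xi => c xi; rewrite bracket_prodS /=; set u := 1 + (w + c) ^+ 2.
have u1 : 1 <= u by exact: bracket_ge1.
have h : Num.max u0 u `^ p <= u0 `^ p * u `^ p.
  rewrite -powRM; [|lra|lra]; apply: ge0_ler_powR => //; rewrite ?nnegrE ?le_max.
  - by apply/orP; left; lra.
  - by rewrite mulr_ge0//; lra.
  - by rewrite ge_max ler_peMr// ?ler_peMl//; lra.
rewrite [leRHS](_ : _ = (u0 `^ p * u `^ p) * (u `^ p * bracket_prod n (2 * p) (w + c) xi)); last first.
  rewrite (_ : 2 * p = p + p); last by lra.
  rewrite powRD; first by ring.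
  by apply/implyP => _; rewrite gt_eqF//; lra.
apply: ler_pM; rewrite ?powR_ge0//; last exact: IH.
by apply: ltW; apply: max_bracket_prod_gt0; lra.
Qed.

(** For frequencies the first coordinate has to be the outer variable: it enters
    the partial sums of all the others. *)
Lemma ge0_integral_lebS_head n (F : n.+1.-tuple R -> \bar R) :
  measurable_fun setT F -> (forall s, 0 <= F s)%E ->
  (\int[leb R n.+1]_s F s = \int[mu]_x \int[leb R n]_s F [tuple of x :: s])%E.
Proof.
move=> mF F0; rewrite ge0_integral_lebS//.
have mc := @measurable_tuple_cons _ T n.
apply/esym; apply: (@fubini_tonelli _ _ _ _ _ mu (leb R n) (F \o tuple_cons (n:=n))) => //.
  exact: measurableT_comp.
by move=> x; exact: F0.
Qed.

(** In the partial sums as new variables the integral is a product. The change of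
    variables reduces to translations, because the bound for the last n
    coordinates is uniform in the offset w. *)
Lemma bracket_prod_integrable (l : R) : 2^-1 < l ->
  exists2 C : R, 0 < C & forall n w,
   (\int[leb R n]_xi (bracket_prod n (- l) w xi)%:E <= (C ^+ n)%:E)%E.
Proof.
move=> l2; have [C C0 hC] := japanese_bracket_integrable l2.
exists C => // n; elim: n => [|n IH] w.
  by rewrite integral_leb0 /bracket_prod big_ord0 expr0.
have mb m v : measurable_fun setT (fun xi : m.-tuple T => bracket_prod m (- l) v xi).
  exact: measurable_bracket_prod.
have b0 m v xi : 0 <= bracket_prod m (- l) v xi by rewrite ltW// bracket_prod_gt0.
rewrite ge0_integral_lebS_head; last 2 first.
- by apply/measurable_EFinP; exact: mb.
- by move=> s; rewrite lee_fin.
pose f (x : R) := (1 + (w + x) ^+ 2) `^ (- l).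
have mf : measurable_fun setT (f : T -> R).
  apply: (measurableT_comp (measurable_powR _)); apply: measurable_funD => //.
  by apply: measurable_funX; exact: measurable_funD.
have f0 x : 0 <= f x by exact: powR_ge0.
apply: (@le_trans _ _ (\int[mu]_x (C ^+ n * f x)%:E)%E).
  apply: le_nonneg_integral => c.
    by apply: integral_ge0 => xi _; rewrite lee_fin.
  under eq_integral do rewrite bracket_prodS.
  rewrite [leLHS](ge0_integralZl_real (leb R n) (f0 c) (mb n (w + c)) (b0 n (w + c))).
  by rewrite mulrC EFinM; apply: lee_wpmul2l; rewrite ?lee_fin.
have Cn0 : 0 <= C ^+ n by rewrite exprn_ge0// ltW.
rewrite [leLHS](ge0_integralZl_real mu Cn0 mf f0) exprSr EFinM.
apply: lee_wpmul2l; first by rewrite lee_fin.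
pose g (x : R) : \bar R := ((1 + x ^+ 2) `^ (- l))%:E.
have mg : measurable_fun setT g.
  apply/measurable_EFinP; apply: (measurableT_comp (measurable_powR _)).
  by apply: measurable_funD => //; exact: measurable_funX.
by rewrite [leLHS](ge0_integral_shift w mg)// => x; rewrite lee_fin powR_ge0.
Qed.

Lemma riesz_prod_perm n (al : R) (sigma : 'S_n) (r s : n.-tuple R) :
  riesz_prod n al (tuple_perm sigma r) (tuple_perm sigma s) = riesz_prod n al r s.
Proof.
rewrite /riesz_prod [RHS](reindex_inj (@perm_inj _ sigma))/=.
apply: eq_bigr => i _.
by rewrite -!(tnth_nth 0 (tuple_perm _ _)) -(tnth_nth 0 r) -(tnth_nth 0 s) !tnth_mktuple.
Qed.

Lemma riesz_prodC n (al : R) (r s : seq R) : riesz_prod n al r s = riesz_prod n al s r.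
Proof. by apply: eq_bigr => i _; rewrite distrC. Qed.

Lemma spectral_weight_perm n (H : R) (sigma : 'S_n) (xi : n.-tuple R) :
  spectral_weight H (tuple_perm sigma xi) = spectral_weight H xi.
Proof.
rewrite /spectral_weight [RHS](reindex_inj (@perm_inj _ sigma))/=.
by apply: eq_bigr => i _; rewrite tnth_mktuple.
Qed.

Lemma spectral_weight_ge0 n (H : R) (xi : n.-tuple R) : 0 <= spectral_weight H xi.
Proof. by apply: prodr_ge0 => i _; exact: powR_ge0. Qed.

Lemma spectral_weight_le n (H : R) (xi : n.-tuple R) : H <= 2^-1 ->
  spectral_weight H xi <=
  (4 `^ ((1 - 2 * H) / 2)) ^+ n * max_bracket_prod ((1 - 2 * H) / 2) 1 0 xi.
Proof.
move=> H2; have p0 : 0 <= (1 - 2 * H) / 2 by lra.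
have := prod_powR_le_max_bracket 0 xi p0.
by rewrite expr0n/= addr0 (_ : 2 * ((1 - 2 * H) / 2) = 1 - 2 * H)//; lra.
Qed.

Lemma measurable_spectral_weight n (H : R) :
  measurable_fun setT (fun xi : n.-tuple T => spectral_weight H xi).
Proof.
apply: measurable_prod => i _; apply: (measurableT_comp (measurable_powR _)).
by apply: measurableT_comp => //; exact: measurable_tnth.
Qed.

End frequencies.

(** * Mixed energies of two orderings *)

Section energy.
Context {R : realType}.
Notation mu := (@lebesgue_measure R).
Notation T := (measurableTypeR R).

Lemma measurable_simplex_damping_perm n d (U : measurableType d) (t w : R)
    (f g : U -> n.-tuple T) (sigma : 'S_n) :
  measurable_fun setT f -> measurable_fun setT g ->
  measurable_fun setT (fun u =>
    simplex_damping n t w (tuple_perm sigma (f u)) (tuple_perm sigma (g u))).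
Proof.
move=> mf mg.
by apply: (@measurable_simplex_damping R n _ U t w (fun u => tuple_perm sigma (f u))
  (fun u => tuple_perm sigma (g u))); exact: measurableT_comp (measurable_tuple_perm sigma) _.
Qed.

Definition pair_density n (t al : R) (sigma tau : 'S_n) (r s xi : n.-tuple R) : R :=
  simplex_damping n t 0 (tuple_perm sigma r) (tuple_perm sigma xi) *
  simplex_damping n t 0 (tuple_perm tau s) (tuple_perm tau xi) *
  riesz_prod n al r s.

Lemma pair_density_ge0 n (t al : R) (sigma tau : 'S_n) (r s xi : n.-tuple R) :
  0 <= pair_density t al sigma tau r s xi.
Proof. by rewrite mulr_ge0 ?riesz_prod_ge0// mulr_ge0 ?simplex_damping_ge0. Qed.

Lemma measurable_pair_density n d (U : measurableType d) (t al : R) (sigma tau : 'S_n)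
    (f g h : U -> n.-tuple T) :
  measurable_fun setT f -> measurable_fun setT g -> measurable_fun setT h ->
  measurable_fun setT (fun u => pair_density t al sigma tau (f u) (g u) (h u)).
Proof.
move=> mf mg mh; apply: measurable_funM; last exact: measurable_riesz_prod.
by apply: measurable_funM; exact: measurable_simplex_damping_perm.
Qed.

Definition pair_energy n (t al : R) (sigma tau : 'S_n) (xi : n.-tuple R) : \bar R :=
  (\int[(leb R n \x leb R n)%E]_p (pair_density t al sigma tau p.1 p.2 xi)%:E)%E.

Lemma pair_energy_fubini n (t al : R) (sigma tau : 'S_n) (xi : n.-tuple R) :
  (pair_energy t al sigma tau xi =
     \int[leb R n]_r \int[leb R n]_s (pair_density t al sigma tau r s xi)%:E)%E /\
  (pair_energy t al sigma tau xi =
     \int[leb R n]_s \int[leb R n]_r (pair_density t al sigma tau r s xi)%:E)%E.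
Proof.
pose F (p : n.-tuple T * n.-tuple T) : \bar R :=
  (pair_density t al sigma tau p.1 p.2 xi)%:E.
have mF : measurable_fun setT F.
  by apply/measurable_EFinP; apply: measurable_pair_density => //; exact: measurable_cst.
have F0 p : (0 <= F p)%E by rewrite lee_fin pair_density_ge0.
split.
  exact: (@fubini_tonelli1 _ _ _ _ _ (leb R n) (leb R n) F mF F0).
exact: (@fubini_tonelli2 _ _ _ _ _ (leb R n) (leb R n) F mF F0).
Qed.

(** The total mass of one density times the supremum of the potential of the
    other; relabelling the times brings each factor to the identity ordering,
    the temporal kernel being symmetric in the coordinates. *)
Lemma pair_energy_le n (t al a b : R) (sigma tau : 'S_n) (xi : n.-tuple R) : 0 <= b ->
  (\int[leb R n]_s (simplex_damping n t 0 s (tuple_perm sigma xi))%:E <= a%:E)%E ->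
  (forall r : n.-tuple R, \int[leb R n]_s
    (riesz_prod n al r s * simplex_damping n t 0 s (tuple_perm tau xi))%:E <= b%:E)%E ->
  (pair_energy t al sigma tau xi <= (a * b)%:E)%E.
Proof.
move=> b0 ha hb; rewrite (pair_energy_fubini t al sigma tau xi).1.
pose u r := simplex_damping n t 0 (tuple_perm sigma r) (tuple_perm sigma xi).
pose v (r s : n.-tuple R) := riesz_prod n al r s * simplex_damping n t 0 (tuple_perm tau s) (tuple_perm tau xi).
rewrite [leLHS](_ : _ = (\int[leb R n]_r \int[leb R n]_s (u r * v r s)%:E)%E); last first.
  apply: eq_integral => r _; apply: eq_integral => s _; congr EFin.
  by rewrite /pair_density /u /v; ring.
have mG (rho : 'S_n) : measurable_fun setT (fun s : n.-tuple T =>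
    simplex_damping n t 0 s (tuple_perm rho xi)).
  by apply: measurable_simplex_damping => //; exact: measurable_cst.
apply: iterated_integral_le => //.
- by move=> r; exact: simplex_damping_ge0.
- by apply: measurable_simplex_damping_perm; [|exact: measurable_cst].
- by move=> r s; rewrite mulr_ge0 ?riesz_prod_ge0 ?simplex_damping_ge0.
- move=> r; apply: measurable_funM; first by apply: measurable_riesz_prod => //; exact: measurable_cst.
  by apply: measurable_simplex_damping_perm => //; exact: measurable_cst.
- pose f (s : n.-tuple T) : \bar R := (simplex_damping n t 0 s (tuple_perm sigma xi))%:E.
  have mf : measurable_fun setT f by apply/measurable_EFinP; exact: mG.
  by rewrite [leLHS](ge0_integral_tuple_perm sigma mf) => [//|s]; rewrite lee_fin simplex_damping_ge0.
- move=> r.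
  pose f (s : n.-tuple T) : \bar R := (riesz_prod n al (tuple_perm tau r) s *
     simplex_damping n t 0 s (tuple_perm tau xi))%:E.
  have mf : measurable_fun setT f.
    apply/measurable_EFinP; apply: measurable_funM; last exact: mG.
    by apply: measurable_riesz_prod => //; exact: measurable_cst.
  apply: le_trans (hb (tuple_perm tau r)).
  rewrite [leRHS](_ : _ = \int[leb R n]_s f s)%E// -(ge0_integral_tuple_perm tau mf); last first.
    by move=> s; rewrite lee_fin mulr_ge0 ?riesz_prod_ge0 ?simplex_damping_ge0.
  by rewrite /f /v; under [leRHS]eq_integral do rewrite riesz_prod_perm.
Qed.

Lemma pair_energyC n (t al : R) (sigma tau : 'S_n) (xi : n.-tuple R) :
  pair_energy t al sigma tau xi = pair_energy t al tau sigma xi.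
Proof.
rewrite (pair_energy_fubini t al sigma tau xi).1 (pair_energy_fubini t al tau sigma xi).2.
apply: eq_integral => r _; apply: eq_integral => s _; rewrite /pair_density riesz_prodC.
by congr (_ * _)%:E; rewrite mulrC.
Qed.

(** In the previous bound the mass is taken in one ordering and the potential in
    the other, and by symmetry the roles may be exchanged. Choosing the ordering
    of smaller mass for the mass, one may replace it by the mass of the other
    ordering, which makes the product diagonal: the two orderings decouple. *)
Lemma pair_energy_le_diag n (t al : R) (sigma tau : 'S_n) (xi : n.-tuple R)
    (a b : n.-tuple R -> R) :
  (forall z, 0 <= a z) -> (forall z, 0 <= b z) ->
  (forall z : n.-tuple R, \int[leb R n]_s (simplex_damping n t 0 s z)%:E <= (a z)%:E)%E ->
  (forall (r z : n.-tuple R), \int[leb R n]_s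
    (riesz_prod n al r s * simplex_damping n t 0 s z)%:E <= (b z)%:E)%E ->
  (pair_energy t al sigma tau xi <=
    (a (tuple_perm sigma xi) * b (tuple_perm sigma xi) +
     a (tuple_perm tau xi) * b (tuple_perm tau xi))%:E)%E.
Proof.
move=> a0 b0 ha hb.
have [h|h] := leP (a (tuple_perm sigma xi)) (a (tuple_perm tau xi)).
  apply: le_trans (pair_energy_le (b0 _) (ha _) (fun r => hb r (tuple_perm tau xi))) _.
  by rewrite lee_fin -[leLHS]add0r lerD ?mulr_ge0// ler_wpM2r.
rewrite pair_energyC.
apply: le_trans (pair_energy_le (b0 _) (ha _) (fun r => hb r (tuple_perm sigma xi))) _.
by rewrite lee_fin -[leLHS]addr0 lerD ?mulr_ge0// ler_wpM2r// ltW.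
Qed.

End energy.

(** * Bounds on the chaos symbol and on the energies *)

Section sufficiency.
Context {R : realType}.
Notation mu := (@lebesgue_measure R).
Notation T := (measurableTypeR R).

(** The frequencies become the outer variable. Tonelli asks for a sigma-finite
    structure on the product measure of the two times, supplied explicitly. *)
Lemma tonelli_triple n (F : (n.-tuple T * n.-tuple T) * n.-tuple T -> \bar R) :
  measurable_fun setT F -> (forall p, 0 <= F p)%E ->
  (\int[((leb R n \x leb R n) \x leb R n)%E]_p F p =
   \int[leb R n]_xi \int[(leb R n \x leb R n)%E]_q F (q, xi))%E.
Proof.
move=> mF F0.
pose sf := Measure_isSigmaFinite.Build _ _ _ (leb R n \x leb R n)%E
   (sigma_finite_product_measure (leb R n) (leb R n)).
pose m : {sigma_finite_measure set (n.-tuple T * n.-tuple T)%type -> \bar R} :=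
  HB.pack (product_measure1 (leb R n) (leb R n)) sf.
exact: (@fubini_tonelli2 _ _ _ _ _ m (leb R n) F mF F0).
Qed.

Lemma gamma0_ge0 (H0 x : R) : 2^-1 <= H0 -> 0 <= gamma0 H0 x.
Proof. by move=> h; rewrite mulr_ge0 ?powR_ge0// mulr_ge0//; lra. Qed.

(** A stronger pole costs only a constant on a bounded range of times, so the
    exponent al may be kept away from small values. *)
Lemma gamma0_le (t H0 al : R) : 0 < t -> 2^-1 <= H0 < 1 -> 2 - 2 * H0 <= al ->
  exists2 c : R, 0 < c & forall x, `|x| <= t -> gamma0 H0 x <= c * `|x| `^ (- al).
Proof.
move=> t0 /andP[h1 h2] hal; pose d := al - (2 - 2 * H0).
have d0 : 0 <= d by rewrite /d; lra.
exists (t `^ d) => [|x xt]; first exact: powR_gt0.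
have h01 : 0 <= H0 * (2 * H0 - 1) <= 1 by apply/andP; split; nra.
have [->|x0] := eqVneq x 0.
  rewrite /gamma0 normr0 powR0; last by apply/eqP; lra.
  by rewrite mulr0 mulr_ge0 ?powR_ge0.
have nx0 : 0 < `|x| by rewrite normr_gt0.
have E : 2 * H0 - 2 = d + - al by rewrite /d; lra.
rewrite /gamma0 E powRD; last by apply/implyP => _; rewrite gt_eqF.
have dle : `|x| `^ d <= t `^ d by apply: ge0_ler_powR => //; rewrite nnegrE// ltW.
have := powR_ge0 `|x| d; have := powR_ge0 `|x| (- al).
case/andP: h01 => k0 k1 a0 b0.
rewrite mulrA; apply: ler_wpM2r => //; apply: le_trans dle.
by rewrite ler_piMl.
Qed.

Lemma ordered_range (t : R) (s : seq R) i : ordered t s -> (i < size s)%N -> 0 < s`_i < t.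
Proof.
elim: s i => // a s IH [|i] /ordered_cons[a0t _ ords] //= h.
exact: IH.
Qed.

Lemma ordered_perm_range n (t : R) (s : n.-tuple R) (sigma : 'S_n) (i : 'I_n) :
  ordered t (tuple_perm sigma s) -> 0 < tnth s i < t.
Proof.
move=> /(@ordered_range _ _ ((sigma^-1)%g i)); rewrite size_tuple ltn_ord => /(_ isT).
by rewrite -(tnth_nth 0 (tuple_perm _ _)) tnth_mktuple permKV.
Qed.

Lemma bracket_prodM n (q m w : R) xi :
  bracket_prod n q w xi * bracket_prod n m w xi = bracket_prod n (q + m) w xi.
Proof.
rewrite /bracket_prod -big_split; apply: eq_bigr => i _ /=.
by rewrite powRD//; apply/implyP => _; rewrite gt_eqF// bracket_gt0.
Qed.

Lemma measurable_chaos_symbol n d (U : measurableType d) (t : R) (f g : U -> n.-tuple T) :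
  measurable_fun setT f -> measurable_fun setT g ->
  measurable_fun setT (fun u => chaos_symbol t (f u) (g u)).
Proof.
move=> mf mg; apply: measurable_funM => //; apply: measurable_sum => sigma.
exact: measurable_simplex_damping_perm.
Qed.

Lemma chaos_symbol_le n (t : R) (s xi : n.-tuple R) :
  chaos_symbol t s xi <=
  \sum_(sigma : 'S_n) simplex_damping n t 0 (tuple_perm sigma s) (tuple_perm sigma xi).
Proof.
rewrite /chaos_symbol ler_piMl//; first by apply: sumr_ge0 => *; exact: simplex_damping_ge0.
by rewrite invf_le1 ?ltr0n ?fact_gt0// ler1n fact_gt0.
Qed.

Lemma simplex_damping_le1 n (t w : R) (s xi : n.-tuple R) : simplex_damping n t w s xi <= 1.
Proof.
rewrite /simplex_damping; case: (boolP (ordered t s)) => [os|_]; last by rewrite mul0r.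
rewrite mul1r /damping; apply: prodr_ile1 => i _; rewrite expR_ge0/= -expR0 ler_expR oppr_le0.
by rewrite divr_ge0// mulr_ge0 ?sqr_ge0// ltW//; exact: ordered_increasing_gaps.
Qed.

Lemma chaos_symbol_le1 n (t : R) (s xi : n.-tuple R) : chaos_symbol t s xi <= 1.
Proof.
rewrite /chaos_symbol mulrC ler_pdivrMr ?mul1r ?ltr0n ?fact_gt0//.
apply: le_trans (_ : \sum_(sigma : 'S_n) 1 <= _).
  by apply: ler_sum => sigma _; exact: simplex_damping_le1.
by rewrite sumr_const card_Sn.
Qed.

Lemma chaos_symbol_eq0 n (t : R) (s xi : n.-tuple R) : t <= 0 -> (0 < n)%N ->
  chaos_symbol t s xi = 0.
Proof.
move=> t0 n0; rewrite /chaos_symbol big1 ?mulr0// => sigma _.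
rewrite /simplex_damping; case: (boolP (ordered _ _)) => [|_]; last by rewrite mul0r.
by move=> /ordered_perm_range -/(_ (Ordinal n0)) /andP[a b]; lra.
Qed.

(** Each diagonal product is a product of powers of brackets. The maxima coming
    from the spectral weight cancel those in the denominator of the potential,
    and what remains is the product of the u_j^(-(q - m)), integrable because
    q - m > 1/2. *)
Lemma energy_integral_le (t al e m q H : R) n : 0 < t -> 0 <= H <= 2^-1 ->
  0 < e <= 1 -> e / 2 <= al -> al + e / 2 < 1 ->
  (1 - 2 * H) / 2 <= m -> 1 - 2 * H - e <= m -> 0 <= q < 1 -> 2^-1 < q - m ->
  exists M : R, forall sigma tau : 'S_n,
    (\int[leb R n]_xi ((spectral_weight H xi)%:E * pair_energy t al sigma tau xi) <= M%:E)%E.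
Proof.
move=> t0 /andP[H0 H2] e01 eal k1 pm pem q01 l2.
pose p := (1 - 2 * H) / 2.
have p0m : 0 <= p <= m by rewrite /p pm andbT; lra.
have pem' : 2 * p - e <= m by rewrite /p; lra.
have [Cb Cb0 hb] := riesz_damping_integral_le t0 e01 eal k1 p0m pem'.
have [Ca Ca0 ha] := simplex_damping_integral_le t0 q01.
have [Cl Cl0 hl] := bracket_prod_integrable l2.
pose a (z : n.-tuple R) := Ca ^+ n * bracket_prod n (- q) 0 z.
pose b (z : n.-tuple R) := Cb ^+ n * 1 `^ p * bracket_prod n m 0 z / max_bracket_prod p 1 0 z.
have Mp (z : n.-tuple R) : 0 < max_bracket_prod p 1 0 z by exact: max_bracket_prod_gt0.
have a0 z : 0 <= a z by rewrite mulr_ge0 ?exprn_ge0 ?(ltW Ca0)// ltW// bracket_prod_gt0.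
have b0 z : 0 <= b z.
  rewrite divr_ge0 ?(ltW (Mp z))// mulr_ge0 ?(ltW (bracket_prod_gt0 _ _ _ _))//.
  by rewrite mulr_ge0 ?powR_ge0// exprn_ge0// ltW.
pose K := 4 `^ p : R.
have K0 : 0 <= K by exact: powR_ge0.
pose X := K ^+ n * Ca ^+ n * Cb ^+ n.
have X0 : 0 <= X by rewrite !mulr_ge0// exprn_ge0// ltW.
pose B (z : n.-tuple R) := bracket_prod n (- (q - m)) 0 z.
have Wab (z : n.-tuple R) : spectral_weight H z * (a z * b z) <= X * B z.
  apply: (@le_trans _ _ (K ^+ n * max_bracket_prod p 1 0 z * (a z * b z))).
    by apply: ler_wpM2r; [exact: mulr_ge0|exact: spectral_weight_le].
  rewrite /a /b /X /B opprB addrC -bracket_prodM powR1 mulr1.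
  rewrite le_eqVlt; apply/orP; left; apply/eqP; field.
  by rewrite gt_eqF.
pose M := X * (Cl ^+ n + Cl ^+ n).
exists M => sigma tau.
have mB : measurable_fun setT (fun xi : n.-tuple T => (B xi)%:E).
  by apply/measurable_EFinP; exact: measurable_bracket_prod.
have B0 z : (0 <= (B z)%:E)%E by rewrite lee_fin ltW// bracket_prod_gt0.
have mBs (rho : 'S_n) : measurable_fun setT (fun xi : n.-tuple T => (B (tuple_perm rho xi))%:E).
  by apply: (measurableT_comp mB); exact: measurable_tuple_perm.
apply: (@le_trans _ _ (\int[leb R n]_xi (X%:E *
    ((B (tuple_perm sigma xi))%:E + (B (tuple_perm tau xi))%:E)))%E).
  apply: le_nonneg_integral => xi.
    rewrite mule_ge0 ?lee_fin ?spectral_weight_ge0// integral_ge0// => z _.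
    by rewrite lee_fin pair_density_ge0.
  have W0 : (0 <= (spectral_weight H xi)%:E)%E by rewrite lee_fin spectral_weight_ge0.
  apply: le_trans (lee_wpmul2l W0 (pair_energy_le_diag sigma tau xi a0 b0
     (fun z => ha n 0 z) (fun r z => hb n 0 z r 1 (lexx _)))) _.
  rewrite -EFinD -!EFinM lee_fin mulrDr mulrDr.
  have hs := Wab (tuple_perm sigma xi); have ht := Wab (tuple_perm tau xi).
  by rewrite !spectral_weight_perm in hs ht; exact: lerD.
have mBB : measurable_fun setT (fun xi : n.-tuple T =>
    (B (tuple_perm sigma xi))%:E + (B (tuple_perm tau xi))%:E)%E by exact: emeasurable_funD.
rewrite (ge0_integralZl _ measurableT mBB) ?lee_fin//; last by move=> z _; rewrite adde_ge0.
have -> : (M%:E = X%:E * ((Cl ^+ n)%:E + (Cl ^+ n)%:E))%E by rewrite -EFinD -EFinM.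
rewrite ge0_integralD//.
apply: lee_wpmul2l; first by rewrite lee_fin.
by apply: leeD; [rewrite (ge0_integral_tuple_perm sigma mB B0)|
  rewrite (ge0_integral_tuple_perm tau mB B0)]; exact: hl.
Qed.

End sufficiency.

(** * Finiteness of the moments *)

Section finite_moments.
Context {R : realType}.
Notation mu := (@lebesgue_measure R).
Notation T := (measurableTypeR R).

Lemma cintegral_or_pinfty_lty d (X : measurableType d) (m : {measure set X -> \bar R})
    (D : set X) (f : X -> R[i]) :
  m.-integrable D (fun x => (complex.Re (f x))%:E) ->
  (forall x, complex.Im (f x) = 0) -> measurable D ->
  (cintegral_or_pinfty m D f < +oo)%E.
Proof.
move=> h1 h2 mD; rewrite /cintegral_or_pinfty /cintegrable h1 /=.
rewrite (_ : _.-integrable _ _ = true) ?ltry//.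
apply/idP; under eq_fun do rewrite h2; exact: integrable0.
Qed.

Lemma measurable_nonneg_tuples n : measurable (@nonneg_tuples R n : set (n.-tuple T)).
Proof.
apply: (@measurable_box R n (fun=> [set x | 0 <= x])) => i.
rewrite (_ : [set x | 0 <= x] = `[0, +oo[%classic); first exact: measurable_itv.
by apply/seteqP; split => x /=; rewrite in_itv/= andbT.
Qed.

(** The integrands of the squared norm after cancellation of the phases, for
    H0 > 1/2 and for H0 = 1/2 respectively. *)
Definition chaos_density n (H0 H t : R) (p : (n.-tuple R * n.-tuple R) * n.-tuple R) : R :=
  chaos_symbol t p.1.1 p.2 * chaos_symbol t p.1.2 p.2 *
  (spectral_weight H p.2 * \prod_(i < n) gamma0 H0 (tnth p.1.1 i - tnth p.1.2 i)).

Definition white_density n (H t : R) (p : n.-tuple R * n.-tuple R) : R :=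
  chaos_symbol t p.1 p.2 * chaos_symbol t p.1 p.2 * spectral_weight H p.2.

Lemma chaos_moment2_fractional_lty n (H0 H t x : R) : H0 != 2^-1 ->
  ((leb R n \x leb R n) \x leb R n)%E.-integrable
    ((@nonneg_tuples R n `*` @nonneg_tuples R n) `*` setT)
    (fun p => (chaos_density H0 H t p)%:E) ->
  (chaos_moment2 H0 H n t x < +oo)%E.
Proof.
move=> h0 h; rewrite /chaos_moment2 /sqnorm (negbTE h0) lte_mul_pinfty ?lee_fin//.
apply: cintegral_or_pinfty_lty.
- move: h; congr (_.-integrable _ _); apply/funext => -[[r s] xi].
  by rewrite fourier_chaos_kernel_conj.
- by move=> [[r s] xi]; rewrite fourier_chaos_kernel_conj.
- apply: measurableX => //; apply: measurableX; exact: measurable_nonneg_tuples.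
Qed.

Lemma chaos_moment2_white_lty n (H0 H t x : R) : H0 = 2^-1 ->
  (leb R n \x leb R n)%E.-integrable (@nonneg_tuples R n `*` setT)
    (fun p => (white_density H t p)%:E) ->
  (chaos_moment2 H0 H n t x < +oo)%E.
Proof.
move=> h0 h; rewrite /chaos_moment2 /sqnorm h0 eqxx lte_mul_pinfty ?lee_fin//.
apply: cintegral_or_pinfty_lty.
- move: h; congr (_.-integrable _ _); apply/funext => -[s xi].
  by rewrite fourier_chaos_kernel_conj.
- by move=> [s xi]; rewrite fourier_chaos_kernel_conj.
- by apply: measurableX => //; exact: measurable_nonneg_tuples.
Qed.

Lemma chaos_density_ge0 n (H0 H t : R) p : 2^-1 <= H0 -> 0 <= @chaos_density n H0 H t p.
Proof.
move=> h; rewrite /chaos_density mulr_ge0//.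
  by rewrite mulr_ge0// chaos_symbol_ge0.
by rewrite mulr_ge0 ?spectral_weight_ge0// prodr_ge0// => i _; exact: gamma0_ge0.
Qed.

Lemma white_density_ge0 n (H t : R) p : 0 <= @white_density n H t p.
Proof. by rewrite mulr_ge0 ?spectral_weight_ge0// mulr_ge0// chaos_symbol_ge0. Qed.

Lemma measurable_chaos_density n (H0 H t : R) :
  measurable_fun setT (@chaos_density n H0 H t :
    (n.-tuple T * n.-tuple T) * n.-tuple T -> R).
Proof.
have m1 : measurable_fun setT (fun p : (n.-tuple T * n.-tuple T) * n.-tuple T => p.1.1).
  exact: measurableT_comp.
have m2 : measurable_fun setT (fun p : (n.-tuple T * n.-tuple T) * n.-tuple T => p.1.2).
  exact: measurableT_comp.
have m3 : measurable_fun setT (fun p : (n.-tuple T * n.-tuple T) * n.-tuple T => p.2).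
  exact: measurable_snd.
apply: measurable_funM.
  by apply: measurable_funM; exact: measurable_chaos_symbol.
have mW : measurable_fun setT
    (fun p : (n.-tuple T * n.-tuple T) * n.-tuple T => spectral_weight H p.2).
  exact: (measurableT_comp (@measurable_spectral_weight R n H) m3).
apply: measurable_funM; first exact: mW.
apply: measurable_prod => i _; apply: measurable_funM => //.
apply: (measurableT_comp (measurable_powR _)); apply: measurableT_comp => //.
apply: measurable_funB.
  exact: (measurableT_comp (@measurable_tnth _ T n i) m1).
exact: (measurableT_comp (@measurable_tnth _ T n i) m2).
Qed.

Lemma measurable_white_density n (H t : R) :
  measurable_fun setT (@white_density n H t : n.-tuple T * n.-tuple T -> R).
Proof.
apply: measurable_funM.
  by apply: measurable_funM; exact: measurable_chaos_symbol.
exact: (measurableT_comp (@measurable_spectral_weight R n H) measurable_snd).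
Qed.

Lemma ge0_integrable_le d (X : measurableType d) (m : {measure set X -> \bar R})
    (D : set X) (f : X -> R) (g : X -> \bar R) :
  measurable_fun setT f -> (forall x, 0 <= f x) -> (forall x, (f x)%:E <= g x)%E ->
  (\int[m]_x g x < +oo)%E -> m.-integrable D (fun x => (f x)%:E).
Proof.
move=> mf f0 fg goo; apply/integrableP; split.
  by apply: measurable_funTS; exact/measurable_EFinP.
apply: le_lt_trans goo; rewrite integral_mkcond.
apply: le_nonneg_integral => x.
  by rewrite patchE; case: ifP => _ //; exact: abse_ge0.
rewrite patchE; case: ifP => _; first by rewrite gee0_abs ?lee_fin.
by apply: le_trans (fg x); rewrite lee_fin.
Qed.

Lemma chaos_density_le n (H0 H t c al : R) (p : (n.-tuple R * n.-tuple R) * n.-tuple R) :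
  2^-1 <= H0 -> 0 < c -> (forall x, `|x| <= t -> gamma0 H0 x <= c * `|x| `^ (- al)) ->
  chaos_density H0 H t p <=
  \sum_(st : 'S_n * 'S_n) c ^+ n * (spectral_weight H p.2 *
     pair_density t al st.1 st.2 p.1.1 p.1.2 p.2).
Proof.
case: p => -[r s] xi /= h0 c0 hc; rewrite /chaos_density /=.
set P := \prod_(i < n) _; set W := spectral_weight H xi.
have P0 : 0 <= P by apply: prodr_ge0 => i _; exact: gamma0_ge0.
have W0 : 0 <= W by exact: spectral_weight_ge0.
have WP0 : 0 <= W * P by exact: mulr_ge0.
apply: le_trans (ler_wpM2r WP0 (ler_pM (chaos_symbol_ge0 _ _ _) (chaos_symbol_ge0 _ _ _)
  (chaos_symbol_le t r xi) (chaos_symbol_le t s xi))) _.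
rewrite big_distrlr /= pair_bigA /= mulr_suml; apply: ler_sum => -[sigma tau] _ /=.
rewrite /pair_density.
set A := simplex_damping _ _ _ _ _; set B := simplex_damping _ _ _ _ _.
have A0 : 0 <= A by exact: simplex_damping_ge0.
have B0 : 0 <= B by exact: simplex_damping_ge0.
rewrite [leRHS](_ : _ = A * B * (W * (c ^+ n * riesz_prod n al r s))); last by ring.
case: (boolP (ordered t (tuple_perm sigma r))) => [ordr|nordr]; last first.
  by rewrite /A /simplex_damping (negbTE nordr) !mul0r.
case: (boolP (ordered t (tuple_perm tau s))) => [ords|nords]; last first.
  by rewrite /B /simplex_damping (negbTE nords) !(mul0r, mulr0).
apply: ler_wpM2l; first exact: mulr_ge0.
apply: ler_wpM2l => //.
rewrite -[X in c ^+ X](card_ord n) -prodr_const /riesz_prod -big_split /=.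
apply: ler_prod => i _; rewrite gamma0_ge0//= -!tnth_nth.
apply: hc; have /andP[a1 a2] := ordered_perm_range i ordr.
by have /andP[b1 b2] := ordered_perm_range i ords; rewrite ler_norml; lra.
Qed.

(** Only the choice of exponents is left. With beta = 1 - 2 H, a peak needs
    beta - e <= m for some m < 1/2, that is e > beta - 1/2, whereas the double
    singularity needs e < 2 - 2 al; both can be met exactly when
    2 al + beta < 5/2, which for al = 2 - 2 H0 is the condition on H0 and H. *)
Lemma chaos_moment2_finite_fractional n (H0 H t x : R) : 0 <= t -> (0 < n)%N ->
  2^-1 < H0 < 1 -> 0 < H < 2^-1 -> 5 / 4 < 2 * H0 + H ->
  (chaos_moment2 H0 H n t x < +oo)%E.
Proof.
move=> t0 n0 /andP[h1 h2] /andP[H1 H2] cond.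
apply: chaos_moment2_fractional_lty; first by rewrite gt_eqF.
have [t0'|t0'] := leP t 0.
  under eq_fun do rewrite /chaos_density chaos_symbol_eq0// !mul0r.
  exact: integrable0.
have h1' := ltW h1.
(* Enlarging al to 3/4 is harmless, as beta < 1, and gives e <= 1/2. *)
pose al := Num.max (2 - 2 * H0) (3 / 4).
have al1 : 2 - 2 * H0 <= al by rewrite /al le_max lexx.
have al2 : 3 / 4 <= al by rewrite /al le_max lexx orbT.
have al3 : al < 1 by rewrite /al gt_max; apply/andP; split; lra.
have al4 : 2 * al + (1 - 2 * H) < 5 / 2.
  by rewrite /al; case: (leP (2 - 2 * H0) (3 / 4)) => ?; lra.
(* e is the midpoint of the interval of admissible values *)
pose lo := Num.max 0 ((1 - 2 * H) - 2^-1).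
have lo1 : 0 <= lo by rewrite /lo le_max lexx.
have lo2 : (1 - 2 * H) - 2^-1 <= lo by rewrite /lo le_max lexx orbT.
have lo3 : lo < 2 - 2 * al by rewrite /lo gt_max; apply/andP; split; lra.
pose e := (lo + (2 - 2 * al)) / 2.
have e1 : lo < e by rewrite /e; lra.
have e2 : e < 2 - 2 * al by rewrite /e; lra.
pose m := Num.max ((1 - 2 * H) / 2) (1 - 2 * H - e).
have m1 : (1 - 2 * H) / 2 <= m by rewrite /m le_max lexx.
have m2 : 1 - 2 * H - e <= m by rewrite /m le_max lexx orbT.
have m3 : m < 2^-1 by rewrite /m gt_max; apply/andP; split; lra.
(* midpoint of 1/2 + m and 1 *)
pose q := 3 / 4 + m / 2.
have [M hM] : exists M : R, forall sigma tau : 'S_n,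
    (\int[leb R n]_xi ((spectral_weight H xi)%:E * pair_energy t al sigma tau xi) <= M%:E)%E.
  by apply: (@energy_integral_le R t al e m q H n t0'); rewrite ?/q; try (apply/andP; split); lra.
have [c c0 hc] : exists2 c : R, 0 < c &
    forall x, `|x| <= t -> gamma0 H0 x <= c * `|x| `^ (- al).
  by apply: gamma0_le => //; rewrite h1' h2.
pose g (st : 'S_n * 'S_n) (p : (n.-tuple T * n.-tuple T) * n.-tuple T) : R :=
  c ^+ n * (spectral_weight H p.2 *
     pair_density t al st.1 st.2 p.1.1 p.1.2 p.2).
have g0 st p : 0 <= g st p.
  by rewrite mulr_ge0 ?exprn_ge0 ?(ltW c0)// mulr_ge0 ?spectral_weight_ge0 ?pair_density_ge0.
have m11 : measurable_fun setT (fun p : (n.-tuple T * n.-tuple T) * n.-tuple T => p.1.1).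
  exact: measurableT_comp.
have m12 : measurable_fun setT (fun p : (n.-tuple T * n.-tuple T) * n.-tuple T => p.1.2).
  exact: measurableT_comp.
have m20 : measurable_fun setT (fun p : (n.-tuple T * n.-tuple T) * n.-tuple T => p.2).
  exact: measurable_snd.
have mcore (st : 'S_n * 'S_n) : measurable_fun setT
    (fun p : (n.-tuple T * n.-tuple T) * n.-tuple T =>
      pair_density t al st.1 st.2 p.1.1 p.1.2 p.2).
  exact: measurable_pair_density.
have mg st : measurable_fun setT (fun p => (g st p)%:E).
  apply/measurable_EFinP; apply: measurable_funM => //; apply: measurable_funM; last exact: mcore.
  exact: (measurableT_comp (@measurable_spectral_weight R n H) m20).
apply: (@ge0_integrable_le _ _ _ _ _ (fun p => \sum_(st : 'S_n * 'S_n) (g st p)%:E)%E).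
- exact: measurable_chaos_density.
- by move=> p; exact: chaos_density_ge0.
- by move=> p; rewrite sumEFin lee_fin; exact: chaos_density_le.
rewrite ge0_integral_sum//; last by move=> st p _; rewrite lee_fin.
apply: lte_sum_pinfty => -[sigma tau] _.
pose g' (p : (n.-tuple T * n.-tuple T) * n.-tuple T) : R :=
  spectral_weight H p.2 * pair_density t al sigma tau p.1.1 p.1.2 p.2.
have g'0 p : 0 <= g' p by rewrite mulr_ge0 ?spectral_weight_ge0 ?pair_density_ge0.
have mg' : measurable_fun setT g'.
  apply: measurable_funM; last exact: (mcore (sigma, tau)).
  exact: (measurableT_comp (@measurable_spectral_weight R n H) m20).
have cn0 : 0 <= c ^+ n by rewrite exprn_ge0// ltW.
rewrite [ltLHS](ge0_integralZl_real _ cn0 mg' g'0) lte_mul_pinfty ?lee_fin//.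
have mg'E : measurable_fun setT (fun p => (g' p)%:E) by exact/measurable_EFinP.
rewrite [ltLHS](tonelli_triple mg'E) => [|p]; last by rewrite lee_fin.
apply: le_lt_trans (ltry M); apply: le_trans (hM sigma tau).
rewrite le_eqVlt; apply/orP; left; apply/eqP; apply: eq_integral => xi _.
rewrite [LHS](@ge0_integralZl_real _ _ R _ (spectral_weight H xi)
  (fun q : n.-tuple T * n.-tuple T => pair_density t al sigma tau q.1 q.2 xi))//.
- exact: spectral_weight_ge0.
- by apply: measurable_pair_density => //; exact: measurable_cst.
- by move=> z; exact: pair_density_ge0.
Qed.

(** There is only one vector of times and no pole: one of the two symbols is
    bounded by 1 and the mass of the other decays like the product of the
    u_j^(-q) for any q < 1. Charging every bracket twice costs u_j^(1 - 2 H),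
    and q - (1 - 2 H) > 1/2 can be achieved since H > 1/4. *)
Lemma chaos_moment2_finite_white n (H t x : R) : 0 <= t -> (0 < n)%N ->
  4^-1 < H < 2^-1 -> (chaos_moment2 2^-1 H n t x < +oo)%E.
Proof.
move=> t0 n0 /andP[H1 H2].
apply: chaos_moment2_white_lty => //.
have [t0'|t0'] := leP t 0.
  under eq_fun do rewrite /white_density chaos_symbol_eq0// !mul0r.
  exact: integrable0.
pose p := (1 - 2 * H) / 2.
(* midpoint of 1/2 + 2 p and 1 *)
pose q := (3 / 2 + 2 * p) / 2.
have p0 : 0 <= p by rewrite /p; lra.
have q01 : 0 <= q < 1 by apply/andP; split; rewrite /q /p; lra.
have l2 : 2^-1 < q - 2 * p by rewrite /q /p; lra.
have [Ca Ca0 ha] := simplex_damping_integral_le t0' q01.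
have [Cl Cl0 hl] := bracket_prod_integrable l2.
pose K := 4 `^ p : R.
pose X := K ^+ n * Ca ^+ n.
have Ca0' := ltW Ca0.
have X0 : 0 <= X by rewrite mulr_ge0// exprn_ge0// powR_ge0.
pose B (z : n.-tuple R) := bracket_prod n (- (q - 2 * p)) 0 z.
have Wa (z : n.-tuple R) :
    spectral_weight H z * (Ca ^+ n * bracket_prod n (- q) 0 z) <= X * B z.
  have a0 : 0 <= Ca ^+ n * bracket_prod n (- q) 0 z.
    by rewrite mulr_ge0 ?exprn_ge0// ltW// bracket_prod_gt0.
  have H2' := ltW H2.
  apply: (le_trans (ler_wpM2r a0 (spectral_weight_le z H2'))).
  have hM := max_bracket_prod_le 0 z p0 (lexx 1).
  rewrite powR1 mul1r in hM.
  have Ka0 : 0 <= K ^+ n * (Ca ^+ n * bracket_prod n (- q) 0 z).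
    by rewrite mulr_ge0// exprn_ge0// powR_ge0.
  have := ler_wpM2l Ka0 hM; rewrite -/p -/K.
  rewrite /X /B opprB addrC -bracket_prodM => h.
  by apply: le_trans (le_trans _ h) _; rewrite le_eqVlt; apply/orP; left; apply/eqP; ring.
pose g (sigma : 'S_n) (p : n.-tuple T * n.-tuple T) : R := spectral_weight H p.2 *
  simplex_damping n t 0 (tuple_perm sigma p.1) (tuple_perm sigma p.2).
have g0 sigma z : 0 <= g sigma z.
  by rewrite mulr_ge0 ?spectral_weight_ge0 ?simplex_damping_ge0.
have mg sigma : measurable_fun setT (fun z => (g sigma z)%:E).
  apply/measurable_EFinP; apply: measurable_funM; last exact: measurable_simplex_damping_perm.
  exact: (measurableT_comp (@measurable_spectral_weight R n H) measurable_snd).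
apply: (@ge0_integrable_le _ _ _ _ _ (fun z => \sum_(sigma : 'S_n) (g sigma z)%:E)%E).
- exact: measurable_white_density.
- by move=> z; exact: white_density_ge0.
- move=> [s xi]; rewrite sumEFin lee_fin /white_density /g /=.
  rewrite -mulr_sumr mulrC; apply: ler_wpM2l; first exact: spectral_weight_ge0.
  apply: le_trans (chaos_symbol_le t s xi).
  by rewrite ler_piMl ?chaos_symbol_ge0// chaos_symbol_le1.
rewrite ge0_integral_sum//; last by move=> st z _; rewrite lee_fin.
apply: lte_sum_pinfty => sigma _.
rewrite [ltLHS](_ : _ = \int[leb R n]_xi \int[leb R n]_s (g sigma (s, xi))%:E)%E; last first.
  apply: (@fubini_tonelli2 _ _ _ _ _ (leb R n) (leb R n) _ (mg sigma)).
  by move=> z; rewrite lee_fin.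
have mB : measurable_fun setT (fun xi : n.-tuple T => (X * B xi)%:E).
  by apply/measurable_EFinP; apply: measurable_funM => //; exact: measurable_bracket_prod.
have B0 z : 0 <= B z by rewrite ltW// bracket_prod_gt0.
have XB0 z : (0 <= (X * B z)%:E)%E by rewrite lee_fin mulr_ge0.
apply: (@le_lt_trans _ _ (\int[leb R n]_xi (X * B (tuple_perm sigma xi))%:E)%E).
  apply: le_nonneg_integral => xi.
    by apply: integral_ge0 => s _; rewrite lee_fin.
  have W0 : 0 <= spectral_weight H xi by exact: spectral_weight_ge0.
  have mS : measurable_fun setT (fun s : n.-tuple T => simplex_damping n t 0 s (tuple_perm sigma xi)).
    by apply: measurable_simplex_damping => //; exact: measurable_cst.
  have mSs : measurable_fun setT (fun s : n.-tuple T =>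
      simplex_damping n t 0 (tuple_perm sigma s) (tuple_perm sigma xi)).
    by apply: measurable_simplex_damping_perm => //; exact: measurable_cst.
  rewrite [leLHS](@ge0_integralZl_real _ _ R _ (spectral_weight H xi)
     (fun s : n.-tuple T => simplex_damping n t 0 (tuple_perm sigma s) (tuple_perm sigma xi)))//;
     last by move=> s; exact: simplex_damping_ge0.
  have mSE : measurable_fun setT (fun s : n.-tuple T =>
     (simplex_damping n t 0 s (tuple_perm sigma xi))%:E) by exact/measurable_EFinP.
  rewrite (ge0_integral_tuple_perm sigma mSE) => [|s]; last by rewrite lee_fin simplex_damping_ge0.
  have W0' : (0 <= (spectral_weight H xi)%:E)%E by rewrite lee_fin.
  apply: le_trans (lee_wpmul2l W0' (ha n 0 (tuple_perm sigma xi))) _.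
  have hs := Wa (tuple_perm sigma xi); rewrite spectral_weight_perm in hs.
  by rewrite -EFinM lee_fin.
rewrite (ge0_integral_tuple_perm sigma mB XB0).
have mB' : measurable_fun setT (fun xi : n.-tuple T => B xi) by exact: measurable_bracket_prod.
rewrite [ltLHS](ge0_integralZl_real _ X0 mB' B0) lte_mul_pinfty ?lee_fin//.
by apply: le_lt_trans (hl n 0) _; exact: ltry.
Qed.

End finite_moments.

(** * Divergence along boxes *)

Section box_divergence.
Context d (X : measurableType d) (R : realType).
Variable nu : {measure set X -> \bar R}.

Lemma box_sum_le_integral (D : set X) (f : X -> R) (E : nat * nat -> set X)
    (a : nat * nat -> R) (s : seq (nat * nat)) :
  (forall i, 0 <= a i) ->
  measurable D -> measurable_fun D f -> (forall x, D x -> 0 <= f x) ->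
  (forall i, measurable (E i)) -> uniq s -> trivIset [set` s] E ->
  (forall i, i \in s -> E i `<=` D) ->
  (forall i x, i \in s -> E i x -> a i <= f x) ->
  (\sum_(i <- s) (a i)%:E * nu (E i) <= \int[nu]_(x in D) (f x)%:E)%E.
Proof.
move=> a0 mD mf f0 mE us tE ED af.
pose U := \big[setU/set0]_(i <- s) E i.
have mU : measurable U by exact: bigsetU_measurable.
have UD : U `<=` D.
  by rewrite /U -bigcup_seq; apply: bigcup_sub => i /= si; exact: ED.
have mfE : measurable_fun D (fun x => (f x)%:E) by exact/measurable_EFinP.
apply: (@le_trans _ _ (\int[nu]_(x in U) (f x)%:E)%E); last first.
  by apply: ge0_subset_integral => // x Dx; rewrite lee_fin f0.
rewrite ge0_integral_bigsetU//; last 2 first.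
- exact: measurable_funS mfE.
- by move=> x /UD Dx; rewrite lee_fin f0.
rewrite [leLHS]big_seq [leRHS]big_seq; apply: lee_sum => i si.
rewrite -integral_cst//.
by apply: le_nonneg_integral_in => x Ex; rewrite lee_fin//; exact: af Ex.
Qed.

(** The disjoint boxes of level m contribute at least C / (m + 1) together, so the
    integral dominates a multiple of every partial sum of the harmonic series. *)
Lemma harmonic_boxes_not_integrable (D : set X) (f : X -> R)
    (E : nat * nat -> set X) (a v : nat -> R) (C : R) :
  (forall m, 0 <= a m) -> measurable D -> (forall x, D x -> 0 <= f x) ->
  (forall i, measurable (E i)) ->
  (forall i i' x, E i x -> E i' x -> i = i') ->
  (forall m j, (j < m.+1 ^ 2)%N -> E (m, j) `<=` D) ->
  (forall m j x, (j < m.+1 ^ 2)%N -> E (m, j) x -> a m <= f x) ->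
  (forall m j, (j < m.+1 ^ 2)%N -> nu (E (m, j)) = (v m)%:E) ->
  0 < C -> (forall m, C / m.+1%:R <= (m.+1 ^ 2)%:R * (a m * v m)) ->
  ~ nu.-integrable D (fun x => (f x)%:E).
Proof.
move=> a0 mD f0 mE tE ED af vE C0 hC /integrableP[mf fi].
have {}mf : measurable_fun D f by exact/measurable_EFinP.
have {}fi : (\int[nu]_(x in D) (f x)%:E < +oo)%E.
  apply: le_lt_trans fi; apply: le_nonneg_integral_in => x Dx; rewrite /= ?lee_fin ?f0//.
  exact: ler_norm.
have I0 : (0 <= \int[nu]_(x in D) (f x)%:E)%E.
  by apply: integral_ge0 => x Dx; rewrite lee_fin f0.
pose I := fine (\int[nu]_(x in D) (f x)%:E)%E.
have IE : (\int[nu]_(x in D) (f x)%:E)%E = I%:E by rewrite /I fineK// ge0_fin_numE.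
have bound M : C * series (@harmonic R) M <= I.
  pose s := [seq (m, j) | m <- iota 0 M, j <- iota 0 (m.+1 ^ 2)].
  have sP i : i \in s -> (i.2 < i.1.+1 ^ 2)%N.
    by case/allpairsPdep => m [j [_ + ->]] /=; rewrite mem_iota add0n.
  have us : uniq s.
    apply: allpairs_uniq_dep; [exact: iota_uniq|by move=> *; exact: iota_uniq|].
    by move=> [x y] [x' y'] _ _ /= [-> ->].
  have := @box_sum_le_integral D f E (fun i => a i.1) s (fun i => a0 i.1) mD mf f0 mE us.
  rewrite IE => h.
  have {}h : (\sum_(i <- s) (a i.1)%:E * nu (E i) <= I%:E)%E.
    apply: h.
    - by apply/trivIsetP => i i' _ _ ii'; rewrite -subset0 => x [Ex E'x];
        move/eqP: ii'; apply; exact: tE Ex E'x.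
    - by move=> [m j] /sP; exact: ED.
    - by move=> [m j] x /sP /= jm; exact: af.
  rewrite -lee_fin; apply: le_trans h.
  rewrite big_allpairs_dep /series mulr_sumr -sumEFin /index_iota subn0.
  rewrite [leLHS]big_seq [leRHS]big_seq; apply: lee_sum => m _.
  rewrite big_seq (eq_bigr (fun=> (a m * v m)%:E)); last first.
    by move=> j; rewrite mem_iota add0n => /= jm; rewrite vE// EFinM.
  rewrite -big_seq sumEFin big_const_seq count_predT size_iota iter_addr_0.
  by rewrite lee_fin -mulr_natl; exact: hC.
have : cvgn (series (@harmonic R)).
  apply: nondecreasing_is_cvgn.
    by apply/nondecreasing_seqP => n; rewrite seriesSr lerDl; exact: harmonic_ge0.
  exists (C^-1 * I) => _ [n _ <-]; rewrite mulrC ler_pdivlMr// mulrC; exact: bound.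
exact: dvg_harmonic.
Qed.

End box_divergence.

(** * Boxes in time and frequency *)

Section necessity.
Context {R : realType}.
Notation mu := (@lebesgue_measure R).
Notation T := (measurableTypeR R).

Lemma cintegrable_of_lty d (X : measurableType d) (m : {measure set X -> \bar R})
    (D : set X) (f : X -> R[i]) :
  (cintegral_or_pinfty m D f < +oo)%E -> m.-integrable D (fun x => (complex.Re (f x))%:E).
Proof.
by rewrite /cintegral_or_pinfty; case: ifP => // /andP[].
Qed.

Lemma chaos_moment2_fractional_integrable n (H0 H t x : R) : H0 != 2^-1 ->
  (chaos_moment2 H0 H n t x < +oo)%E ->
  ((leb R n \x leb R n) \x leb R n)%E.-integrable
    ((@nonneg_tuples R n `*` @nonneg_tuples R n) `*` setT)
    (fun p => (chaos_density H0 H t p)%:E).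
Proof.
move=> h0; rewrite /chaos_moment2 /sqnorm (negbTE h0).
set c := cintegral_or_pinfty _ _ _ => h.
have /cintegrable_of_lty : (c < +oo)%E.
  rewrite ltey; apply/eqP => cE; move: h; rewrite cE gt0_muley ?ltxx//.
congr (_.-integrable _ _); apply/funext => -[[r s] xi].
by rewrite fourier_chaos_kernel_conj.
Qed.

Lemma chaos_moment2_white_integrable n (H t x : R) :
  (chaos_moment2 2^-1 H n t x < +oo)%E ->
  (leb R n \x leb R n)%E.-integrable (@nonneg_tuples R n `*` setT)
    (fun p => (white_density H t p)%:E).
Proof.
rewrite /chaos_moment2 /sqnorm eqxx.
set c := cintegral_or_pinfty _ _ _ => h.
have /cintegrable_of_lty : (c < +oo)%E.
  rewrite ltey; apply/eqP => cE; move: h; rewrite cE gt0_muley ?ltxx//.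
congr (_.-integrable _ _); apply/funext => -[s xi].
by rewrite fourier_chaos_kernel_conj.
Qed.

Definition pair_box (A B : set R) : set (2.-tuple R) :=
  [set s | forall i, (if i == ord0 then A else B) (tnth s i)].

Lemma pair_boxE (A B : set R) (a b : R) :
  pair_box A B [tuple a; b] <-> A a /\ B b.
Proof.
split=> [h|[Aa Bb] i]; first by split; [exact: (h ord0)|exact: (h ord_max)].
by case: i => [[|[|//]] ?] //=; rewrite /tnth /=.
Qed.

Lemma tuple2P (P : 2.-tuple R -> Prop) : (forall a b, P [tuple a; b]) -> forall s, P s.
Proof.
move=> h s; case/tupleP: s => a s; case/tupleP: s => b s; rewrite (tuple0 s).
suff -> : [tuple of a :: [tuple of b :: [tuple]]] = [tuple a; b] by exact: h.
exact/val_inj.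
Qed.

Lemma measurable_pair_box (A B : set R) :
  measurable (A : set T) -> measurable (B : set T) ->
  measurable (pair_box A B : set (2.-tuple T)).
Proof.
move=> mA mB; pose F (i : 'I_2) : set T := if i == ord0 then A else B.
have mF i : measurable (F i) by rewrite /F; case: ifP.
exact: (@measurable_box R 2 F mF).
Qed.

Lemma leb_pair_box (A B : set R) (x y : R) :
  measurable (A : set T) -> measurable (B : set T) ->
  mu A = x%:E -> mu B = y%:E -> leb R 2 (pair_box A B) = (x * y)%:E.
Proof.
move=> mA mB Ax By; rewrite /pair_box.
rewrite (@tuple_measure_box _ _ _ mu 2 (fun i => if i == ord0 then A else B)); last first.
  by move=> i; case: ifP.
by rewrite big_ord_recl big_ord1/= Ax By.
Qed.

Lemma tuple_perm1 n (s : n.-tuple R) : tuple_perm 1%g s = s.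
Proof. by apply: eq_from_tnth => i; rewrite tnth_mktuple perm1. Qed.

(** The identity ordering alone suffices. The first frequency has size x and is
    damped only during a time of order x^(-2); the frequencies nearly cancel, so
    that the second partial sum stays in ]-1, 1[ and is damped by a bounded
    factor over the rest of [0, 1]. *)
Lemma chaos_symbol2_ge (x a b c e : R) : 1 <= x -> 0 < a < b -> b < 1 ->
  b - a <= 3 / (4 * x ^+ 2) -> x < c < x + 1 -> - (x + 1) < e < - x ->
  expR (- 2) / 2 <= chaos_symbol 1 [tuple a; b] [tuple c; e].
Proof.
move=> x1 /andP[a0 ab] b1 ba /andP[c1 c2] /andP[e1 e2].
rewrite /chaos_symbol (bigD1 (1%g : 'S_2) isT) !tuple_perm1 mulrC.
rewrite (_ : (2`!)%:R = 2 :> R)//; apply: ler_wpM2l => //.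
rewrite -[leLHS]addr0; apply: lerD; last by apply: sumr_ge0 => s _; exact: simplex_damping_ge0.
rewrite /simplex_damping /ordered /= a0 ab b1 /= mul1r.
rewrite !dampingS /damping big_ord0 mulr1 -expRD ler_expR /= add0r.
have x0 : 0 < x by lra.
have xx : 0 < x ^+ 2 by rewrite exprn_gt0.
have cc : c ^+ 2 <= 4 * x ^+ 2 by nra.
have h1 : (b - a) * c ^+ 2 <= 3.
  apply: (@le_trans _ _ (3 / (4 * x ^+ 2) * (4 * x ^+ 2))); last first.
    by rewrite -mulrA mulVf ?mulr1// gt_eqF// mulr_gt0.
  by apply: ler_pM => //; [lra|exact: sqr_ge0].
have ce : (c + e) ^+ 2 <= 1 by nra.
have h2 : (1 - b) * (c + e) ^+ 2 <= 1.
  have := sqr_ge0 (c + e); nra.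
lra.
Qed.

(** The time scale on which a frequency of size m + 1 survives. *)
Definition slot (m k : nat) : set R :=
  `]k%:R / (4 * m.+1%:R ^+ 2), k.+1%:R / (4 * m.+1%:R ^+ 2)[%classic.

Lemma slotP m k (x : R) : slot m k x ->
  k%:R < x * (4 * m.+1%:R ^+ 2) < k%:R + 1.
Proof.
have N0 : 0 < 4 * m.+1%:R ^+ 2 :> R by rewrite mulr_gt0// exprn_gt0.
rewrite /slot/= in_itv/= ltr_pdivrMr// ltr_pdivlMr// => /andP[-> h].
by rewrite natr1.
Qed.

Lemma lebesgue_measure_slot m k : mu (slot m k) = ((4 * m.+1%:R ^+ 2)^-1)%:E.
Proof.
have N0 : 0 < 4 * m.+1%:R ^+ 2 :> R by rewrite mulr_gt0// exprn_gt0.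
rewrite /slot lebesgue_measure_itv/= lte_fin ltr_pM2r ?invr_gt0// ltr_nat ltnSn.
by rewrite -EFinB -mulrBl -natr1 addrAC subrr add0r mul1r.
Qed.

Definition freq_box m : set (2.-tuple R) :=
  pair_box `]m.+1%:R, m.+1%:R + 1[ `]- (m.+1%:R + 1), - m.+1%:R[.

Lemma leb_freq_box m : leb R 2 (freq_box m) = 1%E.
Proof.
rewrite (@leb_pair_box _ _ 1 1) ?mulr1//.
- rewrite lebesgue_measure_itv/= lte_fin ltrDl ltr01 -EFinB.
  by congr EFin; rewrite addrAC subrr add0r.
- rewrite lebesgue_measure_itv/= lte_fin ltrN2 ltrDl ltr01 -EFinB.
  by congr EFin; ring.
Qed.

Lemma spectral_weight2_ge m (H : R) (xi : 2.-tuple R) : H <= 2^-1 -> freq_box m xi ->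
  m.+1%:R `^ (2 * (1 - 2 * H)) <= spectral_weight H xi.
Proof.
move=> H2; elim/tuple2P: xi => c e /pair_boxE[]; rewrite /= !in_itv/= => /andP[c1 c2] /andP[e1 e2].
have x0 : 0 < m.+1%:R :> R by [].
rewrite /spectral_weight big_ord_recl big_ord1 /tnth /=.
rewrite (_ : 2 * (1 - 2 * H) = (1 - 2 * H) + (1 - 2 * H)); last by ring.
rewrite powRD; last by apply/implyP => _; rewrite gt_eqF.
apply: ler_pM; rewrite ?powR_ge0//; apply: ge0_ler_powR; rewrite ?nnegrE//; try lra.
  by rewrite gtr0_norm; lra.
by rewrite ltr0_norm; lra.
Qed.

End necessity.

(** * Divergence of the second chaos *)

Section divergence.
Context {R : realType}.
Notation mu := (@lebesgue_measure R).
Notation T := (measurableTypeR R).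

Lemma gamma0_ge (H0 x y : R) : 2^-1 < H0 < 1 -> 1 <= x -> 0 < `|y| <= (x ^+ 2)^-1 ->
  H0 * (2 * H0 - 1) * x `^ (2 * (2 - 2 * H0)) <= gamma0 H0 y.
Proof.
move=> /andP[h1 h2] x1 /andP[y0 yx]; rewrite /gamma0.
have x0 : 0 <= x by lra.
apply: ler_wpM2l; first by rewrite mulr_ge0; lra.
have -> : x `^ (2 * (2 - 2 * H0)) = ((x ^+ 2)^-1) `^ (- (2 - 2 * H0)).
  by rewrite -(powR_invn 2 x0) -powRrM; congr (_ `^ _); ring.
rewrite (_ : 2 * H0 - 2 = - (2 - 2 * H0)); last by ring.
by apply: ler_powRN_base => //; lra.
Qed.

(** Skipping one slot leaves room for the second vector of times, which is the
    first one moved by one slot and stays ordered: the four slots k, ..., k + 3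
    alternate between the two vectors. *)
Definition time_box m k : set (2.-tuple R) := pair_box (slot m k) (slot m k.+2).

Lemma leb_time_box m k :
  leb R 2 (time_box m k) = ((4 * m.+1%:R ^+ 2)^-1 * (4 * m.+1%:R ^+ 2)^-1)%:E.
Proof. by apply: leb_pair_box; [exact: measurable_itv|exact: measurable_itv|exact: lebesgue_measure_slot..]. Qed.

Lemma measurable_time_box m k : measurable (time_box m k : set (2.-tuple T)).
Proof. by apply: measurable_pair_box; exact: measurable_itv. Qed.

Lemma measurable_freq_box m : measurable (freq_box m : set (2.-tuple T)).
Proof. by apply: measurable_pair_box; exact: measurable_itv. Qed.

Lemma mesh_gt0 m : 0 < 4 * m.+1%:R ^+ 2 :> R.
Proof. by rewrite mulr_gt0// exprn_gt0. Qed.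

Lemma chaos_symbol_box_ge m k (s xi : 2.-tuple R) : (k.+3 <= 4 * m.+1 ^ 2)%N ->
  time_box m k s -> freq_box m xi -> expR (- 2) / 2 <= chaos_symbol 1 s xi.
Proof.
move=> hk; elim/(@tuple2P R): s => a b /pair_boxE[/slotP/andP[a1 a2] /slotP/andP[b1 b2]].
elim/(@tuple2P R): xi => c e /pair_boxE[]; rewrite /= !in_itv/= => c12 e12.
have N0 := mesh_gt0 m.
have hk' : k%:R + 3 <= 4 * m.+1%:R ^+ 2 :> R.
  by rewrite -natrX -!natrM -natrD ler_nat addn3.
rewrite -(addn2 k) natrD in b1 b2.
have k0 : 0 <= k%:R :> R by [].
apply: (@chaos_symbol2_ge R m.+1%:R) => //; first by rewrite ler1n.
- by apply/andP; split; [rewrite -(pmulr_lgt0 a N0); lra|rewrite -(ltr_pM2r N0); lra].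
- by rewrite -(ltr_pM2r N0) mul1r; lra.
- by rewrite ler_pdivlMr//; lra.
Qed.

Lemma time_box_nonneg m k : time_box m k `<=` @nonneg_tuples R 2.
Proof.
elim/(@tuple2P R) => a b /pair_boxE[/slotP/andP[a1 _] /slotP/andP[b1 _]].
have N0 := mesh_gt0 m.
have k0 : 0 <= k%:R :> R by [].
have k20 : 0 <= k.+2%:R :> R by [].
move=> [[|[|//]] i]; rewrite /tnth /=; rewrite -(pmulr_lge0 _ N0); lra.
Qed.

Lemma natr_lt_succ (k k' : nat) : k%:R < k'%:R + 1 :> R -> (k <= k')%N.
Proof. by rewrite natr1 ltr_nat ltnS. Qed.

Lemma time_box_inj m k k' s : time_box m k s -> time_box m k' s -> k = k'.
Proof.
elim/(@tuple2P R): s => a b /pair_boxE[/slotP/andP[a1 a2] _] /pair_boxE[/slotP/andP[b1 b2] _].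
by apply/eqP; rewrite eqn_leq !natr_lt_succ//; lra.
Qed.

Lemma freq_box_inj m m' (xi : 2.-tuple R) : freq_box m xi -> freq_box m' xi -> m = m'.
Proof.
elim/(@tuple2P R): xi => a b /pair_boxE[+ _] /pair_boxE[+ _]; rewrite /= !in_itv/=.
move=> /andP[a1 a2] /andP[b1 b2].
by apply/eqP; rewrite -eqSS eqn_leq !natr_lt_succ//; lra.
Qed.

Lemma time_box_dist m k (r s : 2.-tuple R) (i : 'I_2) :
  time_box m k.+1 r -> time_box m k s -> 0 < `|tnth r i - tnth s i| <= (m.+1%:R ^+ 2)^-1.
Proof.
elim/(@tuple2P R): r => a b /pair_boxE[/slotP/andP[a1 a2] /slotP/andP[b1 b2]].
elim/(@tuple2P R): s => c e /pair_boxE[/slotP/andP[c1 c2] /slotP/andP[e1 e2]].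
have N0 := mesh_gt0 m; have x0 : 0 < m.+1%:R ^+ 2 :> R by rewrite exprn_gt0.
have kS : k.+1%:R = k%:R + 1 :> R by rewrite natr1.
have kSS : k.+2%:R = k%:R + 2 :> R by rewrite -natrD addn2.
have kSSS : k.+3%:R = k%:R + 3 :> R by rewrite -natrD addn3.
rewrite ?kS ?kSS ?kSSS in a1 a2 b1 b2 c1 c2 e1 e2.
have key (y z : R) : z * (4 * m.+1%:R ^+ 2) < y * (4 * m.+1%:R ^+ 2) ->
    y * (4 * m.+1%:R ^+ 2) <= z * (4 * m.+1%:R ^+ 2) + 2 ->
    0 < `|y - z| <= (m.+1%:R ^+ 2)^-1.
  rewrite ltr_pM2r// => zy yz; rewrite gtr0_norm ?subr_gt0// zy/=.
  by rewrite -(ler_pM2r x0) mulVf ?gt_eqF//; lra.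
by case: i => [[|[|//]] i]; rewrite /tnth /=; apply: key; lra.
Qed.

(** With x = m + 1, beta = 1 - 2 H and alpha = 2 - 2 H0, the density is at least of
    order x^(2 beta + 4 alpha) >= x^5 on the boxes of level m, and their x^2
    boxes have volume (4 x^2)^(-4) each: every level contributes at least a
    multiple of 1 / x. *)
Lemma chaos_density_not_integrable (H0 H : R) : 2^-1 < H0 < 1 -> 0 < H < 2^-1 ->
  2 * H0 + H <= 5 / 4 ->
  ~ ((leb R 2 \x leb R 2) \x leb R 2)%E.-integrable
    ((@nonneg_tuples R 2 `*` @nonneg_tuples R 2) `*` setT)
    (fun p => (chaos_density H0 H 1 p)%:E).
Proof.
move=> /andP[h1 h2] /andP[H1 H2] cond.
have h12 : 2^-1 < H0 < 1 by rewrite h1.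
pose E (i : nat * nat) : set ((2.-tuple T * 2.-tuple T) * 2.-tuple T) :=
  (time_box i.1 (4 * i.2).+1 `*` time_box i.1 (4 * i.2)) `*` freq_box i.1.
pose c0 := H0 * (2 * H0 - 1).
have c00 : 0 < c0 by rewrite mulr_gt0; lra.
pose K := (expR (- 2) / 2) ^+ 2 * c0 ^+ 2.
have ex0 : 0 < expR (- 2) / 2 :> R by rewrite divr_gt0// expR_gt0.
have K0 : 0 < K by rewrite mulr_gt0// exprn_gt0.
pose v (m : nat) : R := (4 * m.+1%:R ^+ 2)^-1 ^+ 4.
apply: (@harmonic_boxes_not_integrable _ _ R _ _ _ E (fun m => K * m.+1%:R ^+ 5) v (K / 256)).
- by move=> m; rewrite mulr_ge0 ?exprn_ge0// ltW.
- by apply: measurableX => //; apply: measurableX; exact: measurable_nonneg_tuples.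
- by move=> p _; apply: chaos_density_ge0; exact: ltW.
- move=> i; apply: measurableX; last exact: measurable_freq_box.
  by apply: measurableX; exact: measurable_time_box.
- move=> [m j] [m' j'] [[r s] xi] /= [[_ s1] x1] [[_ s2] x2].
  have mm : m = m' by exact: freq_box_inj x1 x2.
  rewrite -{m'}mm in s2 x2 *; congr pair.
  by have /eqP := time_box_inj s1 s2; rewrite eqn_pmul2l// => /eqP.
- move=> m j _ [[r s] xi] /= [[r1 s1] _]; split => //; split => /=.
    exact: time_box_nonneg r1.
  exact: time_box_nonneg s1.
- move=> m j [[r s] xi] jm [[/= r1 s1] x1]; rewrite /chaos_density /=.
  have x1' : 1 <= m.+1%:R :> R by rewrite ler1n.
  have x0 : 0 < m.+1%:R :> R by [].
  have j4 : (4 * j + 4 <= 4 * m.+1 ^ 2)%N by rewrite -mulnSr leq_pmul2l.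
  have gr : expR (- 2) / 2 <= chaos_symbol 1 r xi.
    by apply: chaos_symbol_box_ge r1 x1; rewrite -addn4.
  have gs : expR (- 2) / 2 <= chaos_symbol 1 s xi.
    by apply: chaos_symbol_box_ge s1 x1; apply: leq_trans j4; rewrite addn4.
  have gw := spectral_weight2_ge (ltW H2) x1.
  have gg : (c0 * m.+1%:R `^ (2 * (2 - 2 * H0))) ^+ 2 <=
      \prod_(i < 2) gamma0 H0 (tnth r i - tnth s i).
    have cp : 0 <= c0 * m.+1%:R `^ (2 * (2 - 2 * H0)).
      by apply: mulr_ge0; [exact: ltW|exact: powR_ge0].
    rewrite expr2 big_ord_recl big_ord1.
    by apply: ler_pM => //; apply: gamma0_ge => //; exact: time_box_dist r1 s1.
  have pw : m.+1%:R ^+ 5 <= m.+1%:R `^ (2 * (1 - 2 * H)) * (m.+1%:R `^ (2 * (2 - 2 * H0))) ^+ 2 :> R.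
    rewrite -(powR_mulrn 5)// -(powR_mulrn 2) ?powR_ge0// -powRrM.
    rewrite -powRD; last by apply/implyP => _; rewrite gt_eqF.
    by apply: ler_powR => //; lra.
  apply: (@le_trans _ _ ((expR (- 2) / 2) * (expR (- 2) / 2) *
    (m.+1%:R `^ (2 * (1 - 2 * H)) * (c0 * m.+1%:R `^ (2 * (2 - 2 * H0))) ^+ 2))).
    rewrite [leRHS](_ : _ = K * (m.+1%:R `^ (2 * (1 - 2 * H)) *
       (m.+1%:R `^ (2 * (2 - 2 * H0))) ^+ 2)); last by rewrite /K; ring.
    by rewrite ler_pM2l.
  have ex0' := ltW ex0.
  apply: ler_pM; [exact: mulr_ge0| |exact: ler_pM|].
    by rewrite mulr_ge0 ?powR_ge0// sqr_ge0.
  by apply: ler_pM => //; rewrite ?powR_ge0 ?sqr_ge0.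
- move=> m j _; rewrite /E /=.
  have mr := measurable_time_box m (4 * j).+1; have ms := measurable_time_box m (4 * j).
  have mx := measurable_freq_box m.
  rewrite [LHS](product_measure1E (leb R 2 \x leb R 2)%E (leb R 2) (measurableX mr ms) mx).
  rewrite [X in (X * _)%E](product_measure1E (leb R 2) (leb R 2) mr ms).
  rewrite leb_freq_box mule1 [X in (_ * X)%E](leb_time_box m (4 * j)).
  rewrite [X in (X * _)%E](leb_time_box m (4 * j).+1) -EFinM; congr EFin.
  by rewrite /v; ring.
- by rewrite divr_gt0.
- move=> m; rewrite /v natrX; set x := m.+1%:R.
  have xn0 : x != 0 by rewrite pnatr_eq0.
  by rewrite le_eqVlt; apply/orP; left; apply/eqP; field.
Qed.

(** The same with one vector of times: the density is at least of order
    x^(2 beta) >= x and the boxes have volume (4 x^2)^(-2). *)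
Lemma white_density_not_integrable (H : R) : 0 < H <= 4^-1 ->
  ~ (leb R 2 \x leb R 2)%E.-integrable (@nonneg_tuples R 2 `*` setT)
    (fun p => (white_density H 1 p)%:E).
Proof.
move=> /andP[H1 H2].
pose E (i : nat * nat) : set (2.-tuple T * 2.-tuple T) :=
  time_box i.1 (4 * i.2) `*` freq_box i.1.
pose K := (expR (- 2) / 2) ^+ 2 : R.
have ex0 : 0 < expR (- 2) / 2 :> R by rewrite divr_gt0// expR_gt0.
have K0 : 0 < K by rewrite exprn_gt0.
pose v (m : nat) : R := (4 * m.+1%:R ^+ 2)^-1 ^+ 2.
apply: (@harmonic_boxes_not_integrable _ _ R _ _ _ E (fun m => K * m.+1%:R) v (K / 16)).
- by move=> m; rewrite mulr_ge0// ltW.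
- by apply: measurableX => //; exact: measurable_nonneg_tuples.
- by move=> p _; exact: white_density_ge0.
- by move=> i; apply: measurableX; [exact: measurable_time_box|exact: measurable_freq_box].
- move=> [m j] [m' j'] [s xi] /= [s1 x1] [s2 x2].
  have mm : m = m' by exact: freq_box_inj x1 x2.
  rewrite -{m'}mm in s2 x2 *; congr pair.
  by have /eqP := time_box_inj s1 s2; rewrite eqn_pmul2l// => /eqP.
- by move=> m j _ [s xi] /= [s1 _]; split => //; exact: time_box_nonneg s1.
- move=> m j [s xi] jm [/= s1 x1]; rewrite /white_density /=.
  have x1' : 1 <= m.+1%:R :> R by rewrite ler1n.
  have j4 : (4 * j + 4 <= 4 * m.+1 ^ 2)%N by rewrite -mulnSr leq_pmul2l.
  have gs : expR (- 2) / 2 <= chaos_symbol 1 s xi.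
    by apply: chaos_symbol_box_ge s1 x1; apply: leq_trans j4; rewrite addn4.
  have H2' : H <= 2^-1 by lra.
  have gw := spectral_weight2_ge H2' x1.
  have pw : m.+1%:R <= m.+1%:R `^ (2 * (1 - 2 * H)) :> R by apply: le1r_powR => //; lra.
  have ex0' := ltW ex0; rewrite /K expr2.
  by apply: ler_pM; [exact: mulr_ge0|by []|exact: ler_pM|exact: le_trans gw].
- move=> m j _; rewrite /E /=.
  have ms := measurable_time_box m (4 * j).
  rewrite [LHS](product_measure1E (leb R 2) (leb R 2) ms (measurable_freq_box m)).
  by rewrite leb_freq_box mule1; exact: leb_time_box.
- by rewrite divr_gt0.
- move=> m; rewrite /v natrX; set x := m.+1%:R.
  have xn0 : x != 0 by rewrite pnatr_eq0.
  by rewrite le_eqVlt; apply/orP; left; apply/eqP; field.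
Qed.

End divergence.

(** * Second moments of all chaoses *)

Theorem theorem1p3 (R : realType) (H0 H : R) (hH0 : 2^-1 <= H0 < 1)
    (hH : 0 < H < 2^-1) :
  (forall (t x : R) (n : nat), 0 <= t -> (1 <= n)%N ->
     (chaos_moment2 H0 H n t x < +oo)%E) <->
  5 / 4 < 2 * H0 + H.
Proof.
case/andP: hH0 => h1 h2; case/andP: (hH) => H1 H2; split=> [fin|cond t x n t0 n0].
- have fin2 : (chaos_moment2 H0 H 2 1 0 < +oo)%E by apply: fin.
  rewrite ltNge; apply/negP => cond.
  move: h1; rewrite le_eqVlt => /predU1P[h0|h1].
    rewrite -h0 in fin2 cond.
    have /white_density_not_integrable : 0 < H <= 4^-1 by apply/andP; split; lra.
    by apply; exact: chaos_moment2_white_integrable fin2.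
  apply: (@chaos_density_not_integrable _ H0 H) => //; first by rewrite h1.
  by apply: chaos_moment2_fractional_integrable fin2; rewrite gt_eqF.
- move: h1; rewrite le_eqVlt => /predU1P[h0|h1].
    rewrite -h0 in cond *; apply: chaos_moment2_finite_white => //.
    by apply/andP; split; lra.
  by apply: chaos_moment2_finite_fractional => //; rewrite h1.
Qed.
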